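(* Let $z\neq0$ with $|\arg z|\le\pi$, and let the order $\nu$ satisfy $\nu\notin\mathbb{Z}$ and $\nu\neq\pm\frac12,\pm\frac32$. Then $$\begin{aligned}\int_z^\infty\frac{K_\nu^2(t)}{t}\,dt=\frac1{8\nu}\Biggl\{&\left(\frac z2\right)^{-2\nu}\Gamma^2(\nu)\,{}_2F_3\left(\left.\begin{array}{c}-\nu,\ \frac12-\nu\\ 1-\nu,\ 1-\nu,\ 1-2\nu\end{array}\right|z^2\right)-\left(\frac z2\right)^{2\nu}\Gamma^2(-\nu)\,{}_2F_3\left(\left.\begin{array}{c}\nu,\ \frac12+\nu\\ 1+\nu,\ 1+\nu,\ 1+2\nu\end{array}\right|z^2\right)\\&+4\pi\csc(\pi\nu)\left[\log\left(\frac z2\right)+\frac{z^2}{4(1-\nu^2)}\,{}_3F_4\left(\left.\begin{array}{c}1,\ 1,\ \frac32\\ 2,\ 2,\ 2-\nu,\ 2+\nu\end{array}\right|z^2\right)-\frac1{2\nu}-\psi(\nu)-\frac\pi2\cot(\pi\nu)\right]\Biggr\}.\end{aligned}$$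
   Context: $I_\nu(z)=(z/2)^\nu\sum_{k\ge0}\frac{(z/2)^{2k}}{k!\,\Gamma(\nu+k+1)}$ is the modified Bessel function and, for $\nu\notin\mathbb{Z}$, $K_\nu(z)=\frac\pi2\frac{I_{-\nu}(z)-I_\nu(z)}{\sin\pi\nu}$ is the Macdonald function. $\Gamma$ is the gamma function and $\psi=\Gamma'/\Gamma$ is the digamma function. The generalized hypergeometric function is ${}_pF_q\left(\left.\begin{array}{c}a_1,\dots,a_p\\ b_1,\dots,b_q\end{array}\right|x\right)=\sum_{k\ge0}\frac{(a_1)_k\cdots(a_p)_k}{(b_1)_k\cdots(b_q)_k}\frac{x^k}{k!}$ with $(\alpha)_k=\Gamma(\alpha+k)/\Gamma(\alpha)$. Multivalued functions take their principal values, with $\arg z=\pm\pi$ understood as the continuous boundary values from above/below the cut $(-\infty,0]$. The integral $\int_z^\infty$ is along a path in $|\arg t|\le\pi$, $t\neq0$, from $z$ ending at $+\infty$ along the positive real direction.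
   Formalization: At half-integer orders ν=±5/2, ±7/2, … a lower parameter 1∓2ν and an upper parameter 1/2∓ν of a 2F3 are nonpositive integers, so that series is undefined (0/0 terms); there the right-hand side is taken as its limit as the order tends to ν. *)

(* Defs.v *)
From Stdlib Require Import Reals ZArith List.
From Coquelicot Require Import Coquelicot.
Import ListNotations.

Set Implicit Arguments.

Open Scope C_scope.

(** * Elementary complex functions *)

Definition Cexp (z : C) : C :=
  RtoC (exp (Re z)) * (cos (Im z), sin (Im z)).

Definition Csin (z : C) : C := (Cexp (Ci * z) - Cexp (- (Ci * z))) / (2 * Ci).
Definition Ccos (z : C) : C := (Cexp (Ci * z) + Cexp (- (Ci * z))) / 2.
Definition Ccsc (z : C) : C := 1 / Csin z.
Definition Ccot (z : C) : C := Ccos z / Csin z.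

(* Limits and sums of complex sequences, taken componentwise; like [Lim_seq]
   and [Series], they are meaningful only in case of convergence. *)
Definition CLim_seq (u : nat -> C) : C :=
  (real (Lim_seq (fun n => Re (u n))), real (Lim_seq (fun n => Im (u n)))).
Definition CSeries (u : nat -> C) : C :=
  (Series (fun n => Re (u n)), Series (fun n => Im (u n))).

Definition Cprod (l : list C) : C := fold_right Cmult 1 l.

(** * Gamma, digamma and hypergeometric functions *)

(* Gauss's formula
     Gamma s = lim_n n! n^s / (s (s + 1) ... (s + n)),
   valid for every complex s other than 0, -1, -2, ... *)
Definition Gamma (s : C) : C :=
  CLim_seq (fun n =>
    RtoC (INR (fact n)) * Cexp (s * RtoC (ln (INR n)))
    / Cprod (map (fun j => s + RtoC (INR j)) (seq 0 (S n)))).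

Definition digamma (s : C) : C := C_derive Gamma s / Gamma s.

Definition pochhammer (a : C) (k : nat) : C :=
  Gamma (a + RtoC (INR k)) / Gamma a.

(* pFq (a | b | x), where p and q are the lengths of [a] and [b]. *)
Definition hypergeom (a b : list C) (x : C) : C :=
  CSeries (fun k =>
    Cprod (map (fun c => pochhammer c k) a)
    / Cprod (map (fun c => pochhammer c k) b)
    * (x ^ k / RtoC (INR (fact k)))).

(** * The plane cut along the negative real axis, with both sides of the cut *)

(* A nonzero complex number together with a choice of its argument.  With the
   argument in [-PI, PI], the two sides of the cut are distinct, and the
   multivalued functions below are the principal ones when |arg| < PI, extended
   continuously to each side of the cut. *)
Record cpoint := CPoint { cmod : R; carg : R }.

Definition in_cut_plane (p : cpoint) : Prop :=
  (0 < cmod p)%R /\ (Rabs (carg p) <= PI)%R.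

Definition cval (p : cpoint) : C :=
  RtoC (cmod p) * (cos (carg p), sin (carg p)).

Definition clog (p : cpoint) : C := (ln (cmod p), carg p).

Definition cpower (p : cpoint) (a : C) : C := Cexp (a * clog p).

Definition chalf (p : cpoint) : cpoint := CPoint (cmod p / 2) (carg p).

(** * Bessel functions *)

Definition besselI (nu : C) (z : cpoint) : C :=
  cpower (chalf z) nu *
  CSeries (fun k => cval (chalf z) ^ (2 * k)
    / (RtoC (INR (fact k)) * Gamma (nu + RtoC (INR k) + 1))).

Definition besselK (nu : C) (z : cpoint) : C :=
  RtoC PI / 2 * ((besselI (- nu) z - besselI nu z) / Csin (RtoC PI * nu)).

(** * Paths to infinity and integrals along them *)

Definition C1 (f : R -> R) : Prop :=
  forall x, ex_derive f x /\ continuous (Derive f) x.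

(* Piecewise C^1 on [0, +oo), with breakpoints [b 0 = 0 < b 1 < ... -> +oo]; on
   each closed piece the path is the restriction of a C^1 path defined on R. *)
Definition piecewise_C1 (gamma : R -> cpoint) : Prop :=
  exists b : nat -> R,
    b 0%nat = 0%R /\
    (forall n, (b n < b (S n))%R) /\
    is_lim_seq b p_infty /\
    forall n, exists rho theta : R -> R,
      C1 rho /\ C1 theta /\
      forall x, (b n <= x <= b (S n))%R ->
        cmod (gamma x) = rho x /\ carg (gamma x) = theta x.

(* [gamma], parametrized by [0, +oo), goes from [z] to +oo in the positive real
   direction: its modulus tends to +oo and its argument tends to 0. *)
Definition path_to_infinity (z : cpoint) (gamma : R -> cpoint) : Prop :=
  gamma 0%R = z /\
  (forall s, (0 <= s)%R -> in_cut_plane (gamma s)) /\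
  piecewise_C1 gamma /\
  is_lim (fun s => cmod (gamma s)) p_infty p_infty /\
  is_lim (fun s => carg (gamma s)) p_infty 0%R.

Definition path_velocity (gamma : R -> cpoint) (s : R) : C :=
  (Derive (fun x => Re (cval (gamma x))) s,
   Derive (fun x => Im (cval (gamma x))) s).

(* The improper integral of f(t) dt along [gamma] converges and equals [l]. *)
Definition is_path_integral
    (f : cpoint -> C) (gamma : R -> cpoint) (l : C) : Prop :=
  is_RInt_gen (V := C_R_NormedModule)
    (fun s => f (gamma s) * path_velocity gamma s)
    (at_point 0%R) (Rbar_locally p_infty) l.

(* [f w] tends to [l] as [w] tends to [a], [w <> a]. *)
Definition is_C_lim (f : C -> C) (a l : C) : Prop :=
  filterlim f (@locally' C_UniformSpace a) (@locally C_UniformSpace l).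

(* Main.v *)
(* Put z = 2 e^y, so that z d/dz becomes d/dy and dt/t becomes dy.  Expanding
   I_mu I_nu by Vandermonde's identity and integrating termwise gives explicit
   primitives of K_mu K_nu.  For mu <> nu this primitive is, up to sign, the
   Wronskian of K_mu and K_nu divided by nu^2 - mu^2, without constant of
   integration, because both sides are multiplied by the same factor when y is
   shifted by i pi; hence it vanishes at +oo.  Letting mu tend to nu produces the
   logarithm and the digamma terms, and since the decay of K_mu is uniform for mu
   near nu, the limit vanishes at +oo as well.  It is continuous in nu at the
   half-integers, which gives the limiting case.

   The decay of K_mu comes from the power series: for x -> +oo the terms of
   I_0(x) concentrate around the index x/2, where those of I_mu(x) are
   asymptotically the same, so I_{-mu}/I_mu tends to 1; its derivative in y is a
   constant divided by I_mu^2, which makes I_{-mu} - I_mu exponentially small.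
   An energy estimate along arcs extends this to a small sector. *)

Require Import Defs.
From Stdlib Require Import Reals ZArith List.
From Coquelicot Require Import Coquelicot.
From Stdlib Require Import Lra Lia Classical.
Import ListNotations.
Open Scope C_scope.

(** In the variable y = log(z/2) every function involved is entire, so the two sides of the cut and
    all branches of the powers are treated at once, and no path has to be deformed: each integral is
    an increment of one entire primitive. The coefficients are written with 1/Gamma, which is
    entire, so limits in mu meet no pole except that of the termwise primitive at mu = nu. The
    obstacle is the constant of integration. At mu = nu the cross products I_nu I_{-nu} have
    exponent 0, the shift by i pi multiplies them by 1, and the argument that kills the constant is
    void; hence mu is kept away from nu as long as possible. The Wronskian form contains 1/(nu^2 -
    mu^2) and is not uniform as mu tends to nu. It serves only to show that the primitive vanishes
    at +oo; the bound comes from integrating the decay of K_mu K_nu, whose constants depend only on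
    an upper bound for |mu| and a lower bound for |1/Gamma(mu)| and |1/Gamma(-mu)|. A sector is
    needed because the argument of the path tends to 0 and may never reach it. *)

Lemma Cmod_sub_comm (a b : C) : Cmod (a - b) = Cmod (b - a).
Proof. rewrite <- Cmod_opp. f_equal. ring. Qed.

Lemma Cmod_triangle_sub (a b : C) : (Cmod (a - b) <= Cmod a + Cmod b)%R.
Proof. unfold Cminus. rewrite <- (Cmod_opp b). apply Cmod_triangle. Qed.

Lemma Cmod_triangle_rev (a b : C) : (Cmod a - Cmod b <= Cmod (a - b))%R.
Proof.
  assert (H := Cmod_triangle (a - b) b). replace (a - b + b) with a in H by ring. lra.
Qed.

Lemma im_le_Cmod (z : C) : (Rabs (Im z) <= Cmod z)%R.
Proof. apply Rle_trans with (2 := Rmax_Cmod z). apply Rmax_r. Qed.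

Lemma Cmod_le_abs (z : C) : (Cmod z <= Rabs (Re z) + Rabs (Im z))%R.
Proof.
  replace z with (RtoC (Re z) + RtoC (Im z) * Ci) at 1.
  - eapply Rle_trans. { apply Cmod_triangle. }
    rewrite Cmod_mult, Cmod_Ci, !Cmod_R. lra.
  - destruct z as [x y]. unfold Re, Im, Ci, RtoC, Cplus, Cmult; simpl. f_equal; ring.
Qed.

Lemma Cmod_RtoC_pos (x : R) : (0 <= x)%R -> Cmod (RtoC x) = x.
Proof. intros H. rewrite Cmod_R. now apply Rabs_pos_eq. Qed.

Lemma RtoC_neq_0 (x : R) : x <> 0%R -> RtoC x <> 0.
Proof. intros H E. apply H. now apply RtoC_inj. Qed.

Lemma PI_neq0_C : RtoC PI <> 0.
Proof. apply RtoC_neq_0, PI_neq0. Qed.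

(** * Limits along a filter *)

(** Limits are expressed by the modulus instead of the uniform structure of C, which keeps the
    estimates elementary; [Clim_filterlim] converts back for the final statement. *)
Definition Clim {T : Type} (F : (T -> Prop) -> Prop) (f : T -> C) (l : C) : Prop :=
  forall eps : R, (0 < eps)%R -> F (fun t => (Cmod (f t - l) < eps)%R).

Lemma Clim_filterlim {T} (F : (T -> Prop) -> Prop) {FF : Filter F} f l :
  Clim F f l <-> filterlim f F (@locally C_UniformSpace l).
Proof.
  split.
  - intros H P HP. apply locally_C in HP. destruct HP as [d Hd].
    change (F (fun t => P (f t))). generalize (H d (cond_pos d)).
    apply filter_imp. intros t Ht. apply Hd. exact Ht.
  - intros H eps He.
    apply (H (fun w => (Cmod (w - l) < eps)%R)). apply locally_C.
    exists (mkposreal _ He). intros w Hw. exact Hw.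
Qed.

Lemma Clim_eq {T} (F : (T -> Prop) -> Prop) f l m : Clim F f l -> l = m -> Clim F f m.
Proof. now intros H <-. Qed.

Section ClimSec.
Context {T : Type} {F : (T -> Prop) -> Prop} {FF : Filter F}.

Lemma Clim_ext_loc f g l : F (fun t => f t = g t) -> Clim F f l -> Clim F g l.
Proof.
  intros E H eps He. generalize (filter_and _ _ E (H eps He)). apply filter_imp.
  intros t [<- Ht]. exact Ht.
Qed.

Lemma Clim_ext f g l : (forall t, f t = g t) -> Clim F f l -> Clim F g l.
Proof. intros E. apply Clim_ext_loc. now apply filter_forall. Qed.

Lemma Clim_const l : Clim F (fun _ => l) l.
Proof.
  intros eps He. apply filter_forall. intros _.
  replace (l - l) with (RtoC 0) by ring. now rewrite Cmod_0.
Qed.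

Lemma Clim_squeeze f l (g : T -> R) :
  F (fun t => (Cmod (f t - l) <= g t)%R) ->
  (forall eps, (0 < eps)%R -> F (fun t => (g t < eps)%R)) -> Clim F f l.
Proof.
  intros H1 H2 eps He. generalize (filter_and _ _ H1 (H2 eps He)).
  apply filter_imp. intros t [A B]. lra.
Qed.

Lemma Clim_plus f g l m : Clim F f l -> Clim F g m -> Clim F (fun t => f t + g t) (l + m).
Proof.
  intros H1 H2 eps He. assert (He' : (0 < eps / 2)%R) by lra.
  generalize (filter_and _ _ (H1 _ He') (H2 _ He')).
  apply filter_imp. intros t [A B].
  replace (f t + g t - (l + m)) with ((f t - l) + (g t - m)) by ring.
  eapply Rle_lt_trans. { apply Cmod_triangle. } lra.
Qed.

Lemma Clim_bounded f l : Clim F f l -> F (fun t => (Cmod (f t) <= Cmod l + 1)%R).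
Proof.
  intros H. generalize (H 1%R Rlt_0_1). apply filter_imp. intros t Ht.
  assert (A := Cmod_triangle_rev (f t) l). lra.
Qed.

Lemma Clim_mult f g l m : Clim F f l -> Clim F g m -> Clim F (fun t => f t * g t) (l * m).
Proof.
  intros H1 H2 eps He.
  assert (Hb := Clim_bounded _ _ H1).
  assert (P1 := Cmod_ge_0 l). assert (P2 := Cmod_ge_0 m).
  set (e := (eps / (2 * (Cmod l + 1 + Cmod m)))%R).
  assert (e0 : (0 < e)%R) by (apply Rdiv_lt_0_compat; lra).
  assert (e1 : (e * (Cmod l + 1 + Cmod m) = eps / 2)%R) by (unfold e; field; lra).
  generalize (filter_and _ _ Hb (filter_and _ _ (H1 _ e0) (H2 _ e0))).
  apply filter_imp. intros t [A [B1 B2]].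
  replace (f t * g t - l * m) with (f t * (g t - m) + (f t - l) * m) by ring.
  eapply Rle_lt_trans. { apply Cmod_triangle. } rewrite !Cmod_mult.
  assert (X1 : (Cmod (f t) * Cmod (g t - m) <= (Cmod l + 1) * e)%R)
    by (apply Rmult_le_compat; auto using Cmod_ge_0; lra).
  assert (X2 : (Cmod (f t - l) * Cmod m <= e * Cmod m)%R)
    by (apply Rmult_le_compat_r; auto using Cmod_ge_0; lra).
  lra.
Qed.

Lemma Clim_opp f l : Clim F f l -> Clim F (fun t => - f t) (- l).
Proof.
  intros H. apply Clim_ext with (fun t => (- (1)) * f t). { intros; ring. }
  replace (- l) with (- (1) * l) by ring. apply Clim_mult; auto. apply Clim_const.
Qed.

Lemma Clim_minus f g l m : Clim F f l -> Clim F g m -> Clim F (fun t => f t - g t) (l - m).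
Proof. intros. apply Clim_plus; auto. now apply Clim_opp. Qed.

Lemma Clim_nonzero f l : Clim F f l -> l <> 0 -> F (fun t => (Cmod l / 2 <= Cmod (f t))%R).
Proof.
  intros H H0. apply Cmod_gt_0 in H0. assert (H' : (0 < Cmod l / 2)%R) by lra.
  generalize (H _ H').
  apply filter_imp. intros t Ht. rewrite Cmod_sub_comm in Ht.
  assert (A := Cmod_triangle_rev l (f t)). lra.
Qed.

Lemma Clim_inv f l : Clim F f l -> l <> 0 -> Clim F (fun t => / f t) (/ l).
Proof.
  intros H H0 eps He. assert (Hb := Clim_nonzero _ _ H H0).
  assert (Hl : (0 < Cmod l)%R) by now apply Cmod_gt_0.
  set (e := (eps * (Cmod l * Cmod l / 2))%R).
  assert (e0 : (0 < e)%R) by (unfold e; apply Rmult_lt_0_compat; nra).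
  generalize (filter_and _ _ Hb (H _ e0)).
  apply filter_imp. intros t [A B].
  assert (Hf : f t <> 0) by (apply Cmod_gt_0; lra).
  replace (/ f t - / l) with (- (f t - l) * / (f t * l)) by (field; auto).
  rewrite Cmod_mult, Cmod_opp, Cmod_inv, Cmod_mult by now apply Cmult_neq_0.
  assert (P : (Cmod l * Cmod l / 2 <= Cmod (f t) * Cmod l)%R) by nra.
  assert (P' : (0 < Cmod l * Cmod l / 2)%R) by nra.
  apply Rmult_lt_reg_r with (Cmod (f t) * Cmod l)%R; [lra|].
  rewrite Rmult_assoc, Rinv_l by lra. unfold e in B.
  apply Rmult_le_compat_l with (r := eps) in P; lra.
Qed.

Lemma Clim_div f g l m : Clim F f l -> Clim F g m -> m <> 0 -> Clim F (fun t => f t / g t) (l / m).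
Proof. intros. apply Clim_mult; auto. now apply Clim_inv. Qed.

Lemma Clim_pow f l k : Clim F f l -> Clim F (fun t => f t ^ k) (l ^ k).
Proof.
  intros H. induction k as [|k IH]; [exact (Clim_const 1) | exact (Clim_mult _ _ _ _ H IH)].
Qed.
End ClimSec.

Lemma Clim_unique {T} (F : (T -> Prop) -> Prop) {FF : ProperFilter F} f l m :
  Clim F f l -> Clim F f m -> l = m.
Proof.
  intros H1 H2. apply NNPP. intros N.
  assert (Hd : (0 < Cmod (l - m))%R) by (apply Cmod_gt_0, Cminus_eq_contra, N).
  assert (Hd' : (0 < Cmod (l - m) / 2)%R) by lra.
  destruct (filter_ex _ (filter_and _ _ (H1 _ Hd') (H2 _ Hd'))) as [t [A B]].
  assert (X := Cmod_triangle_sub (f t - m) (f t - l)).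
  replace (f t - m - (f t - l)) with (l - m) in X by ring. lra.
Qed.

Lemma Clim_mod_le {T} (F : (T -> Prop) -> Prop) {FF : ProperFilter F} f l (M : R) :
  Clim F f l -> F (fun t => (Cmod (f t) <= M)%R) -> (Cmod l <= M)%R.
Proof.
  intros H1 H2. apply Rnot_lt_le. intros N.
  assert (Hd : (0 < Cmod l - M)%R) by lra.
  destruct (filter_ex _ (filter_and _ _ H2 (H1 _ Hd))) as [t [A B]].
  rewrite Cmod_sub_comm in B. assert (X := Cmod_triangle_rev l (f t)). lra.
Qed.

Lemma Clim_comp {T U} (F : (T -> Prop) -> Prop) (G : (U -> Prop) -> Prop) (f : U -> C) g l :
  Clim G f l -> filterlim g F G -> Clim F (fun t => f (g t)) l.
Proof. intros H Hg eps He. exact (Hg _ (H eps He)). Qed.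

Lemma CLim_seq_eq (u : nat -> C) l : Clim eventually u l -> CLim_seq u = l.
Proof.
  intros H. unfold CLim_seq. rewrite (surjective_pairing l).
  f_equal.
  - replace (Lim_seq _) with (Finite (fst l)); [easy|]. symmetry. apply is_lim_seq_unique.
    apply is_lim_seq_spec. intros eps. destruct (H eps (cond_pos eps)) as [N HN].
    exists N. intros n Hn. eapply Rle_lt_trans; [|apply (HN n Hn)].
    apply (re_le_Cmod (u n - l)).
  - replace (Lim_seq _) with (Finite (snd l)); [easy|]. symmetry. apply is_lim_seq_unique.
    apply is_lim_seq_spec. intros eps. destruct (H eps (cond_pos eps)) as [N HN].
    exists N. intros n Hn. eapply Rle_lt_trans; [|apply (HN n Hn)].
    apply (im_le_Cmod (u n - l)).
Qed.

Lemma Clim_Cauchy (u : nat -> C) (e : nat -> R) :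
  (forall n m, (n <= m)%nat -> (Cmod (u m - u n) <= e n)%R) ->
  is_lim_seq e 0%R ->
  Clim eventually u (CLim_seq u) /\ forall n, (Cmod (CLim_seq u - u n) <= e n)%R.
Proof.
  intros H He.
  assert (HC : exists l, Clim eventually u l).
  { assert (C1 : ex_finite_lim_seq (fun n => Re (u n)) /\ ex_finite_lim_seq (fun n => Im (u n))).
    { apply is_lim_seq_spec in He.
      split; apply ex_lim_seq_cauchy_corr; intros eps;
        destruct (He (pos_div_2 eps)) as [N HN]; exists N; intros n m Hn Hm;
        assert (A := H N n Hn); assert (B := H N m Hm);
        specialize (HN N (le_n N)); rewrite Rminus_0_r in HN;
        assert (HN' := Rle_abs (e N)); simpl in HN;
        assert (X := Cmod_triangle_sub (u n - u N) (u m - u N));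
        replace (u n - u N - (u m - u N)) with (u n - u m) in X by ring.
      - assert (Y := re_le_Cmod (u n - u m)). unfold Cminus in Y.
        rewrite re_plus, re_opp in Y. unfold Rminus. unfold Cminus in *. lra.
      - assert (Y := im_le_Cmod (u n - u m)). unfold Cminus in Y.
        rewrite im_plus, im_opp in Y. unfold Rminus. unfold Cminus in *. lra. }
    destruct C1 as [[a Ha] [b Hb]]. exists (a, b). intros eps Heps.
    apply is_lim_seq_spec in Ha. apply is_lim_seq_spec in Hb.
    assert (h2 : (0 < eps / 2)%R) by lra.
    destruct (Ha (mkposreal _ h2)) as [N1 H1]. destruct (Hb (mkposreal _ h2)) as [N2 H2].
    exists (max N1 N2). intros n Hn.
    specialize (H1 n ltac:(lia)). specialize (H2 n ltac:(lia)). simpl in H1, H2.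
    eapply Rle_lt_trans. { apply Cmod_le_abs. }
    unfold Cminus. rewrite re_plus, im_plus, re_opp, im_opp. simpl.
    unfold Rminus in *. lra. }
  destruct HC as [l Hl]. rewrite (CLim_seq_eq _ _ Hl). split; auto.
  intros n. apply (Clim_mod_le eventually (fun m => u m - u n)).
  - apply Clim_minus; auto. apply Clim_const.
  - exists n. intros m Hm. now apply H.
Qed.

(** * Absolutely convergent complex series *)

Definition Csummable (a : nat -> C) : Prop := ex_series (fun k => Cmod (a k)).

Lemma ex_series_pos_le (a b : nat -> R) :
  (forall k, (0 <= a k <= b k)%R) -> ex_series b -> ex_series a.
Proof.
  intros H Hb. apply (ex_series_le (K := R_AbsRing) (V := R_CompleteNormedModule)) with b; auto.
  intros n. unfold norm; simpl. unfold abs; simpl. rewrite Rabs_pos_eq; apply H.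
Qed.

Lemma Csummable_le (a : nat -> C) (b : nat -> R) :
  (forall k, (Cmod (a k) <= b k)%R) -> ex_series b -> Csummable a.
Proof. intros H. apply ex_series_pos_le. intros k. split; auto. apply Cmod_ge_0. Qed.

Lemma Csummable_re a : Csummable a -> ex_series (fun k => Re (a k)).
Proof.
  intros H. apply (ex_series_le (K := R_AbsRing) (V := R_CompleteNormedModule)) with (2 := H).
  intros n. apply re_le_Cmod.
Qed.

Lemma Csummable_im a : Csummable a -> ex_series (fun k => Im (a k)).
Proof.
  intros H. apply (ex_series_le (K := R_AbsRing) (V := R_CompleteNormedModule)) with (2 := H).
  intros n. apply im_le_Cmod.
Qed.

Lemma Csummable_plus a b : Csummable a -> Csummable b -> Csummable (fun k => a k + b k).
Proof.
  intros Ha Hb. apply Csummable_le with (fun k => (Cmod (a k) + Cmod (b k))%R).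
  - intros k. apply Cmod_triangle.
  - now apply (ex_series_plus (fun k => Cmod (a k)) (fun k => Cmod (b k))).
Qed.

Lemma Csummable_scal c a : Csummable a -> Csummable (fun k => c * a k).
Proof.
  intros Ha. apply Csummable_le with (fun k => (Cmod c * Cmod (a k))%R).
  - intros k. rewrite Cmod_mult. lra.
  - now apply (ex_series_scal (Cmod c) (fun k => Cmod (a k))).
Qed.

Lemma Csummable_opp a : Csummable a -> Csummable (fun k => - a k).
Proof.
  intros Ha. apply Csummable_le with (2 := Ha). intros k. rewrite Cmod_opp. lra.
Qed.

Lemma Csummable_minus a b : Csummable a -> Csummable b -> Csummable (fun k => a k - b k).
Proof. intros Ha Hb. apply Csummable_plus; auto. now apply Csummable_opp. Qed.

Lemma Csummable_incr_n a n : Csummable a -> Csummable (fun k => a (n + k)%nat).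
Proof. intros Ha. now apply (ex_series_incr_n (fun k => Cmod (a k))). Qed.

Lemma CSeries_ext a b : (forall k, a k = b k) -> CSeries a = CSeries b.
Proof. intros H. unfold CSeries. f_equal; apply Series_ext; intros k; now rewrite H. Qed.

Lemma CSeries_plus a b : Csummable a -> Csummable b ->
  CSeries (fun k => a k + b k) = CSeries a + CSeries b.
Proof.
  intros Ha Hb. unfold CSeries, Cplus; simpl. f_equal.
  - rewrite <- Series_plus; [easy | now apply Csummable_re | now apply Csummable_re].
  - rewrite <- Series_plus; [easy | now apply Csummable_im | now apply Csummable_im].
Qed.

Lemma CSeries_scal c a : Csummable a -> CSeries (fun k => c * a k) = c * CSeries a.
Proof.
  intros Ha. unfold CSeries, Cmult; simpl.
  assert (H1 := Csummable_re _ Ha). assert (H2 := Csummable_im _ Ha).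
  change (fst c) with (Re c). change (snd c) with (Im c).
  f_equal.
  - rewrite <- !Series_scal_l, <- Series_minus; try easy;
      now apply (ex_series_scal (K := R_AbsRing) (V := R_NormedModule)).
  - rewrite <- !Series_scal_l, <- Series_plus; try easy;
      now apply (ex_series_scal (K := R_AbsRing) (V := R_NormedModule)).
Qed.

Lemma CSeries_opp a : Csummable a -> CSeries (fun k => - a k) = - CSeries a.
Proof.
  intros Ha. replace (- CSeries a) with (- (1) * CSeries a) by ring.
  rewrite <- CSeries_scal by auto. apply CSeries_ext. intros; ring.
Qed.

Lemma CSeries_minus a b : Csummable a -> Csummable b ->
  CSeries (fun k => a k - b k) = CSeries a - CSeries b.
Proof.
  intros Ha Hb. unfold Cminus. rewrite <- CSeries_opp by auto.
  apply (CSeries_plus a (fun k => - b k)); auto. now apply Csummable_opp.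
Qed.

Lemma Series_ge_0 (a : nat -> R) : (forall k, (0 <= a k)%R) -> ex_series a -> (0 <= Series a)%R.
Proof.
  intros H Ha. rewrite <- (Rmult_0_l (Series a)), <- Series_scal_l.
  apply Series_le; auto. intros n. specialize (H n). lra.
Qed.

Lemma CSeries_mod_le a : Csummable a -> (Cmod (CSeries a) <= Series (fun k => Cmod (a k)))%R.
Proof.
  intros Ha. destruct (Req_dec (Cmod (CSeries a)) 0) as [E|E].
  - rewrite E. apply Series_ge_0; auto. intros n; apply Cmod_ge_0.
  - set (S := CSeries a) in *. assert (Hp : (0 < Cmod S)%R) by (assert (X := Cmod_ge_0 S); lra).
    (* Multiplying by this unit makes the sum real and positive, so that only the real parts of the
       terms count. *)
    set (u := Cconj S / RtoC (Cmod S)).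
    assert (Hu : Cmod u = 1%R).
    { unfold u. rewrite Cmod_div, Cmod_conj, Cmod_R, Rabs_pos_eq; try lra.
      - field; lra.
      - apply RtoC_neq_0; lra. }
    assert (HS : u * S = RtoC (Cmod S)).
    { unfold u. replace (Cconj S / RtoC (Cmod S) * S) with (S * Cconj S / RtoC (Cmod S)).
      - rewrite <- Cmod2_conj. simpl. rewrite Rmult_1_r, RtoC_mult. field. apply RtoC_neq_0; lra.
      - field. apply RtoC_neq_0; lra. }
    assert (HR : Cmod S = Series (fun k => Re (u * a k))).
    { transitivity (Re (u * S)). { rewrite HS. reflexivity. }
      unfold S. rewrite <- CSeries_scal by auto. reflexivity. }
    rewrite HR.
    assert (Hua := Csummable_scal u _ Ha).
    apply Rle_trans with (Rabs (Series (fun k => Re (u * a k)))); [apply Rle_abs|].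
    assert (Hab : ex_series (fun k => Rabs (Re (u * a k)))).
    { apply ex_series_pos_le with (fun k => Cmod (u * a k)); auto.
      intros k. split; [apply Rabs_pos | apply re_le_Cmod]. }
    eapply Rle_trans. { apply Series_Rabs; auto. }
    apply Series_le; auto. intros k. split; [apply Rabs_pos|].
    eapply Rle_trans. { apply re_le_Cmod. } rewrite Cmod_mult, Hu. lra.
Qed.

Lemma CSeries_mod_le_dom a (b : nat -> R) :
  (forall k, (Cmod (a k) <= b k)%R) -> ex_series b -> (Cmod (CSeries a) <= Series b)%R.
Proof.
  intros H Hb. eapply Rle_trans. { apply CSeries_mod_le. now apply Csummable_le with b. }
  apply Series_le; auto. intros n. split; auto. apply Cmod_ge_0.
Qed.

Lemma CSeries_incr_1 a : Csummable a -> CSeries a = a O + CSeries (fun k => a (S k)).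
Proof.
  intros Ha. unfold CSeries, Cplus; simpl. f_equal.
  - now rewrite Series_incr_1 by now apply Csummable_re.
  - now rewrite Series_incr_1 by now apply Csummable_im.
Qed.

Fixpoint Csum (a : nat -> C) (n : nat) : C :=
  match n with O => 0 | S m => Csum a m + a m end.

Lemma CSeries_incr_n a n : Csummable a -> CSeries a = Csum a n + CSeries (fun k => a (n + k)%nat).
Proof.
  intros Ha. induction n as [|n IH]; simpl. { unfold CSeries. now rewrite Cplus_0_l. }
  rewrite IH, (CSeries_incr_1 (fun k => a (n + k)%nat)) by now apply Csummable_incr_n.
  rewrite Nat.add_0_r, <- Cplus_assoc. do 2 f_equal.
  apply CSeries_ext. intros k. f_equal. lia.
Qed.

Lemma Clim_Csum {T} (F : (T -> Prop) -> Prop) {FF : Filter F} (f : T -> nat -> C) g n :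
  (forall k, Clim F (fun t => f t k) (g k)) -> Clim F (fun t => Csum (f t) n) (Csum g n).
Proof.
  intros H. induction n as [|n IH]; simpl; [apply Clim_const | now apply Clim_plus].
Qed.

Lemma Series_tail_small (b : nat -> R) : ex_series b ->
  forall eps, (0 < eps)%R -> exists N, (Rabs (Series (fun k => b (N + k)%nat)) < eps)%R.
Proof.
  intros Hb eps He. assert (H := Series_correct _ Hb).
  assert (L : is_lim_seq (sum_n b) (Series b)) by exact H.
  apply is_lim_seq_spec in L. destruct (L (mkposreal _ He)) as [N HN].
  exists (S N). specialize (HN N (le_n N)). simpl in HN.
  rewrite (Series_incr_n b (S N)) in HN by (auto; lia). simpl pred in HN.
  rewrite <- sum_n_Reals in HN. rewrite Rabs_minus_sym in HN.
  replace (sum_n b N + Series (fun k => b (S N + k)%nat) - sum_n b N)%R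
    with (Series (fun k => b (S N + k)%nat)) in HN by ring. exact HN.
Qed.

(** Dominated convergence for series: the domination passes to the limit [g], both tails are then
    below eps/3 from a common index on, and the heads are finite sums. *)
Lemma CSeries_tannery {T} (F : (T -> Prop) -> Prop) {FF : ProperFilter F}
  (f : T -> nat -> C) (g : nat -> C) (b : nat -> R) :
  F (fun t => forall k, (Cmod (f t k) <= b k)%R) -> ex_series b ->
  (forall k, Clim F (fun t => f t k) (g k)) ->
  Clim F (fun t => CSeries (f t)) (CSeries g).
Proof.
  intros Hf Hb Hl eps He.
  assert (Hg : forall k, (Cmod (g k) <= b k)%R).
  { intros k. apply (Clim_mod_le F (fun t => f t k)); auto.
    revert Hf. apply filter_imp. auto. }
  assert (Sg : Csummable g) by now apply Csummable_le with b.
  assert (He' : (0 < eps / 3)%R) by lra.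
  destruct (Series_tail_small b Hb _ He') as [N HN].
  generalize (filter_and _ _ Hf (Clim_Csum F f g N Hl _ He')).
  apply filter_imp. intros t [A B].
  assert (St : Csummable (f t)) by now apply Csummable_le with b.
  rewrite (CSeries_incr_n (f t) N), (CSeries_incr_n g N) by auto.
  assert (H1 : (Cmod (CSeries (fun k => f t (N + k)%nat)) < eps / 3)%R).
  { eapply Rle_lt_trans; [|exact HN]. eapply Rle_trans; [|apply Rle_abs].
    apply CSeries_mod_le_dom; auto. now apply (ex_series_incr_n b). }
  assert (H2 : (Cmod (CSeries (fun k => g (N + k)%nat)) < eps / 3)%R).
  { eapply Rle_lt_trans; [|exact HN]. eapply Rle_trans; [|apply Rle_abs].
    apply CSeries_mod_le_dom; auto. now apply (ex_series_incr_n b). }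
  set (u := CSeries (fun k => f t (N + k)%nat)) in *.
  set (v := CSeries (fun k => g (N + k)%nat)) in *.
  replace (Csum (f t) N + u - (Csum g N + v)) with ((Csum (f t) N - Csum g N) + (u - v)) by ring.
  eapply Rle_lt_trans. { apply Cmod_triangle. }
  assert (X := Cmod_triangle_sub u v). lra.
Qed.

(** * Cauchy products of series *)

Definition conv (a b : nat -> C) (n : nat) : C := Csum (fun k => a k * b (n - k)%nat) (S n).

Lemma Re_Csum a n : Re (Csum a (S n)) = sum_f_R0 (fun k => Re (a k)) n.
Proof.
  induction n as [|n IH]. { change (Csum a 1) with (0 + a O). rewrite Cplus_0_l. reflexivity. }
  change (Csum a (S (S n))) with (Csum a (S n) + a (S n)). rewrite re_plus, IH. reflexivity.
Qed.

Lemma Im_Csum a n : Im (Csum a (S n)) = sum_f_R0 (fun k => Im (a k)) n.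
Proof.
  induction n as [|n IH]. { change (Csum a 1) with (0 + a O). rewrite Cplus_0_l. reflexivity. }
  change (Csum a (S (S n))) with (Csum a (S n) + a (S n)). rewrite im_plus, IH. reflexivity.
Qed.

Lemma Csum_mod_le a n : (Cmod (Csum a (S n)) <= sum_f_R0 (fun k => Cmod (a k)) n)%R.
Proof.
  induction n as [|n IH]. { change (Csum a 1) with (0 + a O). rewrite Cplus_0_l. apply Rle_refl. }
  change (Csum a (S (S n))) with (Csum a (S n) + a (S n)).
  eapply Rle_trans. { apply Cmod_triangle. }
  apply Rplus_le_compat_r with (r := Cmod (a (S n))) in IH. exact IH.
Qed.

Lemma Csum_ext a b n : (forall k, (k < n)%nat -> a k = b k) -> Csum a n = Csum b n.
Proof.
  intros H. induction n as [|n IH]; simpl; auto. rewrite IH, H by (auto; lia).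
  reflexivity.
Qed.

Lemma Csum_scal c a n : Csum (fun k => c * a k) n = c * Csum a n.
Proof. induction n as [|n IH]; simpl; [ring | rewrite IH; ring]. Qed.

Lemma ex_series_conv (a b : nat -> R) :
  ex_series (fun k => Rabs (a k)) -> ex_series (fun k => Rabs (b k)) ->
  ex_series (fun n => sum_f_R0 (fun k => a k * b (n - k)%nat)%R n) /\
  Series (fun n => sum_f_R0 (fun k => a k * b (n - k)%nat)%R n) = (Series a * Series b)%R.
Proof.
  intros Ha Hb.
  assert (H := is_series_mult a b _ _
    (Series_correct _ (ex_series_Rabs _ Ha)) (Series_correct _ (ex_series_Rabs _ Hb)) Ha Hb).
  split; [eexists; exact H | now apply is_series_unique].
Qed.

Lemma ex_series_Rabs_Cmod a : Csummable a -> ex_series (fun k => Rabs (Cmod (a k))).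
Proof. apply ex_series_ext. intros k. now rewrite Rabs_pos_eq by apply Cmod_ge_0. Qed.

Lemma Csummable_conv a b : Csummable a -> Csummable b -> Csummable (conv a b).
Proof.
  intros Ha Hb.
  destruct (ex_series_conv (fun k => Cmod (a k)) (fun k => Cmod (b k))) as [H _];
    try now apply ex_series_Rabs_Cmod.
  apply Csummable_le with (2 := H). intros n. unfold conv.
  eapply Rle_trans. { apply Csum_mod_le. }
  apply Req_le, sum_eq. intros i _. apply Cmod_mult.
Qed.

(** The real theorem on products of series is applied to the four products of real and imaginary
    parts. *)
Lemma CSeries_conv a b : Csummable a -> Csummable b ->
  CSeries (conv a b) = CSeries a * CSeries b.
Proof.
  intros Ha Hb.
  assert (R1 : ex_series (fun k => Rabs (Re (a k)))).
  { apply ex_series_pos_le with (2 := Ha). intros; split; [apply Rabs_pos | apply re_le_Cmod]. }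
  assert (I1 : ex_series (fun k => Rabs (Im (a k)))).
  { apply ex_series_pos_le with (2 := Ha). intros; split; [apply Rabs_pos | apply im_le_Cmod]. }
  assert (R2 : ex_series (fun k => Rabs (Re (b k)))).
  { apply ex_series_pos_le with (2 := Hb). intros; split; [apply Rabs_pos | apply re_le_Cmod]. }
  assert (I2 : ex_series (fun k => Rabs (Im (b k)))).
  { apply ex_series_pos_le with (2 := Hb). intros; split; [apply Rabs_pos | apply im_le_Cmod]. }
  destruct (ex_series_conv _ _ R1 R2) as [E1 S1].
  destruct (ex_series_conv _ _ I1 I2) as [E2 S2].
  destruct (ex_series_conv _ _ R1 I2) as [E3 S3].
  destruct (ex_series_conv _ _ I1 R2) as [E4 S4].
  assert (HR : Series (fun n => Re (conv a b n)) =
    (Series (fun k => Re (a k)) * Series (fun k => Re (b k))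
     - Series (fun k => Im (a k)) * Series (fun k => Im (b k)))%R).
  { rewrite <- S1, <- S2, <- Series_minus by auto. apply Series_ext. intros n.
    unfold conv. rewrite Re_Csum, <- minus_sum. apply sum_eq. intros i _. apply re_mult. }
  assert (HI : Series (fun n => Im (conv a b n)) =
    (Series (fun k => Re (a k)) * Series (fun k => Im (b k))
     + Series (fun k => Im (a k)) * Series (fun k => Re (b k)))%R).
  { rewrite <- S3, <- S4, <- Series_plus by auto. apply Series_ext. intros n.
    unfold conv. rewrite Im_Csum, <- plus_sum. apply sum_eq. intros i _. apply im_mult. }
  unfold CSeries at 1. rewrite HR, HI. reflexivity.
Qed.

Lemma CSeries_RtoC f : CSeries (fun k => RtoC (f k)) = RtoC (Series f).
Proof.
  apply injective_projections; simpl; [reflexivity|].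
  transitivity (Series (fun k => 0 * f k)%R); [|rewrite Series_scal_l; ring].
  apply Series_ext. intros; ring.
Qed.

(** * The complex exponential *)

Lemma Re_Cexp z : Re (Cexp z) = (exp (Re z) * cos (Im z))%R.
Proof. unfold Cexp. rewrite re_scal_l. reflexivity. Qed.

Lemma Im_Cexp z : Im (Cexp z) = (exp (Re z) * sin (Im z))%R.
Proof. unfold Cexp. rewrite im_scal_l. reflexivity. Qed.

Lemma C_eq (a b : C) : Re a = Re b -> Im a = Im b -> a = b.
Proof. destruct a, b. simpl. intros -> ->. reflexivity. Qed.

Lemma Cexp_plus a b : Cexp (a + b) = Cexp a * Cexp b.
Proof.
  apply C_eq; rewrite ?re_mult, ?im_mult, ?Re_Cexp, ?Im_Cexp, re_plus, im_plus, exp_plus.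
  - rewrite cos_plus. ring.
  - rewrite sin_plus. ring.
Qed.

Lemma Cexp_RtoC (x : R) : Cexp (RtoC x) = RtoC (exp x).
Proof.
  apply C_eq; rewrite ?Re_Cexp, ?Im_Cexp; simpl; rewrite ?cos_0, ?sin_0; ring.
Qed.

Lemma Cexp_0 : Cexp 0 = 1.
Proof. rewrite Cexp_RtoC, exp_0. reflexivity. Qed.

Lemma Cmod_Cexp z : Cmod (Cexp z) = exp (Re z).
Proof.
  unfold Cexp. rewrite Cmod_mult, Cmod_RtoC_pos by (left; apply exp_pos).
  replace (Cmod (cos (Im z), sin (Im z))) with 1%R; [ring|].
  unfold Cmod. simpl. rewrite !Rmult_1_r.
  replace (cos (Im z) * cos (Im z) + sin (Im z) * sin (Im z))%R with 1%R.
  - now rewrite sqrt_1.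
  - assert (H := sin2_cos2 (Im z)). unfold Rsqr in H. lra.
Qed.

Lemma Cexp_neq_0 z : Cexp z <> 0.
Proof. apply Cmod_gt_0. rewrite Cmod_Cexp. apply exp_pos. Qed.

Lemma Cexp_opp z : Cexp (- z) = / Cexp z.
Proof.
  assert (H := Cexp_neq_0 z).
  replace (Cexp (- z)) with (Cexp (- z) * Cexp z * / Cexp z) by (field; auto).
  rewrite <- Cexp_plus. replace (- z + z) with (RtoC 0) by ring. rewrite Cexp_0. ring.
Qed.

Lemma RtoC_INR_S n : RtoC (INR (S n)) = RtoC (INR n) + 1.
Proof. rewrite S_INR. apply RtoC_plus. Qed.

Lemma Cexp_INR_mult k z : Cexp (RtoC (INR k) * z) = Cexp z ^ k.
Proof.
  induction k as [|k IH].
  - simpl. rewrite Cmult_0_l. apply Cexp_0.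
  - rewrite RtoC_INR_S, Cmult_plus_distr_r, Cexp_plus, IH, Cmult_1_l. simpl. ring.
Qed.

(** * Explicit first and second order bounds for exp, sin and cos *)

Lemma exp_le (x y : R) : (x <= y)%R -> (exp x <= exp y)%R.
Proof. intros [H| ->]; [left; now apply exp_increasing | apply Rle_refl]. Qed.

Lemma exp_ge_1_plus (x : R) : (1 + x <= exp x)%R.
Proof. destruct (Req_dec x 0) as [-> | N]; [rewrite exp_0; lra | left; now apply exp_ineq1]. Qed.

Lemma abs_exp_sub1 (x : R) : (Rabs (exp x - 1) <= Rabs x * exp (Rabs x))%R.
Proof.
  assert (H1 := exp_ge_1_plus x). assert (H2 := exp_ge_1_plus (- x)).
  assert (H3 := exp_pos x). rewrite exp_Ropp in H2.
  apply Rmult_le_compat_r with (r := exp x) in H2; [|lra]. rewrite Rinv_l in H2 by lra.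
  unfold Rabs at 2 3. destruct (Rcase_abs x).
  - rewrite Rabs_left1 by nra. assert (H5 := exp_pos (- x)).
    assert (1 <= exp (- x))%R by (rewrite <- exp_0; apply exp_le; lra). nra.
  - rewrite Rabs_pos_eq; nra.
Qed.

Lemma abs_exp_sub2 (x : R) : (Rabs (exp x - 1 - x) <= x ^ 2 * exp (Rabs x))%R.
Proof.
  assert (H1 := exp_ge_1_plus x). assert (H2 := exp_ge_1_plus (- x)).
  assert (H3 := exp_pos x). rewrite exp_Ropp in H2.
  apply Rmult_le_compat_r with (r := exp x) in H2; [|lra]. rewrite Rinv_l in H2 by lra.
  rewrite Rabs_pos_eq by lra.
  assert (H4 := abs_exp_sub1 x).
  assert (H5 : (exp x - 1 - x <= x * (exp x - 1))%R) by nra.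
  apply Rle_trans with (1 := H5). apply Rle_trans with (1 := Rle_abs _).
  rewrite Rabs_mult. replace (x ^ 2)%R with (Rabs x * Rabs x)%R.
  - assert (X := Rabs_pos x). nra.
  - rewrite <- Rabs_mult. rewrite Rabs_pos_eq by nra. ring.
Qed.

Lemma abs_sin_le (x : R) : (Rabs (sin x) <= Rabs x)%R.
Proof.
  destruct (MVT_gen sin 0 x cos) as [c [_ Hc]].
  - intros y _. auto_derive; auto. ring.
  - intros y _. apply continuity_sin.
  - rewrite sin_0, !Rminus_0_r in Hc. rewrite Hc, Rabs_mult.
    assert (H := COS_bound c). assert (Rabs (cos c) <= 1)%R by (apply Rabs_le; lra).
    assert (X := Rabs_pos x). nra.
Qed.

Lemma abs_cos_sub1_sq (x : R) : (Rabs (cos x - 1) <= x ^ 2 / 2)%R.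
Proof.
  replace (cos x - 1)%R with (- (2 * (sin (x / 2) * sin (x / 2))))%R.
  - assert (H := abs_sin_le (x / 2)). rewrite Rabs_Ropp, Rabs_mult, (Rabs_pos_eq 2), Rabs_mult by lra.
    assert (X := Rabs_pos (sin (x / 2))).
    assert (E : (Rabs (x / 2) * Rabs (x / 2) = x ^ 2 / 4)%R).
    { rewrite <- Rabs_mult. rewrite Rabs_pos_eq by nra. field. }
    nra.
  - replace x with (2 * (x / 2))%R at 3 by field. rewrite cos_2a_sin. ring.
Qed.

Lemma abs_cos_sub1 (x : R) : (Rabs (cos x - 1) <= Rabs x)%R.
Proof.
  replace (cos x - 1)%R with (- (2 * (sin (x / 2) * sin (x / 2))))%R.
  - assert (H := abs_sin_le (x / 2)). rewrite Rabs_Ropp, Rabs_mult, (Rabs_pos_eq 2), Rabs_mult by lra.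
    assert (X := Rabs_pos (sin (x / 2))).
    assert (E : (Rabs (x / 2) = Rabs x / 2)%R).
    { unfold Rdiv. rewrite Rabs_mult, (Rabs_pos_eq (/ 2)); lra. }
    assert (Y := SIN_bound (x / 2)). assert (Rabs (sin (x / 2)) <= 1)%R by (apply Rabs_le; lra).
    nra.
  - replace x with (2 * (x / 2))%R at 3 by field. rewrite cos_2a_sin. ring.
Qed.

Lemma abs_sin_sub (x : R) : (Rabs (sin x - x) <= x ^ 2)%R.
Proof.
  destruct (MVT_gen (fun y => sin y - y)%R 0 x (fun y => cos y - 1)%R) as [c [Hc1 Hc]].
  - intros y _. auto_derive; auto. ring.
  - intros y _. apply continuity_minus; [apply continuity_sin | apply derivable_continuous, derivable_id].
  - rewrite sin_0, !Rminus_0_r in Hc. rewrite Hc, Rabs_mult.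
    assert (H := abs_cos_sub1 c).
    assert (Hcx : (Rabs c <= Rabs x)%R).
    { unfold Rmin, Rmax in Hc1. destruct (Rle_dec 0 x); unfold Rabs; destruct (Rcase_abs c), (Rcase_abs x); lra. }
    replace (x ^ 2)%R with (Rabs x * Rabs x)%R.
    + assert (X := Rabs_pos x). nra.
    + rewrite <- Rabs_mult. rewrite Rabs_pos_eq by nra. ring.
Qed.

Lemma abs_Re_Im_sq z : (Rabs (Re z) * Rabs (Re z) + Rabs (Im z) * Rabs (Im z) = Cmod z * Cmod z)%R.
Proof.
  assert (H := Cmod2_alt z). rewrite <- !Rabs_mult, !Rabs_pos_eq by nra. lra.
Qed.

Lemma Cmod_Cexp_sub1 z : (Cmod (Cexp z - 1) <= 3 * Cmod z * exp (Cmod z))%R.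
Proof.
  set (x := Re z). set (y := Im z).
  assert (E : Cexp z - 1 = RtoC (exp x - 1) + RtoC (exp x) * (RtoC (cos y - 1) + Ci * RtoC (sin y))).
  { apply C_eq; unfold Cminus; rewrite ?re_plus, ?im_plus, ?re_mult, ?im_mult, ?re_opp, ?im_opp, ?Re_Cexp, ?Im_Cexp, ?re_plus, ?im_plus, ?re_mult, ?im_mult;
    fold x y; simpl; ring. }
  rewrite E. eapply Rle_trans. { apply Cmod_triangle. }
  rewrite Cmod_mult, !Cmod_R, (Rabs_pos_eq (exp x)) by (left; apply exp_pos).
  assert (T := Cmod_triangle (RtoC (cos y - 1)) (Ci * RtoC (sin y))).
  rewrite Cmod_mult, Cmod_Ci, !Cmod_R in T.
  assert (H1 := abs_exp_sub1 x). assert (H2 := abs_cos_sub1 y). assert (H3 := abs_sin_le y).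
  assert (Hx : (Rabs x <= Cmod z)%R) by apply re_le_Cmod.
  assert (Hy : (Rabs y <= Cmod z)%R) by apply im_le_Cmod.
  assert (Ex : (exp x <= exp (Cmod z))%R) by (apply exp_le; apply Rle_trans with (2 := Hx); apply Rle_abs).
  assert (Ex' : (exp (Rabs x) <= exp (Cmod z))%R) by now apply exp_le.
  assert (P := exp_pos x). assert (P' := exp_pos (Rabs x)).
  assert (X := Rabs_pos x). assert (Y := Rabs_pos y).
  assert (A1 : (Rabs x * exp (Rabs x) <= Cmod z * exp (Cmod z))%R) by (apply Rmult_le_compat; lra).
  assert (A2 : (exp x * (2 * Rabs y) <= exp (Cmod z) * (2 * Cmod z))%R) by (apply Rmult_le_compat; lra).
  set (M := Cmod (RtoC (cos y - 1) + Ci * RtoC (sin y))) in *.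
  assert (A3 : (exp x * M <= exp x * (2 * Rabs y))%R) by (apply Rmult_le_compat_l; lra).
  lra.
Qed.

(** With z = x + i y the remainder splits into e^x - 1 - x, e^x ((cos y - 1) + i (sin y - y)) and i
    y (e^x - 1), each of second order. This bound is the source of the derivative of the exponential
    and of termwise differentiation. *)
Lemma Cmod_Cexp_sub2 z : (Cmod (Cexp z - 1 - z) <= 2 * Cmod z ^ 2 * exp (Cmod z))%R.
Proof.
  set (x := Re z). set (y := Im z).
  assert (E : Cexp z - 1 - z = RtoC (exp x - 1 - x) + RtoC (exp x) * (RtoC (cos y - 1) + Ci * RtoC (sin y - y))
     + Ci * RtoC (y * (exp x - 1))).
  { apply C_eq; unfold Cminus; rewrite ?re_plus, ?im_plus, ?re_mult, ?im_mult, ?re_opp, ?im_opp, ?Re_Cexp, ?Im_Cexp, ?re_plus, ?im_plus, ?re_mult, ?im_mult;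
    fold x y; simpl; ring. }
  rewrite E. eapply Rle_trans. { apply Cmod_triangle. }
  eapply Rle_trans. { apply Rplus_le_compat_r, Cmod_triangle. }
  rewrite !Cmod_mult, !Cmod_R, Cmod_Ci, (Rabs_pos_eq (exp x)) by (left; apply exp_pos).
  assert (T := Cmod_triangle (RtoC (cos y - 1)) (Ci * RtoC (sin y - y))).
  rewrite Cmod_mult, Cmod_Ci, !Cmod_R in T. rewrite Rabs_mult.
  assert (H1 := abs_exp_sub2 x). assert (H2 := abs_cos_sub1_sq y). assert (H3 := abs_sin_sub y).
  assert (H4 := abs_exp_sub1 x).
  assert (Hx : (Rabs x <= Cmod z)%R) by apply re_le_Cmod.
  assert (Ex : (exp x <= exp (Cmod z))%R) by (apply exp_le; apply Rle_trans with (2 := Hx); apply Rle_abs).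
  assert (Ex' : (exp (Rabs x) <= exp (Cmod z))%R) by now apply exp_le.
  assert (P := exp_pos x). assert (P' := exp_pos (Rabs x)).
  assert (X := Rabs_pos x). assert (Y := Rabs_pos y).
  assert (Q := abs_Re_Im_sq z). fold x y in Q.
  assert (Sx : (x ^ 2 = Rabs x * Rabs x)%R) by (rewrite <- Rabs_mult, Rabs_pos_eq by nra; ring).
  assert (Sy : (y ^ 2 = Rabs y * Rabs y)%R) by (rewrite <- Rabs_mult, Rabs_pos_eq by nra; ring).
  rewrite Sx in *. rewrite Sy in *.
  set (M := Cmod (RtoC (cos y - 1) + Ci * RtoC (sin y - y))) in *.
  set (e := exp (Cmod z)) in *. set (a := Rabs x) in *. set (b := Rabs y) in *.
  assert (A1 : (a * a * exp a <= a * a * e)%R) by (apply Rmult_le_compat_l; nra).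
  assert (A2 : (exp x * M <= e * (3 / 2 * (b * b)))%R).
  { apply Rmult_le_compat; try lra. apply Cmod_ge_0. }
  assert (A3 : (1 * (b * Rabs (exp x - 1)) <= b * (a * e))%R).
  { rewrite Rmult_1_l. apply Rmult_le_compat_l; auto. apply Rle_trans with (1 := H4).
    apply Rmult_le_compat_l; lra. }
  assert (A4 := Rle_0_sqr (a - b)). unfold Rsqr in A4.
  assert (A4' : (a * b <= (a * a + b * b) / 2)%R) by lra.
  assert (He : (0 < e)%R) by apply exp_pos.
  assert (A5 : (a * b * e <= (a * a + b * b) / 2 * e)%R) by (apply Rmult_le_compat_r; lra).
  replace (Cmod z ^ 2)%R with (a * a + b * b)%R by (rewrite Q; ring).
  assert (A6 : (0 <= (a * a + b * b) * e)%R) by (apply Rmult_le_pos; nra).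
  assert (A7 : (0 <= (a * a) * e)%R) by (apply Rmult_le_pos; nra).
  assert (A8 : (0 <= (b * b) * e)%R) by (apply Rmult_le_pos; nra).
  rewrite Rmult_1_l in A3. lra.
Qed.

(** * Complex derivatives *)

(** The derivative in o(h) form, free of quotients, so that h = 0 needs no exception; [C_derive_eq]
    relates it to [C_derive]. *)
Definition Cdiff (f : C -> C) (z l : C) : Prop :=
  forall eps, (0 < eps)%R -> exists d, (0 < d)%R /\
    forall h, (Cmod h < d)%R -> (Cmod (f (z + h)%C - f z - l * h) <= eps * Cmod h)%R.

Lemma Cdiff_ext f g z l : (forall w, f w = g w) -> Cdiff f z l -> Cdiff g z l.
Proof.
  intros E H eps He. destruct (H eps He) as [d [Hd Hh]]. exists d. split; auto.
  intros h Hm. rewrite <- !E. now apply Hh.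
Qed.

Lemma Cdiff_const c z : Cdiff (fun _ => c) z 0.
Proof.
  intros eps He. exists 1%R. split; [lra|]. intros h _.
  replace (c - c - 0 * h) with (RtoC 0) by ring. rewrite Cmod_0.
  assert (H := Cmod_ge_0 h). nra.
Qed.

Lemma Cdiff_affine a b z : Cdiff (fun w => a * w + b) z a.
Proof.
  intros eps He. exists 1%R. split; [lra|]. intros h _.
  replace (a * (z + h) + b - (a * z + b) - a * h) with (RtoC 0) by ring. rewrite Cmod_0.
  assert (H := Cmod_ge_0 h). nra.
Qed.

Lemma Cdiff_quad f z l (d M : R) : (0 < d)%R ->
  (forall h, (Cmod h < d)%R -> (Cmod (f (z + h)%C - f z - l * h) <= M * Cmod h ^ 2)%R) ->
  Cdiff f z l.
Proof.
  (* [M] may be zero or negative, and the radius eps / M' needs a positive denominator. *)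
  intros Hd H eps He. set (M' := (Rabs M + 1)%R).
  assert (HM : (0 < M')%R) by (unfold M'; assert (X := Rabs_pos M); lra).
  exists (Rmin d (eps / M')). split. { apply Rmin_pos; auto. now apply Rdiv_lt_0_compat. }
  intros h Hh.
  assert (h1 := Rlt_le_trans _ _ _ Hh (Rmin_l _ _)).
  assert (h2 := Rlt_le_trans _ _ _ Hh (Rmin_r _ _)).
  eapply Rle_trans. { now apply H. }
  assert (P := Cmod_ge_0 h).
  apply Rle_trans with (M' * Cmod h * Cmod h)%R.
  - replace (M * Cmod h ^ 2)%R with (M * (Cmod h * Cmod h))%R by ring.
    rewrite Rmult_assoc. apply Rmult_le_compat_r; [nra|]. unfold M'. assert (X := Rle_abs M). lra.
  - apply Rmult_le_compat_r; auto. apply Rlt_le in h2.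
    apply Rmult_le_compat_l with (r := M') in h2; [|lra].
    replace (M' * (eps / M'))%R with eps in h2 by (field; lra). exact h2.
Qed.

Lemma Cdiff_Cexp z : Cdiff Cexp z (Cexp z).
Proof.
  apply Cdiff_quad with (d := 1%R) (M := (Cmod (Cexp z) * (2 * exp 1))%R); [lra|].
  intros h Hh. rewrite Cexp_plus.
  replace (Cexp z * Cexp h - Cexp z - Cexp z * h) with (Cexp z * (Cexp h - 1 - h)) by ring.
  rewrite Cmod_mult, Rmult_assoc. apply Rmult_le_compat_l; [apply Cmod_ge_0|].
  eapply Rle_trans. { apply Cmod_Cexp_sub2. }
  assert (exp (Cmod h) <= exp 1)%R by (apply exp_le; lra).
  assert (X := Cmod_ge_0 h). assert (0 <= Cmod h ^ 2)%R by nra. nra.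
Qed.

Lemma Cdiff_plus f g z l m : Cdiff f z l -> Cdiff g z m -> Cdiff (fun w => f w + g w) z (l + m).
Proof.
  intros H1 H2 eps He. assert (He' : (0 < eps / 2)%R) by lra.
  destruct (H1 _ He') as [d1 [D1 B1]]. destruct (H2 _ He') as [d2 [D2 B2]].
  exists (Rmin d1 d2). split. { now apply Rmin_pos. }
  intros h Hh. specialize (B1 h (Rlt_le_trans _ _ _ Hh (Rmin_l _ _))).
  specialize (B2 h (Rlt_le_trans _ _ _ Hh (Rmin_r _ _))).
  replace (f (z + h) + g (z + h) - (f z + g z) - (l + m) * h)
    with ((f (z + h)%C - f z - l * h) + (g (z + h)%C - g z - m * h)) by ring.
  eapply Rle_trans. { apply Cmod_triangle. } lra.
Qed.

Lemma Cdiff_bound f z l : Cdiff f z l -> exists d, (0 < d)%R /\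
  forall h, (Cmod h < d)%R -> (Cmod (f (z + h)%C - f z) <= (Cmod l + 1) * Cmod h)%R.
Proof.
  intros H. destruct (H 1%R Rlt_0_1) as [d [D B]]. exists d. split; auto.
  intros h Hh. specialize (B h Hh).
  replace (f (z + h)%C - f z) with ((f (z + h)%C - f z - l * h) + l * h) by ring.
  eapply Rle_trans. { apply Cmod_triangle. } rewrite Cmod_mult. lra.
Qed.

Lemma Cdiff_comp f g z l m : Cdiff g z m -> Cdiff f (g z) l -> Cdiff (fun w => f (g w)) z (l * m).
Proof.
  intros Hg Hf eps He.
  destruct (Cdiff_bound _ _ _ Hg) as [d0 [D0 B0]].
  assert (Pm := Cmod_ge_0 m). assert (Pl := Cmod_ge_0 l).
  assert (e1 : (0 < eps / 2 / (Cmod m + 1))%R) by (apply Rdiv_lt_0_compat; lra).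
  assert (e2 : (0 < eps / 2 / (Cmod l + 1))%R) by (apply Rdiv_lt_0_compat; lra).
  destruct (Hf _ e1) as [d1 [D1 B1]]. destruct (Hg _ e2) as [d2 [D2 B2]].
  assert (d3 : (0 < d1 / (Cmod m + 1))%R) by (apply Rdiv_lt_0_compat; lra).
  exists (Rmin (Rmin d0 d2) (d1 / (Cmod m + 1))). split. { repeat apply Rmin_pos; auto. }
  intros h Hh.
  assert (h0 := Rlt_le_trans _ _ _ Hh (Rle_trans _ _ _ (Rmin_l _ _) (Rmin_l _ _))).
  assert (h2 := Rlt_le_trans _ _ _ Hh (Rle_trans _ _ _ (Rmin_l _ _) (Rmin_r _ _))).
  assert (h1 := Rlt_le_trans _ _ _ Hh (Rmin_r _ _)).
  specialize (B0 h h0). specialize (B2 h h2).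
  assert (K : (Cmod (g (z + h)%C - g z) < d1)%R).
  { eapply Rle_lt_trans. { exact B0. }
    apply Rmult_lt_compat_l with (r := (Cmod m + 1)%R) in h1; [|lra].
    replace ((Cmod m + 1) * (d1 / (Cmod m + 1)))%R with d1 in h1 by (field; lra). exact h1. }
  specialize (B1 _ K). replace (g z + (g (z + h)%C - g z)) with (g (z + h)) in B1 by ring.
  replace (f (g (z + h)) - f (g z) - l * m * h) with
    ((f (g (z + h)) - f (g z) - l * (g (z + h)%C - g z)) + l * (g (z + h)%C - g z - m * h)) by ring.
  eapply Rle_trans. { apply Cmod_triangle. } rewrite Cmod_mult.
  apply Rle_trans with (eps / 2 * Cmod h + eps / 2 * Cmod h)%R; [|lra].
  apply Rplus_le_compat.
  - eapply Rle_trans. { exact B1. }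
    apply Rle_trans with (eps / 2 / (Cmod m + 1) * ((Cmod m + 1) * Cmod h))%R.
    + apply Rmult_le_compat_l; lra.
    + apply Req_le. field. lra.
  - apply Rle_trans with (Cmod l * (eps / 2 / (Cmod l + 1) * Cmod h))%R.
    + apply Rmult_le_compat_l; lra.
    + apply Rle_trans with ((Cmod l + 1) * (eps / 2 / (Cmod l + 1) * Cmod h))%R.
      * apply Rmult_le_compat_r; [|lra]. apply Rmult_le_pos; [lra | apply Cmod_ge_0].
      * apply Req_le. field. lra.
Qed.

Lemma Cdiff_scal c f z l : Cdiff f z l -> Cdiff (fun w => c * f w) z (c * l).
Proof.
  intros H. apply Cdiff_ext with (fun w => c * f w + 0). { intros; ring. }
  apply (Cdiff_comp (fun w => c * w + 0)); auto. apply Cdiff_affine.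
Qed.

Lemma Cdiff_minus f g z l m : Cdiff f z l -> Cdiff g z m -> Cdiff (fun w => f w - g w) z (l - m).
Proof.
  intros H1 H2. apply Cdiff_ext with (fun w => f w + (- (1)) * g w). { intros; ring. }
  replace (l - m) with (l + (- (1)) * m) by ring. apply Cdiff_plus; auto. now apply Cdiff_scal.
Qed.

Lemma Cdiff_square f z l : Cdiff f z l -> Cdiff (fun w => f w * f w) z (2 * f z * l).
Proof.
  intros H. apply (Cdiff_comp (fun w => w * w) f z (2 * f z)); auto.
  apply Cdiff_quad with (d := 1%R) (M := 1%R); [lra|]. intros h _.
  replace ((f z + h) * (f z + h) - f z * f z - 2 * f z * h) with (h ^ 2) by ring.
  rewrite Cmod_pow. lra.
Qed.

(** Polarization: 4 f g = (f + g)^2 - (f - g)^2, so only the square has to be differentiated by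
    hand. *)
Lemma Cdiff_mult f g z l m : Cdiff f z l -> Cdiff g z m ->
  Cdiff (fun w => f w * g w) z (l * g z + f z * m).
Proof.
  intros H1 H2.
  assert (n4 : RtoC 4 <> 0) by (apply RtoC_neq_0; lra).
  apply Cdiff_ext with (fun w => / 4 * ((f w + g w) * (f w + g w) - (f w - g w) * (f w - g w))).
  { intros; field; auto. }
  replace (l * g z + f z * m) with
    (/ 4 * (2 * (f z + g z) * (l + m) - 2 * (f z - g z) * (l - m))) by (field; auto).
  apply Cdiff_scal, Cdiff_minus.
  - apply (Cdiff_square (fun w => f w + g w)). now apply Cdiff_plus.
  - apply (Cdiff_square (fun w => f w - g w)). now apply Cdiff_minus.
Qed.

Lemma Cdiff_inv f z l : Cdiff f z l -> f z <> 0 -> Cdiff (fun w => / f w) z (- l / (f z * f z)).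
Proof.
  intros H H0. replace (- l / (f z * f z)) with (- / (f z * f z) * l) by (field; auto).
  apply (Cdiff_comp (fun w => / w) f z); auto.
  set (c := f z) in *. assert (P : (0 < Cmod c)%R) by now apply Cmod_gt_0.
  apply Cdiff_quad with (d := (Cmod c / 2)%R) (M := (2 / Cmod c ^ 3)%R); [lra|].
  intros h Hh. assert (Q : (Cmod c / 2 <= Cmod (c + h))%R).
  { assert (X := Cmod_triangle_rev c (- h)). rewrite Cmod_opp in X.
    replace (c - - h) with (c + h) in X by ring. lra. }
  assert (N : c + h <> 0) by (apply Cmod_gt_0; lra).
  replace (/ (c + h) - / c - - / (c * c) * h) with (h ^ 2 / (c * c * (c + h))) by (field; auto).
  rewrite Cmod_div, Cmod_pow, !Cmod_mult by (repeat apply Cmult_neq_0; auto).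
  unfold Rdiv at 1. rewrite Rmult_comm. apply Rmult_le_compat_r; [assert (X := Cmod_ge_0 h); nra|].
  replace (2 / Cmod c ^ 3)%R with (/ (Cmod c * Cmod c * (Cmod c / 2)))%R by (field; lra).
  apply Rinv_le_contravar; [repeat apply Rmult_lt_0_compat; lra|].
  apply Rmult_le_compat_l; nra.
Qed.

Lemma locally_Cmod (z : C) (P : C -> Prop) :
  @locally C_UniformSpace z P <-> exists d, (0 < d)%R /\ forall w, (Cmod (w - z) < d)%R -> P w.
Proof.
  split.
  - intros H. apply locally_C in H. destruct H as [d Hd].
    exists d. split; [apply cond_pos | exact Hd].
  - intros [d [D Hd]]. apply locally_C. exists (mkposreal d D). exact Hd.
Qed.

Lemma locally'_Cmod (z : C) (P : C -> Prop) :
  @locally' C_UniformSpace z P <-> exists d, (0 < d)%R /\ forall w, w <> z -> (Cmod (w - z) < d)%R -> P w.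
Proof.
  unfold locally', within. rewrite locally_Cmod. split; intros [d [D H]]; exists d; split; auto.
Qed.

Lemma Cdiff_slope f z l : Cdiff f z l ->
  Clim (@locally' C_UniformSpace z) (fun w => (f w - f z) / (w - z)) l.
Proof.
  intros H eps He. apply locally'_Cmod. assert (He' : (0 < eps / 2)%R) by lra.
  destruct (H _ He') as [d [D B]]. exists d. split; auto. intros w Nw Hw.
  specialize (B _ Hw). replace (z + (w - z)) with w in B by ring.
  assert (N : w - z <> 0) by now apply Cminus_eq_contra.
  assert (P : (0 < Cmod (w - z))%R) by now apply Cmod_gt_0.
  replace ((f w - f z) / (w - z) - l) with ((f w - f z - l * (w - z)) / (w - z)) by (field; auto).
  rewrite Cmod_div by auto. apply Rle_lt_trans with (eps / 2)%R; [|lra].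
  apply Rmult_le_reg_r with (Cmod (w - z)); auto.
  unfold Rdiv at 1. rewrite Rmult_assoc, Rinv_l; lra.
Qed.

Lemma Cdiff_cont f z l : Cdiff f z l -> Clim (@locally C_UniformSpace z) f (f z).
Proof.
  intros H eps He. apply locally_Cmod. destruct (Cdiff_bound _ _ _ H) as [d [D B]].
  assert (Pl := Cmod_ge_0 l).
  assert (e1 : (0 < eps / (Cmod l + 1))%R) by (apply Rdiv_lt_0_compat; lra).
  exists (Rmin d (eps / (Cmod l + 1))). split. { now apply Rmin_pos. }
  intros w Hw. specialize (B _ (Rlt_le_trans _ _ _ Hw (Rmin_l _ _))).
  assert (h2 := Rlt_le_trans _ _ _ Hw (Rmin_r _ _)).
  replace (z + (w - z)) with w in B by ring. eapply Rle_lt_trans. { exact B. }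
  apply Rmult_lt_compat_l with (r := (Cmod l + 1)%R) in h2; [|lra].
  replace ((Cmod l + 1) * (eps / (Cmod l + 1)))%R with eps in h2 by (field; lra). exact h2.
Qed.

Global Instance Clocally'_filter (z : C) : ProperFilter (@locally' C_UniformSpace z).
Proof.
  constructor.
  - intros P HP. apply locally'_Cmod in HP. destruct HP as [d [D H]].
    exists (z + RtoC (d / 2)). apply H.
    + intros E. assert (X : RtoC (d / 2) = 0).
      { replace (RtoC (d / 2)) with (z + RtoC (d / 2) - z) by ring. rewrite E. ring. }
      apply RtoC_inj in X. lra.
    + replace (z + RtoC (d / 2) - z) with (RtoC (d / 2)) by ring. rewrite Cmod_RtoC_pos; lra.
  - apply within_filter, locally_filter.
Qed.

Lemma Cdiff_unique f z l m : Cdiff f z l -> Cdiff f z m -> l = m.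
Proof.
  intros H1 H2. apply (Clim_unique (@locally' C_UniformSpace z) (fun w => (f w - f z) / (w - z)));
  now apply Cdiff_slope.
Qed.

Lemma C_derive_eq f z l : Cdiff f z l -> C_derive f z = l.
Proof.
  intros H. unfold C_derive. apply is_C_lim_unique.
  exact (proj1 (Clim_filterlim _ _ _) (Cdiff_slope _ _ _ H)).
Qed.

(** * Complex-valued functions of a real variable *)

Definition Rdiff (f : R -> C) (s : R) (l : C) : Prop :=
  forall eps, (0 < eps)%R -> exists d, (0 < d)%R /\
    forall h, (Rabs h < d)%R -> (Cmod (f (s + h)%R - f s - l * RtoC h) <= eps * Rabs h)%R.

Lemma Cdiff_Rdiff_line f (s : R) a b l :
  Cdiff f (a * RtoC s + b) l -> Rdiff (fun t => f (a * RtoC t + b)) s (l * a).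
Proof.
  intros H. assert (H' := Cdiff_comp f (fun w => a * w + b) s l a (Cdiff_affine a b s) H).
  intros eps He. destruct (H' eps He) as [d [D B]]. exists d. split; auto. intros h Hh.
  rewrite <- Cmod_R in Hh |- *. rewrite RtoC_plus. now apply B.
Qed.

Lemma Rdiff_is_derive_re f s l : Rdiff f s l -> is_derive (fun t => Re (f t)) s (Re l).
Proof.
  intros H. apply is_derive_Reals. intros eps He. assert (He' : (0 < eps / 2)%R) by lra.
  destruct (H _ He') as [d [D B]].
  exists (mkposreal d D). intros h Nh Hh. specialize (B h Hh).
  assert (P : (0 < Rabs h)%R) by now apply Rabs_pos_lt.
  apply Rle_lt_trans with (eps / 2)%R; [|lra].
  apply Rmult_le_reg_r with (Rabs h); auto. rewrite <- Rabs_mult.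
  apply Rle_trans with (2 := B). apply Rle_trans with (2 := re_le_Cmod _).
  apply Req_le. f_equal. unfold Cminus. rewrite !re_plus, !re_opp, re_mult. simpl. field. auto.
Qed.

Lemma Rdiff_scal c f s l : Rdiff f s l -> Rdiff (fun t => c * f t) s (c * l).
Proof.
  intros H eps He. assert (Pl := Cmod_ge_0 c).
  assert (e1 : (0 < eps / (Cmod c + 1))%R) by (apply Rdiv_lt_0_compat; lra).
  destruct (H _ e1) as [d [D B]]. exists d. split; auto. intros h Hh. specialize (B h Hh).
  replace (c * f (s + h)%R - c * f s - c * l * RtoC h) with (c * (f (s + h)%R - f s - l * RtoC h)) by ring.
  rewrite Cmod_mult.
  apply Rle_trans with ((Cmod c + 1) * (eps / (Cmod c + 1) * Rabs h))%R.
  - apply Rmult_le_compat; try lra. apply Cmod_ge_0.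
  - apply Req_le. field. lra.
Qed.

Lemma Rdiff_is_derive_im f s l : Rdiff f s l -> is_derive (fun t => Im (f t)) s (Im l).
Proof.
  intros H. assert (K := Rdiff_is_derive_re _ _ _ (Rdiff_scal (- Ci) _ _ _ H)).
  replace (Im l) with (Re (- Ci * l)) by (rewrite re_mult; simpl; ring).
  apply is_derive_ext with (2 := K). intros t. rewrite re_mult. simpl. ring.
Qed.

Lemma nondecreasing_derive (g g' : R -> R) (a b : R) : (a <= b)%R ->
  (forall s, (a <= s <= b)%R -> is_derive g s (g' s)) ->
  (forall s, (a <= s <= b)%R -> (0 <= g' s)%R) -> (g a <= g b)%R.
Proof.
  intros Hab Hd Hp.
  destruct (MVT_gen g a b g') as [c [Hc E]].
  - intros x. rewrite Rmin_left, Rmax_right by auto. intros Hx. apply Hd; lra.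
  - intros x. rewrite Rmin_left, Rmax_right by auto. intros Hx.
    apply continuity_pt_filterlim. apply (ex_derive_continuous g). eexists. now apply Hd.
  - rewrite Rmin_left, Rmax_right in Hc by auto. specialize (Hp c Hc). nra.
Qed.

(** If the unit u rotates f b - f a onto the positive axis, then g - Re (u f) is nondecreasing.
    Estimates of integrals are later carried out in this form, with an explicit primitive g of the
    majorant in place of an integral. *)
Lemma Rdiff_mean_value (f f' : R -> C) (g g' : R -> R) (a b : R) : (a <= b)%R ->
  (forall s, (a <= s <= b)%R -> Rdiff f s (f' s)) ->
  (forall s, (a <= s <= b)%R -> is_derive g s (g' s)) ->
  (forall s, (a <= s <= b)%R -> (Cmod (f' s) <= g' s)%R) ->
  (Cmod (f b - f a) <= g b - g a)%R.
Proof.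
  intros Hab Hf Hg Hb. destruct (Req_dec (Cmod (f b - f a)) 0) as [E|E].
  - rewrite E. assert (H := nondecreasing_derive g g' a b Hab Hg). apply Rge_le, Rge_minus, Rle_ge, H.
    intros s Hs. eapply Rle_trans; [apply Cmod_ge_0 | now apply Hb].
  - set (S := f b - f a) in *. assert (Hp : (0 < Cmod S)%R) by (assert (X := Cmod_ge_0 S); lra).
    assert (nS : RtoC (Cmod S) <> 0) by (apply RtoC_neq_0; lra).
    set (u := Cconj S / RtoC (Cmod S)).
    assert (Hu : Cmod u = 1%R).
    { unfold u. rewrite Cmod_div, Cmod_conj, Cmod_R, Rabs_pos_eq by (auto; lra). field; lra. }
    assert (HS : u * S = RtoC (Cmod S)).
    { unfold u. replace (Cconj S / RtoC (Cmod S) * S) with (S * Cconj S / RtoC (Cmod S)) by (field; auto).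
      rewrite <- Cmod2_conj. simpl. rewrite Rmult_1_r, RtoC_mult. field. auto. }
    assert (K := nondecreasing_derive (fun s => g s - Re (u * f s))%R (fun s => g' s - Re (u * f' s))%R a b Hab).
    cbv beta in K.
    assert (L : (Re (u * f b) - Re (u * f a) = Cmod S)%R).
    { transitivity (Re (u * S)); [|now rewrite HS]. unfold S.
      rewrite !re_mult. unfold Cminus. rewrite re_plus, im_plus, re_opp, im_opp. ring. }
    rewrite <- L. assert (M : (g a - Re (u * f a) <= g b - Re (u * f b))%R); [|lra].
    apply K.
    + intros s Hs. apply (is_derive_minus g (fun t => Re (u * f t)) s (g' s) (Re (u * f' s))); [now apply Hg|].
      apply (Rdiff_is_derive_re (fun t => u * f t)), Rdiff_scal. now apply Hf.
    + intros s Hs. specialize (Hb s Hs).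
      assert (X := Rle_trans _ _ _ (Rle_abs _) (re_le_Cmod (u * f' s))).
      rewrite Cmod_mult, Hu in X. lra.
Qed.

Lemma Cdiff_zero_const f : (forall z, Cdiff f z 0) -> forall z w, f z = f w.
Proof.
  intros H z w. symmetry. apply Ceq_minus, Cmod_eq_0. apply Rle_antisym; [|apply Cmod_ge_0].
  assert (K := Rdiff_mean_value (fun t => f ((w - z) * RtoC t + z)) (fun _ => 0 * (w - z))
    (fun _ => 0%R) (fun _ => 0%R) 0 1 Rle_0_1). cbv beta in K.
  replace ((w - z) * 1 + z) with w in K by ring. replace ((w - z) * 0 + z) with z in K by ring.
  rewrite Rminus_0_r in K. apply K.
  - intros s _. apply Cdiff_Rdiff_line, H.
  - intros s _. apply (is_derive_const (K := R_AbsRing) (V := R_NormedModule)).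
  - intros s _. rewrite Cmult_0_l, Cmod_0. lra.
Qed.

(** * The reciprocal of the gamma function *)

(* A first-order Taylor bound on the disc of radius [S], with derivative [f'];
   the bounds [A] survive products and limits, so no Cauchy estimate is needed
   to differentiate a locally uniform limit. *)
Definition jet_bound (S : R) (f f' : C -> C) (A : R) : Prop :=
  forall t h, (Cmod t <= S)%R -> (Cmod (t + h) <= S)%R ->
    (Cmod (f t) <= A)%R /\ (Cmod (f' t) <= A)%R /\
    (Cmod (f (t + h)%C - f t - f' t * h) <= A * Cmod h ^ 2)%R.

Lemma jet_bound_le S f f' A B : (A <= B)%R -> jet_bound S f f' A -> jet_bound S f f' B.
Proof.
  intros AB H t h H1 H2. destruct (H t h H1 H2) as [X [Y Z]]. repeat split; try lra.
  eapply Rle_trans. { exact Z. } apply Rmult_le_compat_r; auto. apply pow2_ge_0.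
Qed.

Lemma jet_bound_ext S f f' g g' A : (forall s, f s = g s) -> (forall s, f' s = g' s) ->
  jet_bound S f f' A -> jet_bound S g g' A.
Proof. intros E E' H t h H1 H2. rewrite <- !E, <- E'. now apply H. Qed.

Lemma jet_bound_plus S f f' g g' A B : jet_bound S f f' A -> jet_bound S g g' B ->
  jet_bound S (fun s => f s + g s) (fun s => f' s + g' s) (A + B).
Proof.
  intros Hf Hg t h H1 H2. destruct (Hf t h H1 H2) as [X [Y Z]].
  destruct (Hg t h H1 H2) as [X' [Y' Z']]. repeat split.
  - eapply Rle_trans; [apply Cmod_triangle | lra].
  - eapply Rle_trans; [apply Cmod_triangle | lra].
  - replace (f (t + h) + g (t + h) - (f t + g t) - (f' t + g' t) * h) with
      ((f (t + h) - f t - f' t * h) + (g (t + h) - g t - g' t * h)) by ring.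
    eapply Rle_trans; [apply Cmod_triangle | lra].
Qed.

Lemma jet_bound_mult S f f' g g' A B : (0 <= A)%R -> (0 <= B)%R ->
  jet_bound S f f' A -> jet_bound S g g' B ->
  jet_bound S (fun s => f s * g s) (fun s => f' s * g s + f s * g' s) ((3 + 2 * S) * A * B).
Proof.
  intros HA HB Hf Hg t h H1 H2. destruct (Hf t h H1 H2) as [X [Y Z]].
  destruct (Hg t h H1 H2) as [X' [Y' Z']].
  assert (H20 : (Cmod (t + h + 0) <= S)%R) by now rewrite Cplus_0_r.
  destruct (Hg (t + h) 0 H2 H20) as [X'' _].
  assert (P1 := Cmod_ge_0 (f t)). assert (P2 := Cmod_ge_0 (f' t)). assert (P3 := Cmod_ge_0 (g t)).
  assert (P4 := Cmod_ge_0 (g' t)). assert (P5 := Cmod_ge_0 (g (t + h))).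
  assert (Ph := Cmod_ge_0 h). assert (Pt := Cmod_ge_0 t).
  assert (HAB : (0 <= A * B)%R) by nra.
  assert (M1 : (Cmod (f t) * Cmod (g t) <= A * B)%R) by now apply Rmult_le_compat.
  assert (M2 : (Cmod (f' t) * Cmod (g t) <= A * B)%R) by now apply Rmult_le_compat.
  assert (M3 : (Cmod (f t) * Cmod (g' t) <= A * B)%R) by now apply Rmult_le_compat.
  assert (SA : (0 <= S * (A * B))%R) by (apply Rmult_le_pos; lra).
  assert (Hh : (Cmod h <= 2 * S)%R).
  { assert (W := Cmod_triangle_sub (t + h) t). replace (t + h - t) with h in W by ring. lra. }
  split; [|split].
  - rewrite Cmod_mult. lra.
  - eapply Rle_trans; [apply Cmod_triangle|]. rewrite !Cmod_mult. lra.
  - replace (f (t + h) * g (t + h) - f t * g t - (f' t * g t + f t * g' t) * h) with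
      ((f (t + h) - f t - f' t * h) * g (t + h) + (f t * (g (t + h) - g t - g' t * h)
        + f' t * h * ((g (t + h) - g t - g' t * h) + g' t * h))) by ring.
    eapply Rle_trans; [apply Cmod_triangle|].
    eapply Rle_trans; [apply Rplus_le_compat_l, Cmod_triangle|].
    rewrite !Cmod_mult.
    set (h2 := (Cmod h ^ 2)%R) in *. assert (Ph2 : (0 <= h2)%R) by apply pow2_ge_0.
    set (u := Cmod (f (t + h) - f t - f' t * h)) in *.
    set (v := Cmod (g (t + h) - g t - g' t * h)) in *.
    assert (Pu : (0 <= u)%R) by apply Cmod_ge_0. assert (Pv : (0 <= v)%R) by apply Cmod_ge_0.
    assert (N1 : (u * Cmod (g (t + h)%C) <= A * h2 * B)%R) by now apply Rmult_le_compat.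
    assert (N2 : (Cmod (f t) * v <= A * (B * h2))%R) by now apply Rmult_le_compat.
    assert (N3 : (Cmod ((g (t + h)%C - g t - g' t * h) + g' t * h) <= (2 * S * B + B) * Cmod h)%R).
    { eapply Rle_trans; [apply Cmod_triangle|]. fold v. rewrite Cmod_mult.
      assert (E : h2 = (Cmod h * Cmod h)%R) by (unfold h2; ring).
      assert (B * h2 <= B * (2 * S * Cmod h))%R.
      { apply Rmult_le_compat_l; auto. rewrite E. apply Rmult_le_compat_r; auto. }
      assert (Cmod (g' t) * Cmod h <= B * Cmod h)%R by (apply Rmult_le_compat_r; auto).
      lra. }
    assert (N4 : (Cmod (f' t) * Cmod h * Cmod ((g (t + h)%C - g t - g' t * h) + g' t * h)
       <= A * Cmod h * ((2 * S * B + B) * Cmod h))%R).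
    { apply Rmult_le_compat; auto; try apply Cmod_ge_0; [now apply Rmult_le_pos|].
      apply Rmult_le_compat_r; auto. }
    replace (A * Cmod h * ((2 * S * B + B) * Cmod h))%R with ((2 * S + 1) * (A * B) * h2)%R in N4
      by (unfold h2; ring).
    replace ((3 + 2 * S) * A * B * h2)%R with (A * h2 * B + (A * (B * h2) + (2 * S + 1) * (A * B) * h2))%R
      by ring.
    lra.
Qed.

(** * Locally uniform convergence of Euler's product for 1/Gamma *)

Definition log_ratio (n : nat) : R := ln (1 + / INR n).

(** The factor (1 + s/n) (1 + 1/n)^(-s) of Euler's product for 1/Gamma(s). It differs from 1 by
    O(1/n^2), so the product converges absolutely and Euler's constant does not appear. *)
Definition gfac (n : nat) (s : C) : C :=
  (1 + s * RtoC (/ INR n)) * Cexp (- (s * RtoC (log_ratio n))).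
Definition gfac' (n : nat) (s : C) : C :=
  (RtoC (/ INR n) - RtoC (log_ratio n) * (1 + s * RtoC (/ INR n))) * Cexp (- (s * RtoC (log_ratio n))).

Fixpoint rgn (n : nat) (s : C) : C :=
  match n with O => s | S m => rgn m s * gfac (S m) s end.
Fixpoint rgn' (n : nat) (s : C) : C :=
  match n with O => 1 | S m => rgn' m s * gfac (S m) s + rgn m s * gfac' (S m) s end.

Lemma ln_le_sub1 (y : R) : (0 < y)%R -> (ln y <= y - 1)%R.
Proof.
  intros H. assert (X := exp_ge_1_plus (ln y)). rewrite exp_ln in X; lra.
Qed.

Lemma log_ratio_bounds (n : nat) : (1 <= n)%nat ->
  (0 <= log_ratio n <= / INR n)%R /\ (0 <= / INR n - log_ratio n <= (/ INR n) ^ 2)%R /\ (0 < / INR n <= 1)%R.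
Proof.
  intros Hn. assert (P : (1 <= INR n)%R) by (apply (le_INR 1); lia).
  assert (Q : (0 < / INR n <= 1)%R).
  { split; [apply Rinv_0_lt_compat; lra|]. rewrite <- Rinv_1. apply Rinv_le_contravar; lra. }
  unfold log_ratio. set (x := (/ INR n)%R) in *.
  assert (U := ln_le_sub1 (1 + x) ltac:(lra)).
  assert (Pi : (0 < / (1 + x))%R) by (apply Rinv_0_lt_compat; lra).
  assert (L := ln_le_sub1 (/ (1 + x)) Pi).
  rewrite ln_Rinv in L by lra.
  assert (E : (/ (1 + x) * (1 + x) = 1)%R) by (apply Rinv_l; lra).
  assert (F : (/ (1 + x) <= 1 - x + x * x)%R) by nra.
  assert (G : (/ (1 + x) <= 1)%R) by nra.
  repeat split; try lra.
Qed.

Lemma Cmod_Cexp_le z : (Cmod (Cexp z) <= exp (Cmod z))%R.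
Proof. rewrite Cmod_Cexp. apply exp_le. apply Rle_trans with (2 := re_le_Cmod z). apply Rle_abs. Qed.

(** The cube dominates the polynomial factors; e^(3S) is e^S for the exponential at a point of the
    disc times e^(2S) for an increment, whose modulus is at most 2 S. *)
Definition gconst (S : R) : R := (6 * (1 + S) ^ 3 * exp (3 * S))%R.

(** With a = 1/n and l = ln(1 + 1/n), the terms of first order combine to t (a - l), and 0 <= a - l
    <= a^2. Everything else already contains two factors a or l <= a. *)
Lemma gfac_jet (S : R) (n : nat) : (0 <= S)%R -> (1 <= n)%nat ->
  jet_bound S (fun s => gfac n s - 1) (gfac' n) (gconst S * (/ INR n) ^ 2).
Proof.
  intros HS Hn t h Ht Hth.
  destruct (log_ratio_bounds n Hn) as [L1 [L2 L3]].
  unfold gfac, gfac', gconst. set (a := (/ INR n)%R) in *. set (l := log_ratio n) in *.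
  assert (Pt := Cmod_ge_0 t). assert (Ph := Cmod_ge_0 h).
  assert (Hh : (Cmod h <= 2 * S)%R).
  { assert (W := Cmod_triangle_sub (t + h) t). replace (t + h - t) with h in W by ring. lra. }
  assert (Pa2 : (0 <= a ^ 2)%R) by apply pow2_ge_0.
  set (K := ((1 + S) ^ 3)%R).
  assert (K0 : (1 <= (1 + S))%R) by lra.
  assert (K1 : ((1 + S) <= (1 + S) ^ 2)%R) by (simpl; nra).
  assert (K2 : ((1 + S) ^ 2 <= K)%R) by (unfold K; simpl; nra).
  assert (KS : (S * (1 + S) <= K)%R) by (simpl in K1, K2; nra).
  assert (KSS : ((1 + S) * S ^ 2 <= K)%R) by (unfold K; simpl; nra).
  assert (e1 : (1 <= exp S)%R) by (rewrite <- exp_0; apply exp_le; lra).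
  assert (e3 : (exp S <= exp (3 * S))%R) by (apply exp_le; lra).
  set (e := exp (3 * S)) in *.
  assert (El : forall u : C, (Cmod (u * RtoC l) <= Cmod u * a)%R).
  { intros u. rewrite Cmod_mult, Cmod_RtoC_pos by lra. apply Rmult_le_compat_l; [apply Cmod_ge_0 | lra]. }
  assert (El' : forall u : C, (Cmod (u * RtoC l) <= Cmod u)%R).
  { intros u. eapply Rle_trans; [apply El|]. assert (X := Cmod_ge_0 u). nra. }
  assert (E : forall u : C, (Cmod u <= S)%R -> (Cmod (Cexp (- (u * RtoC l))) <= exp S)%R).
  { intros u Hu. eapply Rle_trans; [apply Cmod_Cexp_le|]. apply exp_le. rewrite Cmod_opp.
    eapply Rle_trans; [apply El'|]. lra. }
  assert (F : (Cmod (1 + t * RtoC a) <= 1 + S)%R).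
  { eapply Rle_trans; [apply Cmod_triangle|]. rewrite Cmod_1, Cmod_mult, Cmod_RtoC_pos by lra. nra. }
  assert (Pe : (0 < e)%R) by apply exp_pos.
  assert (D : (Cmod (RtoC a - RtoC l) <= a ^ 2)%R).
  { rewrite <- RtoC_minus, Cmod_RtoC_pos; lra. }
  assert (D2 : (Cmod (t * RtoC a * RtoC l) <= S * a ^ 2)%R).
  { rewrite !Cmod_mult, !Cmod_RtoC_pos by lra.
    replace (S * a ^ 2)%R with (S * a * a)%R by ring. apply Rmult_le_compat; try nra. }
  assert (Kp : (1 <= K)%R) by lra.
  assert (Ke : (K <= K * e)%R) by nra.
  assert (T3 : forall x, (x <= 6 * (K * e))%R -> (x * a ^ 2 <= 6 * K * e * a ^ 2)%R).
  { intros x Hx. apply Rmult_le_compat_r; lra. }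
  split; [|split].
  - replace ((1 + t * RtoC a) * Cexp (- (t * RtoC l)) - 1) with
      ((1 + t * RtoC a) * (Cexp (- (t * RtoC l)) - 1 - - (t * RtoC l))
        + (t * (RtoC a - RtoC l) + - (t * (t * RtoC a * RtoC l)))) by ring.
    eapply Rle_trans; [apply Cmod_triangle|].
    eapply Rle_trans; [apply Rplus_le_compat_l, Cmod_triangle|].
    rewrite Cmod_opp, (Cmod_mult (1 + _)), (Cmod_mult t (RtoC a - _)), (Cmod_mult t (t * _ * _)).
    assert (B := Cmod_Cexp_sub2 (- (t * RtoC l))). rewrite Cmod_opp in B.
    assert (B2 : (Cmod (Cexp (- (t * RtoC l)) - 1 - - (t * RtoC l)) <= 2 * (S * a) ^ 2 * e)%R).
    { eapply Rle_trans; [exact B|]. assert (X := El t). assert (Y := El' t).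
      assert (P := Cmod_ge_0 (t * RtoC l)).
      apply Rmult_le_compat; [assert (Z := pow2_ge_0 (Cmod (t * RtoC l))); lra | left; apply exp_pos | |].
      - apply Rmult_le_compat_l; [lra|]. apply pow_incr. split; auto. nra.
      - apply Rle_trans with (exp S); auto. apply exp_le. lra. }
    assert (A1 : (Cmod (1 + t * RtoC a) * Cmod (Cexp (- (t * RtoC l)) - 1 - - (t * RtoC l))
      <= (1 + S) * (2 * (S * a) ^ 2 * e))%R).
    { apply Rmult_le_compat; auto; apply Cmod_ge_0. }
    assert (A2 : (Cmod t * Cmod (RtoC a - RtoC l) <= S * a ^ 2)%R).
    { apply Rmult_le_compat; auto; apply Cmod_ge_0. }
    assert (A3 : (Cmod t * Cmod (t * RtoC a * RtoC l) <= S * (S * a ^ 2))%R).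
    { apply Rmult_le_compat; auto; apply Cmod_ge_0. }
    apply Rle_trans with ((2 * ((1 + S) * S ^ 2) * e + S * (1 + S)) * a ^ 2)%R.
    + replace ((2 * ((1 + S) * S ^ 2) * e + S * (1 + S)) * a ^ 2)%R with
        ((1 + S) * (2 * (S * a) ^ 2 * e) + (S * a ^ 2 + S * (S * a ^ 2)))%R by ring. lra.
    + apply T3. assert (((1 + S) * S ^ 2) * e <= K * e)%R by (apply Rmult_le_compat_r; lra). lra.
  - rewrite Cmod_mult.
    replace (RtoC a - RtoC l * (1 + t * RtoC a)) with ((RtoC a - RtoC l) + - (t * RtoC a * RtoC l)) by ring.
    assert (A1 : (Cmod ((RtoC a - RtoC l) + - (t * RtoC a * RtoC l)) <= (1 + S) * a ^ 2)%R).
    { eapply Rle_trans; [apply Cmod_triangle|]. rewrite Cmod_opp. lra. }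
    apply Rle_trans with ((1 + S) * a ^ 2 * exp S)%R.
    { apply Rmult_le_compat; auto; apply Cmod_ge_0. }
    replace ((1 + S) * a ^ 2 * exp S)%R with ((1 + S) * exp S * a ^ 2)%R by ring.
    apply T3. assert ((1 + S) * exp S <= K * e)%R by (apply Rmult_le_compat; lra).
    assert (0 <= K * e)%R by nra. lra.
  - replace ((1 + (t + h) * RtoC a) * Cexp (- ((t + h) * RtoC l)) - 1 - ((1 + t * RtoC a) * Cexp (- (t * RtoC l)) - 1)
      - (RtoC a - RtoC l * (1 + t * RtoC a)) * Cexp (- (t * RtoC l)) * h) with
      (Cexp (- (t * RtoC l)) * ((1 + t * RtoC a) * (Cexp (- (h * RtoC l)) - 1 - - (h * RtoC l))
         + h * RtoC a * (Cexp (- (h * RtoC l)) - 1))).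
    2: { replace (- ((t + h) * RtoC l)) with (- (t * RtoC l) + - (h * RtoC l)) by ring.
         rewrite Cexp_plus. ring. }
    rewrite Cmod_mult.
    assert (X := El h). assert (Y := El' h). assert (P := Cmod_ge_0 (h * RtoC l)).
    assert (B := Cmod_Cexp_sub2 (- (h * RtoC l))). rewrite Cmod_opp in B.
    assert (B' := Cmod_Cexp_sub1 (- (h * RtoC l))). rewrite Cmod_opp in B'.
    assert (Pe2 : (0 < exp (2 * S))%R) by apply exp_pos.
    assert (B2 : (Cmod (Cexp (- (h * RtoC l)) - 1 - - (h * RtoC l)) <= 2 * (Cmod h * a) ^ 2 * exp (2 * S))%R).
    { eapply Rle_trans; [exact B|].
      apply Rmult_le_compat; [assert (Z := pow2_ge_0 (Cmod (h * RtoC l))); lra | left; apply exp_pos | |].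
      - apply Rmult_le_compat_l; [lra|]. apply pow_incr. split; auto.
      - apply exp_le. lra. }
    assert (B3 : (Cmod (Cexp (- (h * RtoC l)) - 1) <= 3 * (Cmod h * a) * exp (2 * S))%R).
    { eapply Rle_trans; [exact B'|].
      apply Rmult_le_compat; [lra | left; apply exp_pos | lra |].
      apply exp_le. lra. }
    assert (A : (Cmod ((1 + t * RtoC a) * (Cexp (- (h * RtoC l)) - 1 - - (h * RtoC l))
         + h * RtoC a * (Cexp (- (h * RtoC l)) - 1))
         <= (2 * (1 + S) + 3) * exp (2 * S) * (Cmod h * a) ^ 2)%R).
    { eapply Rle_trans; [apply Cmod_triangle|].
      rewrite (Cmod_mult (1 + _)), (Cmod_mult (h * _)), (Cmod_mult h), (Cmod_RtoC_pos a) by lra.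
      assert (A1 : (Cmod (1 + t * RtoC a) * Cmod (Cexp (- (h * RtoC l)) - 1 - - (h * RtoC l))
         <= (1 + S) * (2 * (Cmod h * a) ^ 2 * exp (2 * S)))%R).
      { apply Rmult_le_compat; auto; apply Cmod_ge_0. }
      assert (A2 : (Cmod h * a * Cmod (Cexp (- (h * RtoC l)) - 1) <= Cmod h * a * (3 * (Cmod h * a) * exp (2 * S)))%R).
      { apply Rmult_le_compat_l; auto. apply Rmult_le_pos; lra. }
      replace ((2 * (1 + S) + 3) * exp (2 * S) * (Cmod h * a) ^ 2)%R with
       ((1 + S) * (2 * (Cmod h * a) ^ 2 * exp (2 * S)) + Cmod h * a * (3 * (Cmod h * a) * exp (2 * S)))%R by ring.
      lra. }
    apply Rle_trans with (exp S * ((2 * (1 + S) + 3) * exp (2 * S) * (Cmod h * a) ^ 2))%R.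
    { apply Rmult_le_compat; auto; apply Cmod_ge_0. }
    replace (exp S * ((2 * (1 + S) + 3) * exp (2 * S) * (Cmod h * a) ^ 2))%R with
      ((2 * (1 + S) + 3) * (exp S * exp (2 * S)) * a ^ 2 * Cmod h ^ 2)%R by ring.
    rewrite <- exp_plus. replace (S + 2 * S)%R with (3 * S)%R by ring. fold e.
    apply Rmult_le_compat_r; [apply pow2_ge_0|]. apply T3.
    assert ((1 + S) * e <= K * e)%R by (apply Rmult_le_compat_r; lra).
    assert (1 * e <= K * e)%R by (apply Rmult_le_compat_r; lra). lra.
Qed.

Lemma gconst_ge_0 S : (0 <= S)%R -> (0 <= gconst S)%R.
Proof.
  intros H. unfold gconst. assert (P := exp_pos (3 * S)).
  assert (0 <= (1 + S) ^ 3)%R by (apply pow_le; lra). nra.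
Qed.

(** Replaces the sum of 1/n^2 by a telescoping one. The same inequality yields both the uniform
    bound of the partial products and their rate of convergence 1/n. *)
Lemma inv_sq_telescope n : ((/ INR (S n)) ^ 2 <= 2 * (/ INR (S n) - / INR (S (S n))))%R.
Proof.
  rewrite !S_INR. assert (P := pos_INR n).
  replace (2 * (/ (INR n + 1) - / (INR n + 1 + 1)))%R with
    ((/ (INR n + 1)) ^ 2 * (2 * (INR n + 1) / (INR n + 1 + 1)))%R by (field; lra).
  rewrite <- (Rmult_1_r ((/ (INR n + 1)) ^ 2)) at 1.
  apply Rmult_le_compat_l; [apply pow2_ge_0|].
  apply Rmult_le_reg_r with (INR n + 1 + 1)%R; [lra|].
  unfold Rdiv. rewrite Rmult_assoc, Rinv_l by lra. lra.
Qed.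

(** S + 1 covers the initial factor s and its derivative 1. Multiplying by one more factor costs at
    most 1 + c/n^2 with c = (3 + 2 S) [gconst S], and the product of these is at most e^(2c). *)
Definition rgn_bound (S : R) : R := ((S + 1) * exp (2 * ((3 + 2 * S) * gconst S)))%R.

Lemma rgn_jet_step S n A : (0 <= S)%R -> (0 <= A)%R -> jet_bound S (rgn n) (rgn' n) A ->
  jet_bound S (fun s => rgn (Datatypes.S n) s - rgn n s) (fun s => rgn' (Datatypes.S n) s - rgn' n s)
    ((3 + 2 * S) * A * (gconst S * (/ INR (Datatypes.S n)) ^ 2)).
Proof.
  intros HS HA H.
  assert (HB : (0 <= gconst S * (/ INR (Datatypes.S n)) ^ 2)%R).
  { apply Rmult_le_pos; [now apply gconst_ge_0 | apply pow2_ge_0]. }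
  assert (K := jet_bound_mult S _ _ _ _ _ _ HA HB H (gfac_jet S (Datatypes.S n) HS ltac:(lia))).
  revert K. apply jet_bound_ext; intros s; simpl; ring.
Qed.

Lemma rgn_jet S n : (0 <= S)%R -> jet_bound S (rgn n) (rgn' n) (rgn_bound S).
Proof.
  intros HS. set (c := ((3 + 2 * S) * gconst S)%R).
  assert (Hc : (0 <= c)%R) by (unfold c; assert (X := gconst_ge_0 S HS); nra).
  (* The induction needs the partial telescoping sum 1 - 1/(n + 1) in the exponent; the next factor
     1 + c/(n + 1)^2 is absorbed by its increment. *)
  apply jet_bound_le with ((S + 1) * exp (2 * c * (1 - / INR (Datatypes.S n))))%R.
  { apply Rmult_le_compat_l; [lra|]. apply exp_le. fold c.
    assert (0 < / INR (Datatypes.S n))%R by (apply Rinv_0_lt_compat, lt_0_INR; lia). nra. }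
  induction n as [|n IH].
  - intros t h Ht Hth. simpl INR. rewrite Rinv_1, Rminus_diag, Rmult_0_r, exp_0, Rmult_1_r.
    assert (P := Cmod_ge_0 t). simpl. repeat split.
    + lra.
    + rewrite Cmod_1. lra.
    + replace (t + h - t - 1 * h) with (RtoC 0) by ring. rewrite Cmod_0.
      apply Rmult_le_pos; [lra|]. apply (pow2_ge_0 (Cmod h)).
  - set (A := ((S + 1) * exp (2 * c * (1 - / INR (Datatypes.S n))))%R) in *.
    assert (HA : (0 <= A)%R) by (apply Rmult_le_pos; [lra | left; apply exp_pos]).
    assert (K := jet_bound_plus _ _ _ _ _ _ _ IH (rgn_jet_step S n A HS HA IH)).
    apply jet_bound_le with (A + (3 + 2 * S) * A * (gconst S * (/ INR (Datatypes.S n)) ^ 2))%R.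
    2: { revert K. apply jet_bound_ext; intros s; ring. }
    replace (A + (3 + 2 * S) * A * (gconst S * (/ INR (Datatypes.S n)) ^ 2))%R with
      (A * (1 + c * (/ INR (Datatypes.S n)) ^ 2))%R by (unfold c; ring).
    apply Rle_trans with (A * exp (c * (/ INR (Datatypes.S n)) ^ 2))%R.
    { apply Rmult_le_compat_l; auto. apply exp_ge_1_plus. }
    unfold A. rewrite Rmult_assoc, <- exp_plus. apply Rmult_le_compat_l; [lra|]. apply exp_le.
    assert (T := inv_sq_telescope n). apply Rmult_le_compat_l with (r := c) in T; auto. lra.
Qed.

Definition rgn_rate (S : R) : R := (2 * ((3 + 2 * S) * rgn_bound S * gconst S))%R.

Lemma rgn_bound_ge_0 S : (0 <= S)%R -> (0 <= rgn_bound S)%R.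
Proof. intros HS. apply Rmult_le_pos; [lra | left; apply exp_pos]. Qed.

Lemma rgn_rate_ge_0 S : (0 <= S)%R -> (0 <= rgn_rate S)%R.
Proof.
  intros HS. unfold rgn_rate. assert (X := rgn_bound_ge_0 S HS). assert (Y := gconst_ge_0 S HS).
  assert (0 <= (3 + 2 * S) * rgn_bound S)%R by nra. nra.
Qed.

(** A difference of partial products is a telescoping sum of steps of size 1/k^2. Bounding values,
    derivatives and Taylor remainders together makes [rgn] and [rgn'] Cauchy at the common rate
    1/n. *)
Lemma rgn_jet_diff S n m : (0 <= S)%R -> (n <= m)%nat ->
  jet_bound S (fun s => rgn m s - rgn n s) (fun s => rgn' m s - rgn' n s)
    (rgn_rate S * / INR (Datatypes.S n)).
Proof.
  intros HS Hnm. assert (R0 := rgn_rate_ge_0 S HS).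
  apply jet_bound_le with (rgn_rate S * (/ INR (Datatypes.S n) - / INR (Datatypes.S m)))%R.
  { apply Rmult_le_compat_l; auto.
    assert (0 < / INR (Datatypes.S m))%R by (apply Rinv_0_lt_compat, lt_0_INR; lia). lra. }
  induction Hnm as [|m Hnm IH].
  - rewrite Rminus_diag, Rmult_0_r. intros t h _ _. cbv beta.
    replace (rgn n t - rgn n t) with (RtoC 0) by ring.
    replace (rgn n (t + h) - rgn n (t + h) - 0 - (rgn' n t - rgn' n t) * h) with (RtoC 0) by ring.
    replace (rgn' n t - rgn' n t) with (RtoC 0) by ring.
    rewrite Cmod_0, Rmult_0_l. repeat split; apply Rle_refl.
  - assert (K := jet_bound_plus _ _ _ _ _ _ _ IH
      (rgn_jet_step S m _ HS (rgn_bound_ge_0 S HS) (rgn_jet S m HS))).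
    apply (jet_bound_ext _ _ _ (fun s => rgn (Datatypes.S m) s - rgn n s)
      (fun s => rgn' (Datatypes.S m) s - rgn' n s)) in K; [|intros s; ring|intros s; ring].
    apply jet_bound_le with (2 := K).
    assert (T := inv_sq_telescope m). apply Rmult_le_compat_l with (r := rgn_rate S) in T; auto.
    unfold rgn_rate in *. lra.
Qed.

(** This is 1/Gamma, which unlike [Gamma] has no exceptional arguments; its zeros are the poles of
    Gamma. *)
Definition rGam (s : C) : C := CLim_seq (fun n => rgn n s).
Definition rGam' (s : C) : C := CLim_seq (fun n => rgn' n s).

Lemma is_lim_seq_const_inv (c : R) : is_lim_seq (fun n => c * / INR (S n))%R 0%R.
Proof.
  replace (Finite 0) with (Rbar_mult c (Finite 0)) by (simpl; f_equal; ring).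
  apply (is_lim_seq_scal_l (fun n => / INR (S n))%R c 0%R).
  replace (Finite 0) with (Rbar_inv p_infty) by reflexivity.
  apply is_lim_seq_inv; [|easy]. apply (is_lim_seq_incr_1 INR). apply is_lim_seq_INR.
Qed.

Lemma rgn_lim_aux s :
  (Clim eventually (fun n => rgn n s) (rGam s) /\
   forall n, (Cmod (rGam s - rgn n s) <= rgn_rate (Cmod s) * / INR (S n))%R) /\
  (Clim eventually (fun n => rgn' n s) (rGam' s) /\
   forall n, (Cmod (rGam' s - rgn' n s) <= rgn_rate (Cmod s) * / INR (S n))%R).
Proof.
  assert (J : forall n m, (n <= m)%nat ->
    (Cmod (rgn m s - rgn n s) <= rgn_rate (Cmod s) * / INR (S n))%R /\
    (Cmod (rgn' m s - rgn' n s) <= rgn_rate (Cmod s) * / INR (S n))%R).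
  { intros n m H. assert (H0 : (Cmod (s + 0) <= Cmod s)%R) by (rewrite Cplus_0_r; apply Rle_refl).
    destruct (rgn_jet_diff (Cmod s) n m (Cmod_ge_0 s) H s 0 (Rle_refl _) H0) as [X [Y _]].
    split; auto. }
  split; (apply Clim_Cauchy; [intros n m H; now apply J | apply is_lim_seq_const_inv]).
Qed.

Lemma rGam_lim s : Clim eventually (fun n => rgn n s) (rGam s).
Proof. apply rgn_lim_aux. Qed.
Lemma rGam'_lim s : Clim eventually (fun n => rgn' n s) (rGam' s).
Proof. apply rgn_lim_aux. Qed.

Lemma rGam_jet S : (0 <= S)%R -> jet_bound S rGam rGam' (rgn_bound S).
Proof.
  intros HS t h Ht Hth. assert (J := fun n => rgn_jet S n HS t h Ht Hth).
  repeat split.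
  - apply (Clim_mod_le eventually _ _ _ (rGam_lim t)). exists O. intros n _. apply J.
  - apply (Clim_mod_le eventually _ _ _ (rGam'_lim t)). exists O. intros n _. apply J.
  - apply (Clim_mod_le eventually (fun n => rgn n (t + h) - rgn n t - rgn' n t * h)).
    + apply Clim_minus; [apply Clim_minus; apply rGam_lim|].
      apply (Clim_mult (fun n => rgn' n t) (fun _ => h)).
      * apply rGam'_lim.
      * apply Clim_const.
    + exists O. intros n _. apply J.
Qed.

Lemma rGam_rate S n s : (0 <= S)%R -> (Cmod s <= S)%R ->
  (Cmod (rGam s - rgn n s) <= rgn_rate S * / INR (Datatypes.S n))%R.
Proof.
  intros HS Hs. apply (Clim_mod_le eventually (fun m => rgn m s - rgn n s)).
  - apply Clim_minus; [apply rGam_lim | apply Clim_const].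
  - exists n. intros m Hm.
    assert (H0 : (Cmod (s + 0) <= S)%R) by now rewrite Cplus_0_r.
    apply (rgn_jet_diff S n m HS Hm s 0 Hs H0).
Qed.

Lemma rGam_bounded S s : (0 <= S)%R -> (Cmod s <= S)%R -> (Cmod (rGam s) <= rgn_bound S)%R.
Proof.
  intros HS Hs. assert (H0 : (Cmod (s + 0) <= S)%R) by now rewrite Cplus_0_r.
  apply (rGam_jet S HS s 0 Hs H0).
Qed.

Lemma rGam_diff s : Cdiff rGam s (rGam' s).
Proof.
  apply Cdiff_quad with (d := 1%R) (M := rgn_bound (Cmod s + 1)); [lra|].
  intros h Hh. assert (P := Cmod_ge_0 s).
  apply (rGam_jet (Cmod s + 1)); try lra.
  assert (X := Cmod_triangle s h). lra.
Qed.

(** * The functional equation of 1/Gamma and its agreement with Gauss's formula *)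

Fixpoint rising (s : C) (n : nat) : C :=
  match n with O => 1 | S m => rising s m * (s + RtoC (INR m)) end.

Lemma rising_S_l s n : rising s (S n) = s * rising (s + 1) n.
Proof.
  induction n as [|n IH]; [simpl; ring|].
  change (rising s (S (S n))) with (rising s (S n) * (s + RtoC (INR (S n)))).
  rewrite IH, RtoC_INR_S. simpl. ring.
Qed.

Lemma INR_fact_neq_0_C n : RtoC (INR (fact n)) <> 0.
Proof. apply RtoC_neq_0, INR_fact_neq_0. Qed.

Lemma RtoC_INR_neq_0 n : n <> O -> RtoC (INR n) <> 0.
Proof. intros H. apply RtoC_neq_0. now apply not_0_INR. Qed.

Lemma RtoC_INR_fact_S n : RtoC (INR (fact (S n))) = RtoC (INR (S n)) * RtoC (INR (fact n)).
Proof. rewrite fact_simpl, mult_INR. apply RtoC_mult. Qed.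

(** The factors 1 + 1/j telescope to n + 1, which turns Euler's partial product into s (s + 1) ...
    (s + n) / (n! (n + 1)^s). *)
Lemma rgn_closed n s :
  rgn n s = rising s (S n) / (RtoC (INR (fact n)) * Cexp (s * RtoC (ln (INR (S n))))).
Proof.
  induction n as [|n IH].
  - simpl. rewrite ln_1, Cmult_0_r, Cexp_0. field.
  - assert (N1 := Cexp_neq_0 (s * RtoC (ln (INR (S n))))).
    assert (N2 := INR_fact_neq_0_C n). assert (N3 : RtoC (INR (S n)) <> 0) by (apply RtoC_INR_neq_0; lia).
    assert (P : (0 < INR (S n))%R) by (apply lt_0_INR; lia).
    assert (E : Cexp (s * RtoC (ln (INR (S (S n))))) =
      Cexp (s * RtoC (ln (INR (S n)))) * / Cexp (- (s * RtoC (log_ratio (S n))))).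
    { rewrite <- Cexp_opp, <- Cexp_plus. f_equal.
      replace (ln (INR (S (S n)))) with (ln (INR (S n)) + log_ratio (S n))%R.
      - rewrite RtoC_plus. ring.
      - unfold log_ratio. rewrite <- ln_mult; [|lra|].
        + f_equal. rewrite (S_INR (S n)). field. lra.
        + assert (0 < / INR (S n))%R by (apply Rinv_0_lt_compat; lra). lra. }
    change (rgn (S n) s) with (rgn n s * gfac (S n) s). rewrite IH, E. unfold gfac.
    assert (N4 := Cexp_neq_0 (- (s * RtoC (log_ratio (S n))))).
    change (rising s (S (S n))) with (rising s (S n) * (s + RtoC (INR (S n)))).
    rewrite RtoC_INR_fact_S, RtoC_inv by lra. field. auto.
Qed.

Lemma Clim_INR_inv : Clim eventually (fun n => RtoC (/ INR (S n))) 0.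
Proof.
  intros eps He. assert (H := is_lim_seq_const_inv 1). apply is_lim_seq_spec in H.
  destruct (H (mkposreal _ He)) as [N HN]. exists N. intros n Hn. specialize (HN n Hn). simpl pos in HN.
  replace (RtoC (/ INR (S n)) - 0) with (RtoC (/ INR (S n))) by ring. rewrite Cmod_R.
  rewrite Rminus_0_r, Rmult_1_l in HN. exact HN.
Qed.

(** The recurrence already holds for the partial products, up to the factor 1 + s/(n + 1), which
    tends to 1. *)
Lemma rGam_rec s : rGam s = s * rGam (s + 1).
Proof.
  apply (Clim_unique eventually (fun n => rgn n s * (1 + s * RtoC (/ INR (S n))))).
  - replace (rGam s) with (rGam s * (1 + s * 0)) by ring.
    apply Clim_mult; [apply rGam_lim|]. apply Clim_plus; [apply Clim_const|].
    apply Clim_mult; [apply Clim_const | apply Clim_INR_inv].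
  - apply Clim_ext with (fun n => s * rgn n (s + 1)).
    + intros n. rewrite !rgn_closed, (rising_S_l s).
      change (rising (s + 1) (S n)) with (rising (s + 1) n * (s + 1 + RtoC (INR n))).
      assert (P : (0 < INR (S n))%R) by (apply lt_0_INR; lia).
      replace ((s + 1) * RtoC (ln (INR (S n)))) with (s * RtoC (ln (INR (S n))) + RtoC (ln (INR (S n)))) by ring.
      rewrite Cexp_plus, Cexp_RtoC, exp_ln, RtoC_inv by lra.
      assert (N1 := Cexp_neq_0 (s * RtoC (ln (INR (S n))))).
      assert (N2 := INR_fact_neq_0_C n). assert (N3 : RtoC (INR (S n)) <> 0) by (apply RtoC_INR_neq_0; lia).
      rewrite RtoC_INR_S in *. field. auto.
    + apply Clim_mult; [apply Clim_const | apply rGam_lim].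
Qed.

Lemma rGam_rising s k : rGam s = rising s k * rGam (s + RtoC (INR k)).
Proof.
  induction k as [|k IH]. { simpl. rewrite Cplus_0_r. ring. }
  rewrite IH, rGam_rec, RtoC_INR_S. simpl. rewrite <- !Cmult_assoc. do 3 f_equal. ring.
Qed.

Lemma rising_1 n : rising 1 n = RtoC (INR (fact n)).
Proof.
  induction n as [|n IH]; [reflexivity|].
  rewrite RtoC_INR_fact_S, RtoC_INR_S. simpl. rewrite IH. ring.
Qed.

Lemma rGam_1 : rGam 1 = 1.
Proof.
  apply (Clim_unique eventually (fun n => rgn n 1)); [apply rGam_lim|].
  apply Clim_ext with (fun _ => RtoC 1); [|apply Clim_const].
  intros n. rewrite rgn_closed, rising_1, Cmult_1_l, Cexp_RtoC, exp_ln, RtoC_INR_fact_S by (apply lt_0_INR; lia).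
  assert (N2 := INR_fact_neq_0_C n). assert (N3 : RtoC (INR (S n)) <> 0) by (apply RtoC_INR_neq_0; lia).
  field. auto.
Qed.

Lemma Cprod_rising s n m :
  Cprod (map (fun j => s + RtoC (INR j)) (seq m n)) = rising (s + RtoC (INR m)) n.
Proof.
  revert m. induction n as [|n IH]; intros m; [reflexivity|].
  rewrite rising_S_l. simpl seq. cbn [map Cprod fold_right]. unfold Cprod in IH. rewrite IH.
  rewrite RtoC_INR_S. do 2 f_equal. ring.
Qed.

Lemma Gamma_rGam s : rGam s <> 0 -> Gamma s = / rGam s.
Proof.
  intros H0. apply CLim_seq_eq.
  (* Gauss's n^s differs from (n + 1)^s by a factor tending to 1. *)
  apply Clim_ext_loc with (fun n => / rgn n s * Cexp (- (s * RtoC (log_ratio n)))).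
  - destruct (Clim_nonzero _ _ (rGam_lim s) H0) as [N HN].
    exists (S N). intros n Hn. specialize (HN n ltac:(lia)).
    assert (Hr : rgn n s <> 0).
    { apply Cmod_gt_0. apply Cmod_gt_0 in H0. lra. }
    rewrite Cprod_rising, Cplus_0_r. rewrite rgn_closed in Hr |- *.
    assert (N1 := Cexp_neq_0 (s * RtoC (ln (INR (S n))))). assert (N2 := INR_fact_neq_0_C n).
    assert (P : (0 < INR n)%R) by (apply lt_0_INR; lia).
    replace (- (s * RtoC (log_ratio n))) with (s * RtoC (ln (INR n)) + - (s * RtoC (ln (INR (S n))))).
    + rewrite Cexp_plus, Cexp_opp. field. repeat split; auto.
      intros E. apply Hr. rewrite E. field. auto.
    + replace (ln (INR (S n))) with (ln (INR n) + log_ratio n)%R.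
      * rewrite RtoC_plus. ring.
      * unfold log_ratio. assert (0 < / INR n)%R by (apply Rinv_0_lt_compat; lra).
        rewrite <- ln_mult by lra. f_equal. rewrite S_INR. field. lra.
  - replace (/ rGam s) with (/ rGam s * 1) by ring. apply Clim_mult.
    + apply Clim_inv; auto. apply rGam_lim.
    + apply Clim_squeeze with (fun n => 3 * Cmod s * exp (Cmod s) * / INR n)%R.
      * exists 1%nat. intros n Hn. destruct (log_ratio_bounds n Hn) as [L1 [_ L3]].
        eapply Rle_trans; [apply Cmod_Cexp_sub1|]. rewrite Cmod_opp, Cmod_mult, Cmod_RtoC_pos by lra.
        assert (P := Cmod_ge_0 s).
        assert (E : (exp (Cmod s * log_ratio n) <= exp (Cmod s))%R) by (apply exp_le; nra).
        replace (3 * Cmod s * exp (Cmod s) * / INR n)%R with (3 * (Cmod s * / INR n) * exp (Cmod s))%R by ring.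
        apply Rmult_le_compat; [nra | left; apply exp_pos | nra | exact E].
      * intros eps He. assert (H := is_lim_seq_const_inv (3 * Cmod s * exp (Cmod s))).
        apply is_lim_seq_spec in H. destruct (H (mkposreal _ He)) as [N HN].
        exists (S N). intros n Hn. destruct n as [|n]; [lia|].
        specialize (HN n ltac:(lia)). simpl pos in HN. rewrite Rminus_0_r in HN.
        eapply Rle_lt_trans; [apply Rle_abs | exact HN].
Qed.

(** * The reflection formula *)

Lemma C2_neq_0 : RtoC 2 <> 0.
Proof. apply RtoC_neq_0; lra. Qed.

Ltac nz := repeat split; auto using C2_neq_0, Ci_nz, PI_neq0_C, C1_nz.

Lemma Cdiff_eq f z l m : Cdiff f z l -> l = m -> Cdiff f z m.
Proof. now intros H <-. Qed.

Lemma Cdiff_Csin z : Cdiff Csin z (Ccos z).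
Proof.
  assert (N : 2 * Ci <> 0) by (apply Cmult_neq_0; [apply C2_neq_0 | apply Ci_nz]).
  apply Cdiff_ext with (fun w => / (2 * Ci) * (Cexp (Ci * w + 0) - Cexp (- Ci * w + 0))).
  { intros w. unfold Csin. replace (Ci * w + 0) with (Ci * w) by ring.
    replace (- Ci * w + 0) with (- (Ci * w)) by ring. field; nz. }
  eapply Cdiff_eq.
  - apply Cdiff_scal, Cdiff_minus.
    + apply (Cdiff_comp Cexp (fun w => Ci * w + 0)); [apply Cdiff_affine | apply Cdiff_Cexp].
    + apply (Cdiff_comp Cexp (fun w => - Ci * w + 0)); [apply Cdiff_affine | apply Cdiff_Cexp].
  - unfold Ccos. replace (Ci * z + 0) with (Ci * z) by ring.
    replace (- Ci * z + 0) with (- (Ci * z)) by ring. field; nz.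
Qed.

Lemma Ci_sq : Ci * Ci = - (1).
Proof. apply C_eq; simpl; ring. Qed.

Lemma Cdiff_Ccos z : Cdiff Ccos z (- Csin z).
Proof.
  apply Cdiff_ext with (fun w => / 2 * (Cexp (Ci * w + 0) + Cexp (- Ci * w + 0))).
  { intros w. unfold Ccos. replace (Ci * w + 0) with (Ci * w) by ring.
    replace (- Ci * w + 0) with (- (Ci * w)) by ring. field; nz. }
  eapply Cdiff_eq.
  - apply Cdiff_scal, Cdiff_plus.
    + apply (Cdiff_comp Cexp (fun w => Ci * w + 0)); [apply Cdiff_affine | apply Cdiff_Cexp].
    + apply (Cdiff_comp Cexp (fun w => - Ci * w + 0)); [apply Cdiff_affine | apply Cdiff_Cexp].
  - unfold Csin. replace (Ci * z + 0) with (Ci * z) by ring.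
    replace (- Ci * z + 0) with (- (Ci * z)) by ring.
    replace (Cexp (Ci * z) * Ci + Cexp (- (Ci * z)) * - Ci) with
      (- (Ci * Ci) * ((Cexp (- (Ci * z)) - Cexp (Ci * z)) / Ci)) by (field; nz).
    rewrite Ci_sq. field; nz.
Qed.

Lemma Cexp_Ci (x : R) : Cexp (Ci * RtoC x) = (cos x, sin x).
Proof.
  apply C_eq; rewrite ?Re_Cexp, ?Im_Cexp, !re_mult, !im_mult; simpl;
  replace (0 * x - 1 * 0)%R with 0%R by ring; replace (0 * 0 + 1 * x)%R with x by ring; rewrite exp_0; ring.
Qed.

Lemma Cexp_opp_Ci (x : R) : Cexp (- (Ci * RtoC x)) = (cos x, - sin x)%R.
Proof.
  replace (- (Ci * RtoC x)) with (Ci * RtoC (- x)) by (rewrite RtoC_opp; ring).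
  rewrite Cexp_Ci, cos_neg, sin_neg. reflexivity.
Qed.

Lemma Csin_RtoC (x : R) : Csin (RtoC x) = RtoC (sin x).
Proof.
  unfold Csin. rewrite Cexp_Ci, Cexp_opp_Ci.
  replace ((cos x, sin x) - (cos x, (- sin x)%R)) with (2 * Ci * RtoC (sin x)).
  - field; nz.
  - apply C_eq; simpl; ring.
Qed.

Lemma Ccos_RtoC (x : R) : Ccos (RtoC x) = RtoC (cos x).
Proof.
  unfold Ccos. rewrite Cexp_Ci, Cexp_opp_Ci.
  replace ((cos x, sin x) + (cos x, (- sin x)%R)) with (2 * RtoC (cos x)).
  - field; nz.
  - apply C_eq; simpl; ring.
Qed.

Lemma Csin2_Ccos2 z : Csin z * Csin z = 1 - Ccos z * Ccos z.
Proof.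
  assert (E : Cexp (Ci * z) * Cexp (- (Ci * z)) = 1).
  { rewrite <- Cexp_plus, Cplus_opp_r. apply Cexp_0. }
  unfold Csin, Ccos. set (a := Cexp (Ci * z)) in *. set (b := Cexp (- (Ci * z))) in *.
  replace ((a - b) / (2 * Ci) * ((a - b) / (2 * Ci))) with ((a - b) * (a - b) / (4 * (Ci * Ci)))
    by (field; nz).
  rewrite Ci_sq.
  assert (N4 : RtoC 4 <> 0) by (apply RtoC_neq_0; lra).
  replace ((a - b) * (a - b)) with ((a + b) * (a + b) - 4 * (a * b)) by ring. rewrite E.
  field; nz.
Qed.

(** The linear terms of the two exponentials cancel. *)
Lemma Ccos_sub1_bound u : (Cmod (Ccos u - 1) <= 2 * Cmod u ^ 2 * exp (Cmod u))%R.
Proof.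
  unfold Ccos.
  replace ((Cexp (Ci * u) + Cexp (- (Ci * u))) / 2 - 1) with
    (/ 2 * ((Cexp (Ci * u) - 1 - Ci * u) + (Cexp (- (Ci * u)) - 1 - - (Ci * u)))) by (field; nz).
  assert (H1 := Cmod_Cexp_sub2 (Ci * u)). assert (H2 := Cmod_Cexp_sub2 (- (Ci * u))).
  rewrite Cmod_opp in H2. rewrite !Cmod_mult, Cmod_Ci, Rmult_1_l in *.
  rewrite Cmod_inv, Cmod_RtoC_pos by (try apply C2_neq_0; lra).
  assert (T := Cmod_triangle (Cexp (Ci * u) - 1 - Ci * u) (Cexp (- (Ci * u)) - 1 - - (Ci * u))). lra.
Qed.

Lemma Rdiff_components f s (a b : R) :
  is_derive (fun t => Re (f t)) s a -> is_derive (fun t => Im (f t)) s b -> Rdiff f s (a, b).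
Proof.
  intros Ha Hb eps He. apply is_derive_Reals in Ha. apply is_derive_Reals in Hb.
  assert (He' : (0 < eps / 2)%R) by lra.
  destruct (Ha _ He') as [d1 B1]. destruct (Hb _ He') as [d2 B2].
  exists (Rmin d1 d2). split. { apply Rmin_pos; apply cond_pos. }
  intros h Hh. assert (h1 := Rlt_le_trans _ _ _ Hh (Rmin_l _ _)).
  assert (h2 := Rlt_le_trans _ _ _ Hh (Rmin_r _ _)).
  destruct (Req_dec h 0) as [->|N].
  { rewrite Rplus_0_r. replace (f s - f s - (a, b) * 0) with (RtoC 0) by ring.
    rewrite Cmod_0, Rabs_R0. lra. }
  specialize (B1 h N h1). specialize (B2 h N h2).
  assert (P : (0 < Rabs h)%R) by now apply Rabs_pos_lt.
  assert (Q : forall u v c : R, (Rabs ((u - v) / h - c) < eps / 2)%R -> (Rabs (u - v - c * h) <= eps / 2 * Rabs h)%R).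
  { intros u v c X. replace (u - v - c * h)%R with (((u - v) / h - c) * h)%R by (field; nz).
    rewrite Rabs_mult. apply Rmult_le_compat_r; lra. }
  apply Q in B1. apply Q in B2. eapply Rle_trans. { apply Cmod_le_abs. }
  replace (Re (f (s + h)%R - f s - (a, b) * RtoC h)) with (Re (f (s + h)%R) - Re (f s) - a * h)%R.
  2: { unfold Cminus. rewrite !re_plus, !re_opp, re_mult. simpl. ring. }
  replace (Im (f (s + h)%R - f s - (a, b) * RtoC h)) with (Im (f (s + h)%R) - Im (f s) - b * h)%R.
  2: { unfold Cminus. rewrite !im_plus, !im_opp, im_mult. simpl. ring. }
  lra.
Qed.

Lemma Rdiff_plus f g s l m : Rdiff f s l -> Rdiff g s m -> Rdiff (fun t => f t + g t) s (l + m).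
Proof.
  intros H1 H2 eps He. assert (He' : (0 < eps / 2)%R) by lra.
  destruct (H1 _ He') as [d1 [D1 B1]]. destruct (H2 _ He') as [d2 [D2 B2]].
  exists (Rmin d1 d2). split. { now apply Rmin_pos. }
  intros h Hh. specialize (B1 h (Rlt_le_trans _ _ _ Hh (Rmin_l _ _))).
  specialize (B2 h (Rlt_le_trans _ _ _ Hh (Rmin_r _ _))).
  replace (f (s + h)%R + g (s + h)%R - (f s + g s) - (l + m) * RtoC h)
    with ((f (s + h)%R - f s - l * RtoC h) + (g (s + h)%R - g s - m * RtoC h)) by ring.
  eapply Rle_trans. { apply Cmod_triangle. } lra.
Qed.

Lemma Rdiff_ext f g s l : (forall t, f t = g t) -> Rdiff f s l -> Rdiff g s l.
Proof.
  intros E H eps He. destruct (H eps He) as [d [Hd Hh]]. exists d. split; auto.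
  intros h Hm. rewrite <- !E. now apply Hh.
Qed.

Lemma Rdiff_minus f g s l m : Rdiff f s l -> Rdiff g s m -> Rdiff (fun t => f t - g t) s (l - m).
Proof.
  intros H1 H2. apply Rdiff_ext with (fun t => f t + (- (1)) * g t). { intros; ring. }
  replace (l - m) with (l + (- (1)) * m) by ring. apply Rdiff_plus; auto. now apply Rdiff_scal.
Qed.

Lemma Rdiff_zero_eq f (a b : R) : (a <= b)%R ->
  (forall s, (a <= s <= b)%R -> Rdiff f s 0) -> f a = f b.
Proof.
  intros Hab H. symmetry. apply Ceq_minus, Cmod_eq_0. apply Rle_antisym; [|apply Cmod_ge_0].
  assert (K := Rdiff_mean_value f (fun _ => RtoC 0) (fun _ => 0%R) (fun _ => 0%R) a b Hab H).
  cbv beta in K. rewrite Rminus_0_r in K. apply K.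
  - intros s _. apply (is_derive_const (K := R_AbsRing) (V := R_NormedModule)).
  - intros s _. rewrite Cmod_0. lra.
Qed.

(** * Primitives along the real axis and Wallis integrals *)

Definition primitive (f : R -> C) (x : R) : C :=
  (RInt (fun t => Re (f t)) 0 x, RInt (fun t => Im (f t)) 0 x).

Lemma primitive_spec (f : R -> C) : (forall t, exists l, Rdiff f t l) ->
  primitive f 0%R = 0 /\ forall t, Rdiff (primitive f) t (f t).
Proof.
  intros H.
  assert (Prim : forall g : R -> R, (forall t, ex_derive g t) ->
    RInt g 0 0 = 0%R /\ forall t, is_derive (fun x => RInt g 0 x) t (g t)).
  { intros g Hg. split. { apply (RInt_point (V := R_CompleteNormedModule)). }
    assert (Hc : forall t, continuous g t) by (intros t; apply (ex_derive_continuous g), Hg).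
    intros t. apply (is_derive_RInt (V := R_CompleteNormedModule) g (fun x => RInt g 0 x) 0 t); auto.
    apply filter_forall. intros x. apply RInt_correct, (ex_RInt_continuous (V := R_CompleteNormedModule)). auto. }
  destruct (Prim (fun t => Re (f t))) as [A1 A2].
  { intros t. destruct (H t) as [l Hl]. eexists. now apply Rdiff_is_derive_re with (1 := Hl). }
  destruct (Prim (fun t => Im (f t))) as [B1 B2].
  { intros t. destruct (H t) as [l Hl]. eexists. now apply Rdiff_is_derive_im with (1 := Hl). }
  split.
  - unfold primitive. now rewrite A1, B1.
  - intros t. rewrite (surjective_pairing (f t)). apply Rdiff_components; [apply A2 | apply B2].
Qed.

(* With J_n(s) the integral of cos(2 s t) cos^n t over [0, PI/2], integration by
   parts gives (n^2 - 4 s^2) J_n(s) = n (n - 1) J_(n-2)(s), and J_n(s) / J_n(0)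
   tends to 1; iterating from J_0 yields Euler's product for the sine. *)
Definition wallis_integrand (n : nat) (s w : C) : C := Ccos w ^ n * Ccos (2 * s * w).

Lemma Cdiff_pow f z l n : Cdiff f z l -> Cdiff (fun w => f w ^ S n) z (RtoC (INR (S n)) * f z ^ n * l).
Proof.
  intros H. induction n as [|n IH].
  - apply Cdiff_ext with f. { intros; simpl; ring. }
    eapply Cdiff_eq; [exact H|]. simpl. ring.
  - apply Cdiff_ext with (fun w => f w * f w ^ S n). { reflexivity. }
    eapply Cdiff_eq; [apply (Cdiff_mult f (fun w => f w ^ S n)); [exact H | exact IH]|].
    rewrite (RtoC_INR_S (S n)). rewrite !Cpow_S. ring.
Qed.

Lemma Cdiff_scaled f a z l : Cdiff f (a * z) l -> Cdiff (fun w => f (a * w)) z (l * a).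
Proof.
  intros H. apply Cdiff_ext with (fun w => f (a * w + 0)). { intros; now rewrite Cplus_0_r. }
  apply (Cdiff_comp f (fun w => a * w + 0)); [apply Cdiff_affine | now rewrite Cplus_0_r].
Qed.

Lemma wallis_integrand_diff n s w : exists l, Cdiff (wallis_integrand n s) w l.
Proof.
  assert (H : exists m, Cdiff (fun w => Ccos w ^ n) w m).
  { destruct n as [|n]; eexists; [apply (Cdiff_const 1) | apply Cdiff_pow, Cdiff_Ccos]. }
  destruct H as [m Hm]. eexists.
  apply (Cdiff_mult (fun w => Ccos w ^ n) (fun w => Ccos (2 * s * w))); [exact Hm|].
  apply (Cdiff_scaled Ccos), Cdiff_Ccos.
Qed.

Lemma Cdiff_Rdiff f (t : R) l : Cdiff f (RtoC t) l -> Rdiff (fun x => f (RtoC x)) t l.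
Proof.
  intros H. apply Rdiff_ext with (fun x => f (1 * RtoC x + 0)).
  { intros x. f_equal. ring. }
  replace l with (l * 1) by ring. apply Cdiff_Rdiff_line.
  now replace (1 * RtoC t + 0) with (RtoC t) by ring.
Qed.

Definition wallis_primitive (n : nat) (s : C) (A : R -> C) : Prop :=
  A 0%R = 0 /\ forall t, Rdiff A t (wallis_integrand n s (RtoC t)).

Definition wallis_integral (n : nat) (s : C) : R -> C :=
  primitive (fun t => wallis_integrand n s (RtoC t)).

Lemma wallis_integral_spec n s : wallis_primitive n s (wallis_integral n s).
Proof.
  apply (primitive_spec (fun t => wallis_integrand n s (RtoC t))).
  intros t. destruct (wallis_integrand_diff n s (RtoC t)) as [l Hl].
  exists l. now apply (Cdiff_Rdiff (wallis_integrand n s)).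
Qed.

Lemma wallis_primitive_ex n s : exists A, wallis_primitive n s A.
Proof. eexists. apply wallis_integral_spec. Qed.

Lemma Ccos_0 : Ccos 0 = 1.
Proof. rewrite Ccos_RtoC, cos_0. reflexivity. Qed.
Lemma Csin_0 : Csin 0 = 0.
Proof. rewrite Csin_RtoC, sin_0. reflexivity. Qed.

Lemma PI2_pos' : (0 <= PI / 2)%R.
Proof. assert (H := PI_RGT_0). lra. Qed.

Lemma wallis_recurrence n s A B : wallis_primitive (S (S n)) s A -> wallis_primitive n s B ->
  (RtoC (INR (S (S n))) ^ 2 - 4 * s ^ 2) * A (PI / 2)%R
  = RtoC (INR (S (S n))) * RtoC (INR (S n)) * B (PI / 2)%R.
Proof.
  intros [A0 HA] [B0 HB]. set (N := RtoC (INR (S (S n)))). set (N1 := RtoC (INR (S n))).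
  assert (EN : N = N1 + 1) by apply RtoC_INR_S.
  (* The boundary terms of the two integrations by parts. They vanish at 0 through the sines and at
     PI/2 through the powers of the cosine. *)
  set (b := fun w => N * (Ccos w ^ S n * Csin w * Ccos (2 * s * w))
     - 2 * s * (Ccos w ^ S (S n) * Csin (2 * s * w))).
  assert (Hb : forall w, Cdiff b w ((N ^ 2 - 4 * s ^ 2) * wallis_integrand (S (S n)) s w
     - N * N1 * wallis_integrand n s w)).
  { intros w. eapply Cdiff_eq.
    - apply Cdiff_minus; apply Cdiff_scal.
      + apply (Cdiff_mult (fun w => Ccos w ^ S n * Csin w) (fun w => Ccos (2 * s * w))).
        * apply (Cdiff_mult (fun w => Ccos w ^ S n) Csin); [apply Cdiff_pow, Cdiff_Ccos | apply Cdiff_Csin].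
        * apply (Cdiff_scaled Ccos), Cdiff_Ccos.
      + apply (Cdiff_mult (fun w => Ccos w ^ S (S n)) (fun w => Csin (2 * s * w))).
        * apply Cdiff_pow, Cdiff_Ccos.
        * apply (Cdiff_scaled Csin), Cdiff_Csin.
    - unfold wallis_integrand. fold N N1. rewrite EN, !Cpow_S.
      set (c := Ccos w). set (C2 := Ccos (2 * s * w)). set (S2 := Csin (2 * s * w)).
      replace (N1 * c ^ n * - Csin w * Csin w) with (- (N1 * c ^ n) * (Csin w * Csin w)) by ring.
      replace ((N1 + 1) * ((- (N1 * c ^ n) * (Csin w * Csin w) + c * c ^ n * Ccos w) * C2
         + c * c ^ n * Csin w * (- S2 * (2 * s)))
         - 2 * s * ((N1 + 1) * (c * c ^ n) * - Csin w * S2 + c * (c * c ^ n) * (C2 * (2 * s)))) with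
      ((N1 + 1) * ((- (N1 * c ^ n) * (Csin w * Csin w) + c * c ^ n * Ccos w) * C2)
         - 2 * s * (c * (c * c ^ n) * (C2 * (2 * s)))) by ring.
      rewrite Csin2_Ccos2. fold c. ring. }
  assert (K := Rdiff_zero_eq (fun t => (N ^ 2 - 4 * s ^ 2) * A t - N * N1 * B t - b (RtoC t)) 0 (PI / 2) PI2_pos').
  cbv beta in K. rewrite A0, B0 in K.
  assert (b0 : b 0 = 0).
  { unfold b. rewrite !Cmult_0_r, Ccos_0, Csin_0. ring. }
  assert (b1 : b (RtoC (PI / 2)) = 0).
  { unfold b. rewrite Ccos_RtoC, cos_PI2. rewrite !Cpow_S. ring. }
  rewrite b0, b1 in K. apply Ceq_minus.
  transitivity ((N ^ 2 - 4 * s ^ 2) * A (PI / 2)%R - N * N1 * B (PI / 2)%R - 0). { ring. }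
  rewrite <- K; [ring|]. intros t _.
  replace (RtoC 0) with ((N ^ 2 - 4 * s ^ 2) * wallis_integrand (S (S n)) s (RtoC t)
     - N * N1 * wallis_integrand n s (RtoC t) - ((N ^ 2 - 4 * s ^ 2) * wallis_integrand (S (S n)) s (RtoC t)
     - N * N1 * wallis_integrand n s (RtoC t))) by ring.
  apply Rdiff_minus; [apply Rdiff_minus; apply Rdiff_scal; auto|].
  apply Cdiff_Rdiff, Hb.
Qed.

Lemma wallis_base s A : wallis_primitive 0 s A -> 2 * s * A (PI / 2)%R = Csin (RtoC PI * s).
Proof.
  intros [A0 HA].
  assert (K := Rdiff_zero_eq (fun t => 2 * s * A t - Csin (2 * s * RtoC t)) 0 (PI / 2) PI2_pos').
  cbv beta in K. rewrite A0, !Cmult_0_r, Csin_0 in K.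
  apply Ceq_minus. replace (RtoC PI * s) with (2 * s * RtoC (PI / 2)).
  - rewrite <- K; [ring|]. intros t _.
    replace (RtoC 0) with (2 * s * wallis_integrand 0 s (RtoC t) - Ccos (2 * s * RtoC t) * (2 * s)).
    + apply Rdiff_minus; [now apply Rdiff_scal|].
      apply (Cdiff_Rdiff (fun w => Csin (2 * s * w))). apply (Cdiff_scaled Csin), Cdiff_Csin.
    + unfold wallis_integrand. simpl. ring.
  - rewrite RtoC_div by lra. field; nz.
Qed.

Lemma wallis_base_0 A : wallis_primitive 0 0 A -> A (PI / 2)%R = RtoC (PI / 2).
Proof.
  intros [A0 HA].
  assert (K := Rdiff_zero_eq (fun t => A t - RtoC t) 0 (PI / 2) PI2_pos').
  cbv beta in K. rewrite A0 in K.
  apply Ceq_minus. rewrite <- K; [ring|]. intros t _.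
  replace (RtoC 0) with (wallis_integrand 0 0 (RtoC t) - 1).
  - apply Rdiff_minus; auto. apply Rdiff_ext with (fun x => 1 * RtoC x + 0). { intros; ring. }
    apply (Cdiff_Rdiff (fun w => 1 * w + 0)), Cdiff_affine.
  - unfold wallis_integrand. simpl. rewrite Cmult_0_r, Cmult_0_l, Ccos_0. ring.
Qed.

(** The classical Wallis integrals, that is J_(2m)(0). *)
Fixpoint wallis (m : nat) : R :=
  match m with O => (PI / 2)%R | S k => (INR (2 * k + 1) / INR (2 * k + 2) * wallis k)%R end.

Lemma wallis_pos m : (0 < wallis m)%R.
Proof.
  induction m as [|m IH]; simpl wallis; [assert (H := PI_RGT_0); lra|].
  apply Rmult_lt_0_compat; auto. apply Rdiv_lt_0_compat; apply lt_0_INR; lia.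
Qed.

Lemma wallis_value m A : wallis_primitive (2 * m) 0 A -> A (PI / 2)%R = RtoC (wallis m).
Proof.
  revert A. induction m as [|m IH]; intros A HA; [now apply wallis_base_0|].
  destruct (wallis_primitive_ex (2 * m) 0) as [B HB].
  replace (2 * S m)%nat with (S (S (2 * m))) in HA by lia.
  assert (K := wallis_recurrence _ _ _ _ HA HB). rewrite (IH _ HB) in K.
  assert (N1 : RtoC (INR (S (S (2 * m)))) <> 0) by (apply RtoC_INR_neq_0; lia).
  simpl wallis. replace (m + (m + 0))%nat with (2 * m)%nat by lia.
  rewrite RtoC_mult, RtoC_div by (apply not_0_INR; lia).
  replace (2 * m + 1)%nat with (S (2 * m)) by lia. replace (2 * m + 2)%nat with (S (S (2 * m))) by lia.
  set (N := RtoC (INR (S (S (2 * m))))) in *.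
  replace (A (PI / 2)%R) with ((N ^ 2 - 4 * 0 ^ 2) * A (PI / 2)%R / (N * N)) by (field; nz).
  rewrite K. field; nz.
Qed.

Lemma t_cos_le_sin (t : R) : (0 <= t <= PI / 2)%R -> (0 <= t * cos t <= sin t)%R.
Proof.
  intros [H0 H1]. assert (HP := PI_RGT_0). split.
  - apply Rmult_le_pos; auto. apply cos_ge_0; lra.
  - assert (K := nondecreasing_derive (fun x => sin x - x * cos x)%R (fun x => x * sin x)%R 0 t H0).
    cbv beta in K. rewrite sin_0 in K. assert (X : (0 - 0 * cos 0 <= sin t - t * cos t)%R); [|lra].
    apply K.
    + intros s _. auto_derive; auto. ring.
    + intros s Hs. apply Rmult_le_pos; [lra|]. apply sin_ge_0; lra.
Qed.

(** The bound 2 |u|^2 e^|u| for cos u - 1 at u = 2 s t, with t <= PI/2 in the exponential and t^2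
    split off. *)
Definition wallis_const (s : C) : R := (8 * Cmod s ^ 2 * exp (Cmod s * PI))%R.

(** Since |cos (2 s t) - 1| <= K t^2 and t cos t <= sin t, the integrands for s and for 0 differ by
    at most K cos^(2m) t sin^2 t = K (cos^(2m) t - cos^(2m+2) t). Its integral is K times the
    difference of consecutive Wallis integrals, a fraction 1/(2m + 1) of the last one. *)
Lemma wallis_ratio_bound m s A : wallis_primitive (2 * S m) s A ->
  (Cmod (A (PI / 2)%R / RtoC (wallis (S m)) - 1) <= wallis_const s * / INR (S m))%R.
Proof.
  intros [A0 HA].
  destruct (wallis_primitive_ex (2 * S m) 0) as [B HB].
  destruct (wallis_primitive_ex (2 * m) 0) as [D HD].
  set (K := wallis_const s).
  assert (K0 : (0 <= K)%R).
  { unfold K, wallis_const. assert (X := exp_pos (Cmod s * PI)). assert (Y := pow2_ge_0 (Cmod s)). nra. }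
  assert (M := Rdiff_mean_value (fun t => A t - B t)
    (fun t => wallis_integrand (2 * S m) s (RtoC t) - wallis_integrand (2 * S m) 0 (RtoC t))
    (fun t => K * (Re (D t - B t)))%R
    (fun t => K * (Re (wallis_integrand (2 * m) 0 (RtoC t) - wallis_integrand (2 * S m) 0 (RtoC t))))%R
    0 (PI / 2) PI2_pos'). cbv beta in M.
  destruct HB as [B0 HB']. destruct HD as [D0 HD'].
  assert (Hw : (0 < wallis (S m))%R) by apply wallis_pos.
  assert (Hv : (wallis m - wallis (S m) = wallis (S m) * / INR (2 * m + 1))%R).
  { simpl wallis. replace (m + (m + 0))%nat with (2 * m)%nat by lia.
    assert (P : (0 < INR (2 * m + 1))%R) by (apply lt_0_INR; lia).
    replace (INR (2 * m + 2)) with (INR (2 * m + 1) + 1)%R by (rewrite <- S_INR; f_equal; lia).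
    field. lra. }
  rewrite (wallis_value (S m) B), (wallis_value m D) in M by (split; auto).
  rewrite A0, B0, D0 in M. replace (0 - 0) with (RtoC 0) in M by ring.
  assert (N : RtoC (wallis (S m)) <> 0) by (apply RtoC_neq_0; lra).
  replace (A (PI / 2)%R / RtoC (wallis (S m)) - 1) with
    ((A (PI / 2)%R - RtoC (wallis (S m)) - 0) / RtoC (wallis (S m))) by (field; nz).
  rewrite Cmod_div, (Cmod_RtoC_pos (wallis (S m))) by (auto; lra).
  apply Rmult_le_reg_r with (wallis (S m)); auto. unfold Rdiv at 1. rewrite Rmult_assoc, Rinv_l, Rmult_1_r by lra.
  eapply Rle_trans; [apply M|].
  - intros t _. apply Rdiff_minus; auto.
  - intros t _. apply (is_derive_scal (fun t => Re (D t - B t))).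
    apply (Rdiff_is_derive_re (fun t => D t - B t)), Rdiff_minus; auto.
  - intros t Ht. unfold wallis_integrand.
    rewrite (Cmult_0_r 2), (Cmult_0_l (RtoC t)), Ccos_0, Ccos_RtoC.
    replace (RtoC (cos t) ^ (2 * S m) * Ccos (2 * s * RtoC t) - RtoC (cos t) ^ (2 * S m) * 1) with
      (RtoC (cos t) ^ (2 * S m) * (Ccos (2 * s * RtoC t) - 1)) by ring.
    destruct (t_cos_le_sin t Ht) as [T1 T2]. assert (HP := PI_RGT_0).
    assert (C0 : (0 <= cos t)%R) by (apply cos_ge_0; lra).
    rewrite <- !RtoC_pow, Cmod_mult, Cmod_RtoC_pos by now apply pow_le.
    replace (Re (RtoC (cos t ^ (2 * m)) * 1 - RtoC (cos t ^ (2 * S m)) * 1)) with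
      (cos t ^ (2 * m) * (sin t) ^ 2)%R.
    2: { assert (X := sin2_cos2 t). unfold Rsqr in X.
         replace (RtoC (cos t ^ (2 * m)) * 1 - RtoC (cos t ^ (2 * S m)) * 1)
           with (RtoC (cos t ^ (2 * m) - cos t ^ (2 * S m))) by (rewrite RtoC_minus; ring).
         rewrite re_RtoC. replace (2 * S m)%nat with (2 * m + 2)%nat by lia. rewrite pow_add.
         replace (sin t ^ 2)%R with (1 - cos t ^ 2)%R by (simpl; lra). simpl. ring. }
    assert (Bd := Ccos_sub1_bound (2 * s * RtoC t)).
    assert (Em : Cmod (2 * s * RtoC t) = (2 * Cmod s * t)%R).
    { rewrite !Cmod_mult, !Cmod_RtoC_pos by lra. ring. }
    rewrite Em in Bd. assert (Ps := Cmod_ge_0 s).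
    assert (Ee : (exp (2 * Cmod s * t) <= exp (Cmod s * PI))%R) by (apply exp_le; nra).
    assert (Pe := exp_pos (2 * Cmod s * t)).
    assert (Bd2 : (Cmod (Ccos (2 * s * RtoC t) - 1) <= K * t ^ 2)%R).
    { eapply Rle_trans; [exact Bd|]. unfold K, wallis_const.
      replace (8 * Cmod s ^ 2 * exp (Cmod s * PI) * t ^ 2)%R with (8 * (Cmod s ^ 2 * t ^ 2) * exp (Cmod s * PI))%R by ring.
      replace (2 * (2 * Cmod s * t) ^ 2)%R with (8 * (Cmod s ^ 2 * t ^ 2))%R by ring.
      apply Rmult_le_compat_l; auto. assert (X := pow2_ge_0 (Cmod s)). assert (Y := pow2_ge_0 t). nra. }
    replace (2 * S m)%nat with (2 * m + 2)%nat by lia. rewrite pow_add.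
    assert (C2m : (0 <= cos t ^ (2 * m))%R) by now apply pow_le.
    apply Rle_trans with (cos t ^ (2 * m) * cos t ^ 2 * (K * t ^ 2))%R.
    { apply Rmult_le_compat_l; auto. apply Rmult_le_pos; auto. apply pow2_ge_0. }
    replace (cos t ^ (2 * m) * cos t ^ 2 * (K * t ^ 2))%R with (K * (cos t ^ (2 * m) * (t * cos t) ^ 2))%R by ring.
    apply Rmult_le_compat_l; auto. apply Rmult_le_compat_l; auto. apply pow_incr. lra.
  - rewrite <- RtoC_minus, !re_RtoC, Hv.
    assert (I : (/ INR (2 * m + 1) <= / INR (S m))%R).
    { apply Rinv_le_contravar; [apply lt_0_INR; lia | apply le_INR; lia]. }
    assert (K * (wallis (S m) * / INR (2 * m + 1)) <= K * (wallis (S m) * / INR (S m)))%R.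
    { apply Rmult_le_compat_l; auto. apply Rmult_le_compat_l; lra. }
    lra.
Qed.

(** * Euler's product for the sine and the reflection formula *)

Fixpoint sinprod (m : nat) (s : C) : C :=
  match m with O => 1 | S k => sinprod k s * (1 - s ^ 2 / RtoC (INR (S k)) ^ 2) end.

Lemma sin_sinprod m s A : wallis_primitive (2 * m) s A ->
  Csin (RtoC PI * s) = RtoC PI * s * sinprod m s * (A (PI / 2)%R / RtoC (wallis m)).
Proof.
  revert A. induction m as [|m IH]; intros A HA.
  - rewrite <- (wallis_base s A) by exact HA. simpl. rewrite RtoC_div by lra.
    field; nz.
  - destruct (wallis_primitive_ex (2 * m) s) as [B HB]. rewrite (IH B HB).
    replace (2 * S m)%nat with (S (S (2 * m))) in HA by lia.
    assert (K := wallis_recurrence _ _ _ _ HA HB).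
    assert (P : (0 < wallis m)%R) by apply wallis_pos.
    assert (N : RtoC (wallis m) <> 0) by (apply RtoC_neq_0; lra).
    simpl wallis. simpl sinprod. replace (m + (m + 0))%nat with (2 * m)%nat by lia.
    assert (N1 : RtoC (INR (S (2 * m))) <> 0) by (apply RtoC_INR_neq_0; lia).
    assert (N2 : RtoC (INR (S (S (2 * m)))) <> 0) by (apply RtoC_INR_neq_0; lia).
    rewrite RtoC_mult, RtoC_div by (apply not_0_INR; lia).
    replace (2 * m + 1)%nat with (S (2 * m)) by lia. replace (2 * m + 2)%nat with (S (S (2 * m))) by lia.
    assert (E : RtoC (INR (S (S (2 * m)))) = 2 * RtoC (INR (S m))).
    { rewrite <- RtoC_mult. f_equal. rewrite !S_INR, mult_INR. simpl. ring. }
    assert (N3 : RtoC (INR (S m)) <> 0) by (apply RtoC_INR_neq_0; lia).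
    change (match m with O => 1%R | S _ => (INR m + 1)%R end) with (INR (S m)).
    set (M := RtoC (INR (S m))) in *. set (M1 := RtoC (INR (S (2 * m)))) in *.
    rewrite E in *.
    replace (B (PI / 2)%R) with (2 * M * M1 * B (PI / 2)%R / (2 * M * M1)) by (field; nz).
    rewrite <- K. simpl. field; nz.
Qed.

Lemma rising_product m s :
  rising s (S m) * rising (1 - s) m = s * RtoC (INR (fact m)) ^ 2 * sinprod m s.
Proof.
  induction m as [|m IH]; [simpl; ring|].
  change (rising s (S (S m))) with (rising s (S m) * (s + RtoC (INR (S m)))).
  change (rising (1 - s) (S m)) with (rising (1 - s) m * (1 - s + RtoC (INR m))).
  replace (rising s (S m) * (s + RtoC (INR (S m))) * (rising (1 - s) m * (1 - s + RtoC (INR m))))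
    with (rising s (S m) * rising (1 - s) m * ((s + RtoC (INR (S m))) * (1 - s + RtoC (INR m)))) by ring.
  rewrite IH, RtoC_INR_fact_S. assert (N3 : RtoC (INR (S m)) <> 0) by (apply RtoC_INR_neq_0; lia).
  change (sinprod (S m) s) with (sinprod m s * (1 - s ^ 2 / RtoC (INR (S m)) ^ 2)).
  replace (1 - s + RtoC (INR m)) with (RtoC (INR (S m)) - s) by (rewrite RtoC_INR_S; ring).
  field; nz.
Qed.

(** The powers (m + 1)^s and (m + 1)^(-s) cancel and the linear factors pair off to 1 - s^2/k^2,
    except for one unpaired factor that becomes 1 - s/(m + 1). *)
Lemma rgn_reflection m s :
  rgn m s * rgn m (1 - s) = s * sinprod m s * (1 - s * RtoC (/ INR (S m))).
Proof.
  rewrite !rgn_closed. change (rising (1 - s) (S m)) with (rising (1 - s) m * (1 - s + RtoC (INR m))).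
  set (L := RtoC (ln (INR (S m)))).
  assert (P : (0 < INR (S m))%R) by (apply lt_0_INR; lia).
  replace ((1 - s) * L) with (L + - (s * L)) by ring. rewrite Cexp_plus, Cexp_opp.
  unfold L at 2. rewrite Cexp_RtoC, exp_ln by auto.
  assert (N1 := Cexp_neq_0 (s * L)). assert (N2 := INR_fact_neq_0_C m).
  assert (N3 : RtoC (INR (S m)) <> 0) by (apply RtoC_INR_neq_0; lia).
  replace (rising s (S m) / (RtoC (INR (fact m)) * Cexp (s * L)) *
    (rising (1 - s) m * (1 - s + RtoC (INR m)) / (RtoC (INR (fact m)) * (RtoC (INR (S m)) * / Cexp (s * L)))))
    with (rising s (S m) * rising (1 - s) m * (1 - s + RtoC (INR m)) / (RtoC (INR (fact m)) ^ 2 * RtoC (INR (S m))))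
    by (field; nz).
  rewrite rising_product, RtoC_inv by lra.
  replace (1 - s + RtoC (INR m)) with (RtoC (INR (S m)) - s) by (rewrite RtoC_INR_S; ring).
  field; nz.
Qed.

Theorem rGam_reflection s : RtoC PI * (rGam s * rGam (1 - s)) = Csin (RtoC PI * s).
Proof.
  set (A := fun m => wallis_integral (2 * m) s).
  assert (HA : forall m, wallis_primitive (2 * m) s (A m)) by (intros m; apply wallis_integral_spec).
  set (q := fun m => A m (PI / 2)%R / RtoC (wallis m)).
  assert (Hq : Clim eventually q 1).
  { apply Clim_squeeze with (fun m => wallis_const s * / INR m)%R.
    - exists 1%nat. intros [|m] Hm; [lia|]. apply wallis_ratio_bound, HA.
    - intros eps He. assert (H := is_lim_seq_const_inv (wallis_const s)).
      apply is_lim_seq_spec in H. destruct (H (mkposreal _ He)) as [N HN].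
      exists (S N). intros n Hn. destruct n as [|n]; [lia|].
      specialize (HN n ltac:(lia)). simpl pos in HN. rewrite Rminus_0_r in HN.
      eapply Rle_lt_trans; [apply Rle_abs | exact HN]. }
  (* For every m this expression equals sin(pi s) (1 - s/(m + 1)), so both sides of the formula are
     limits of the same sequence. *)
  apply (Clim_unique eventually (fun m => RtoC PI * (rgn m s * rgn m (1 - s)) * q m)).
  - replace (RtoC PI * (rGam s * rGam (1 - s))) with (RtoC PI * (rGam s * rGam (1 - s)) * 1) by ring.
    apply Clim_mult; auto. apply Clim_mult; [apply Clim_const|]. apply Clim_mult; apply rGam_lim.
  - apply Clim_ext with (fun m => Csin (RtoC PI * s) * (1 - s * RtoC (/ INR (S m)))).
    + intros m. rewrite rgn_reflection, (sin_sinprod m s (A m)) by apply HA. unfold q. ring.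
    + apply Clim_eq with (Csin (RtoC PI * s) * (1 - s * 0)); [|ring].
      apply Clim_mult; [apply Clim_const|]. apply Clim_minus; [apply Clim_const|].
      apply Clim_mult; [apply Clim_const | apply Clim_INR_inv].
Qed.

(** * Exponential series *)

Definition entire (a : nat -> C) : Prop :=
  forall r : R, (0 <= r)%R -> ex_series (fun k => Cmod (a k) * r ^ k)%R.

(* With [e^y = z/2], this is [(z/2)^s] times a power series in [(z/2)^2], and
   [z d/dz] becomes [d/dy]. *)
Definition expser (s : C) (a : nat -> C) (y : C) : C :=
  CSeries (fun k => a k * Cexp ((s + 2 * RtoC (INR k)) * y)).

Definition dcoef (s : C) (a : nat -> C) (k : nat) : C := (s + 2 * RtoC (INR k)) * a k.

Lemma Cmod_scal_pow (a : C) (r : R) k : (0 <= r)%R -> Cmod (a * RtoC r ^ k) = (Cmod a * r ^ k)%R.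
Proof. intros H. rewrite Cmod_mult, Cmod_pow, Cmod_RtoC_pos; auto. Qed.

Lemma entire_pow_summable a w : entire a -> Csummable (fun k => a k * w ^ k).
Proof.
  intros H. apply Csummable_le with (2 := H (Cmod w) (Cmod_ge_0 w)).
  intros k. rewrite Cmod_mult, Cmod_pow. apply Rle_refl.
Qed.

(** A geometric factor B^k only rescales the arbitrary radius r. Factors polynomial in k are brought
    into this form by bounding them by an exponential. *)
Lemma entire_le a b (C B : R) : (0 <= C)%R -> (0 <= B)%R ->
  (forall k, (Cmod (b k) <= C * B ^ k * Cmod (a k))%R) -> entire a -> entire b.
Proof.
  intros HC HB H Ha r Hr.
  apply ex_series_pos_le with (fun k => C * (Cmod (a k) * (B * r) ^ k))%R.
  - intros k. assert (P := Cmod_ge_0 (b k)). assert (Q := pow_le r k Hr). split; [nra|].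
    rewrite Rpow_mult_distr. replace (C * (Cmod (a k) * (B ^ k * r ^ k)))%R with (C * B ^ k * Cmod (a k) * r ^ k)%R by ring.
    apply Rmult_le_compat_r; auto.
  - apply (ex_series_scal (K := R_AbsRing) (V := R_NormedModule) C). apply Ha. now apply Rmult_le_pos.
Qed.

Lemma entire_minus a b : entire a -> entire b -> entire (fun k => a k - b k).
Proof.
  intros Ha Hb r Hr. apply ex_series_pos_le with (fun k => Cmod (a k) * r ^ k + Cmod (b k) * r ^ k)%R.
  - intros k. assert (Q := pow_le r k Hr). split; [apply Rmult_le_pos; auto; apply Cmod_ge_0|].
    rewrite <- Rmult_plus_distr_r. apply Rmult_le_compat_r; auto. apply Cmod_triangle_sub.
  - now apply (ex_series_plus (fun k => Cmod (a k) * r ^ k)%R (fun k => Cmod (b k) * r ^ k)%R); [apply Ha | apply Hb].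
Qed.

Lemma entire_scal c a : entire a -> entire (fun k => c * a k).
Proof.
  apply entire_le with (C := Cmod c) (B := 1%R); [apply Cmod_ge_0 | lra |].
  intros k. rewrite pow1, Cmod_mult. lra.
Qed.

Lemma entire_conv a b : entire a -> entire b -> entire (conv a b).
Proof.
  intros Ha Hb r Hr.
  assert (E : forall k, conv (fun k => a k * RtoC r ^ k) (fun k => b k * RtoC r ^ k) k = conv a b k * RtoC r ^ k).
  { intros k. unfold conv. rewrite Cmult_comm, <- Csum_scal. apply Csum_ext. intros j Hj.
    replace (RtoC r ^ k) with (RtoC r ^ j * RtoC r ^ (k - j)); [ring|].
    rewrite <- Cpow_add_r. f_equal. lia. }
  assert (H := Csummable_conv _ _ (entire_pow_summable a r Ha) (entire_pow_summable b r Hb)).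
  revert H. apply ex_series_ext. intros k. rewrite E. now apply Cmod_scal_pow.
Qed.

Lemma freq_bound s k : (Cmod (s + 2 * RtoC (INR k)) <= Cmod s + 2 * INR k)%R.
Proof.
  eapply Rle_trans; [apply Cmod_triangle|]. rewrite Cmod_mult, !Cmod_RtoC_pos; try lra. apply pos_INR.
Qed.

Lemma exp_INR_mult (x : R) k : exp (x * INR k) = (exp x ^ k)%R.
Proof.
  induction k as [|k IH]; [simpl; now rewrite Rmult_0_r, exp_0|].
  rewrite S_INR, Rmult_plus_distr_l, exp_plus, IH, Rmult_1_r. simpl. ring.
Qed.

Lemma exp_freq_bound s k (c : R) : (0 <= c)%R ->
  (exp (c * Cmod (s + 2 * RtoC (INR k))) <= exp (c * Cmod s) * exp (2 * c) ^ k)%R.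
Proof.
  intros Hc. rewrite <- exp_INR_mult, <- exp_plus. apply exp_le.
  assert (H := freq_bound s k). apply Rmult_le_compat_l with (r := c) in H; auto. lra.
Qed.

Lemma entire_dcoef s a : entire a -> entire (dcoef s a).
Proof.
  apply entire_le with (C := exp (1 * Cmod s)) (B := exp (2 * 1)); try (left; apply exp_pos).
  intros k. unfold dcoef. rewrite Cmod_mult. apply Rmult_le_compat_r; [apply Cmod_ge_0|].
  eapply Rle_trans; [|apply exp_freq_bound; lra].
  assert (X := exp_ge_1_plus (1 * Cmod (s + 2 * RtoC (INR k)))). lra.
Qed.

Lemma Cexp_freq s k y : Cexp ((s + 2 * RtoC (INR k)) * y) = Cexp (s * y) * Cexp (2 * y) ^ k.
Proof. rewrite <- Cexp_INR_mult, <- Cexp_plus. f_equal. ring. Qed.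

Lemma expser_pow s a y : entire a ->
  expser s a y = Cexp (s * y) * CSeries (fun k => a k * Cexp (2 * y) ^ k).
Proof.
  intros Ha. rewrite <- CSeries_scal by now apply entire_pow_summable.
  apply CSeries_ext. intros k. rewrite Cexp_freq. ring.
Qed.

Lemma expser_summable s a y : entire a -> Csummable (fun k => a k * Cexp ((s + 2 * RtoC (INR k)) * y)).
Proof.
  intros Ha. apply Csummable_le with (fun k => Cmod (Cexp (s * y) * (a k * Cexp (2 * y) ^ k))).
  - intros k. rewrite Cexp_freq. apply Req_le. f_equal. ring.
  - apply (Csummable_scal (Cexp (s * y))). now apply entire_pow_summable.
Qed.

Lemma expser_ext s a b y : (forall k, a k = b k) -> expser s a y = expser s b y.
Proof. intros H. apply CSeries_ext. intros k. now rewrite H. Qed.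

Lemma expser_scal s c a y : entire a -> expser s (fun k => c * a k) y = c * expser s a y.
Proof.
  intros Ha. unfold expser. rewrite <- CSeries_scal by now apply expser_summable.
  apply CSeries_ext. intros k. ring.
Qed.

Lemma expser_minus s a b y : entire a -> entire b ->
  expser s (fun k => a k - b k) y = expser s a y - expser s b y.
Proof.
  intros Ha Hb. unfold expser. rewrite <- CSeries_minus by now apply expser_summable.
  apply CSeries_ext. intros k. ring.
Qed.

Lemma expser_mult s t a b y : entire a -> entire b ->
  expser s a y * expser t b y = expser (s + t) (conv a b) y.
Proof.
  intros Ha Hb. rewrite !expser_pow by (auto; now apply entire_conv).
  set (w := Cexp (2 * y)).
  replace (CSeries (fun k => conv a b k * w ^ k)) with
    (CSeries (fun k => a k * w ^ k) * CSeries (fun k => b k * w ^ k)).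
  - rewrite Cmult_plus_distr_r, Cexp_plus. ring.
  - rewrite <- CSeries_conv by now apply entire_pow_summable. apply CSeries_ext. intros k.
    unfold conv. rewrite (Cmult_comm _ (w ^ k)), <- Csum_scal. apply Csum_ext. intros j Hj.
    replace (w ^ k) with (w ^ j * w ^ (k - j)); [ring|].
    rewrite <- Cpow_add_r. f_equal. lia.
Qed.

Lemma expser_diff s a y : entire a -> Cdiff (expser s a) y (expser s (dcoef s a) y).
Proof.
  intros Ha.
  set (lam := fun k => s + 2 * RtoC (INR k)).
  (* For |h| < 1 the remainder of e^(lam h) is at most 2 |h|^2 e^(3 |lam|): one e^|lam| for the
     exponential and two for |lam|^2. As |lam| grows linearly in k, e^(3 |lam|) is geometric in
     k. *)
  set (B := fun k => (Cmod (Cexp (s * y)) * (2 * exp (3 * Cmod s)) *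
    (Cmod (a k) * (Cmod (Cexp (2 * y)) * exp (2 * 3)) ^ k))%R).
  assert (HB : ex_series B).
  { apply (ex_series_scal (K := R_AbsRing) (V := R_NormedModule)). apply Ha.
    apply Rmult_le_pos; [apply Cmod_ge_0 | left; apply exp_pos]. }
  apply Cdiff_quad with (d := 1%R) (M := Series B); [lra|]. intros h Hh.
  assert (S1 := expser_summable s a (y + h) Ha). assert (S2 := expser_summable s a y Ha).
  assert (S3 := expser_summable s (dcoef s a) y (entire_dcoef s a Ha)).
  unfold expser. rewrite (Cmult_comm _ h), <- CSeries_scal, <- !CSeries_minus; auto.
  2: { apply Csummable_minus; auto. }
  2: { now apply Csummable_scal. }
  rewrite Rmult_comm, <- Series_scal_l. apply CSeries_mod_le_dom.
  2: { now apply (ex_series_scal (K := R_AbsRing) (V := R_NormedModule)). }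
  intros k. unfold dcoef. fold (lam k).
  rewrite Cmult_plus_distr_l, Cexp_plus.
  replace (a k * (Cexp (lam k * y) * Cexp (lam k * h)) - a k * Cexp (lam k * y) - h * (lam k * a k * Cexp (lam k * y)))
    with (a k * Cexp (lam k * y) * (Cexp (lam k * h) - 1 - lam k * h)) by ring.
  rewrite Cmod_mult. unfold lam at 1. rewrite Cexp_freq, !Cmod_mult, Cmod_pow.
  assert (Hq : (Cmod (Cexp (lam k * h) - 1 - lam k * h) <= 2 * Cmod h ^ 2 * exp (3 * Cmod (lam k)))%R).
  { eapply Rle_trans; [apply Cmod_Cexp_sub2|]. rewrite Cmod_mult.
    assert (Pl := Cmod_ge_0 (lam k)). assert (Ph := Cmod_ge_0 h).
    assert (E1 : (exp (Cmod (lam k) * Cmod h) <= exp (Cmod (lam k)))%R) by (apply exp_le; nra).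
    assert (E2 := exp_ge_1_plus (Cmod (lam k))). set (e := exp (Cmod (lam k))) in *.
    replace (exp (3 * Cmod (lam k))) with (e * e * e)%R.
    2: { unfold e. rewrite <- !exp_plus. f_equal. ring. }
    replace (2 * (Cmod (lam k) * Cmod h) ^ 2)%R with (2 * Cmod h ^ 2 * (Cmod (lam k) * Cmod (lam k)))%R by ring.
    rewrite Rmult_assoc. apply Rmult_le_compat_l; [assert (X := pow2_ge_0 (Cmod h)); lra|].
    apply Rmult_le_compat; [nra | left; apply exp_pos | nra | exact E1]. }
  assert (Hf := exp_freq_bound s k 3 ltac:(lra)). fold (lam k) in Hf.
  set (p := Cmod (a k)). set (q := Cmod (Cexp (s * y))). set (r := Cmod (Cexp (2 * y))).
  assert (Pp : (0 <= p)%R) by apply Cmod_ge_0. assert (Pq : (0 <= q)%R) by apply Cmod_ge_0.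
  assert (Pr : (0 <= r ^ k)%R) by (apply pow_le, Cmod_ge_0).
  assert (Hp : (0 <= p * (q * r ^ k))%R) by (apply Rmult_le_pos; auto; now apply Rmult_le_pos).
  eapply Rle_trans; [apply Rmult_le_compat_l; [exact Hp | exact Hq]|].
  unfold B. fold p q r. rewrite Rpow_mult_distr.
  replace (Cmod h ^ 2 * (q * (2 * exp (3 * Cmod s)) * (p * (r ^ k * exp (2 * 3) ^ k))))%R with
    (p * (q * r ^ k) * (2 * Cmod h ^ 2 * (exp (3 * Cmod s) * exp (2 * 3) ^ k)))%R by ring.
  apply Rmult_le_compat_l; auto. apply Rmult_le_compat_l; auto.
  assert (X := pow2_ge_0 (Cmod h)). lra.
Qed.

Lemma Cexp_PI_Ci : Cexp (Ci * RtoC PI) = - (1).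
Proof. rewrite Cexp_Ci, cos_PI, sin_PI. apply C_eq; simpl; ring. Qed.

(** The shift replaces z by -z: the series in z^2 is unchanged and only the power (z/2)^s acquires a
    factor. *)
Lemma expser_shift s a y : entire a ->
  expser s a (y + Ci * RtoC PI) = Cexp (Ci * RtoC PI * s) * expser s a y.
Proof.
  intros Ha. rewrite !expser_pow by auto.
  replace (2 * (y + Ci * RtoC PI)) with (2 * y + (Ci * RtoC PI + Ci * RtoC PI)) by ring.
  rewrite (Cexp_plus (2 * y)), (Cexp_plus (Ci * _)), Cexp_PI_Ci.
  replace (- (1) * - (1)) with (RtoC 1) by ring. rewrite Cmult_1_r.
  replace (s * (y + Ci * RtoC PI)) with (Ci * RtoC PI * s + s * y) by ring.
  rewrite Cexp_plus. ring.
Qed.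

Lemma Clim_Cexp {T} (F : (T -> Prop) -> Prop) {FF : Filter F} (f : T -> C) l :
  Clim F f l -> Clim F (fun t => Cexp (f t)) (Cexp l).
Proof.
  intros H. apply (Clim_comp F (@locally C_UniformSpace l)).
  - apply (Cdiff_cont Cexp l _ (Cdiff_Cexp l)).
  - now apply Clim_filterlim.
Qed.

Lemma Clim_expser {T} (F : (T -> Prop) -> Prop) {FF : ProperFilter F}
  (s : T -> C) (a : T -> nat -> C) s0 a0 (M : nat -> C) y :
  Clim F s s0 -> (forall k, Clim F (fun t => a t k) (a0 k)) ->
  F (fun t => forall k, (Cmod (a t k) <= Cmod (M k))%R) -> entire M ->
  Clim F (fun t => expser (s t) (a t) y) (expser s0 a0 y).
Proof.
  intros Hs Ha Hb HM.
  apply (CSeries_tannery F _ _ (fun k => (exp ((Cmod s0 + 1) * Cmod y) * (Cmod (M k) * (exp (2 * Cmod y)) ^ k))%R)).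
  - apply (filter_imp (fun t => (forall k, (Cmod (a t k) <= Cmod (M k))%R) /\ (Cmod (s t) <= Cmod s0 + 1)%R)).
    2: { apply filter_and; [exact Hb | now apply Clim_bounded]. }
    intros t [H1 H2] k.
    rewrite Cmod_mult, Cexp_freq, Cmod_mult, Cmod_pow.
    assert (E1 : (Cmod (Cexp (s t * y)) <= exp ((Cmod s0 + 1) * Cmod y))%R).
    { eapply Rle_trans; [apply Cmod_Cexp_le|]. apply exp_le. rewrite Cmod_mult.
      apply Rmult_le_compat_r; auto. apply Cmod_ge_0. }
    assert (E2 : (Cmod (Cexp (2 * y)) ^ k <= exp (2 * Cmod y) ^ k)%R).
    { apply pow_incr. split; [apply Cmod_ge_0|]. eapply Rle_trans; [apply Cmod_Cexp_le|].
      rewrite Cmod_mult, Cmod_RtoC_pos; lra. }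
    replace (exp ((Cmod s0 + 1) * Cmod y) * (Cmod (M k) * exp (2 * Cmod y) ^ k))%R with
      (Cmod (M k) * (exp ((Cmod s0 + 1) * Cmod y) * exp (2 * Cmod y) ^ k))%R by ring.
    apply Rmult_le_compat; auto; try apply Cmod_ge_0.
    + apply Rmult_le_pos; [apply Cmod_ge_0 | apply pow_le, Cmod_ge_0].
    + apply Rmult_le_compat; auto; [apply Cmod_ge_0 | apply pow_le, Cmod_ge_0].
  - apply (ex_series_scal (K := R_AbsRing) (V := R_NormedModule)). apply HM. left; apply exp_pos.
  - intros k. apply Clim_mult; auto. apply (Clim_Cexp F (fun t => (s t + 2 * RtoC (INR k)) * y)).
    apply (Clim_mult (fun t => s t + 2 * RtoC (INR k)) (fun _ => y)); [|apply Clim_const].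
    apply (Clim_plus s (fun _ => 2 * RtoC (INR k))); auto. apply Clim_const.
Qed.

(** * The modified Bessel functions *)

(** The coefficients 1/(k! Gamma(mu + k + 1)); thus [BI mu y] is I_mu(2 e^y) and [BI'] its
    derivative in y. *)
Definition bes (mu : C) (k : nat) : C := rGam (mu + RtoC (INR k) + 1) / RtoC (INR (fact k)).
Definition BI (mu y : C) : C := expser mu (bes mu) y.
Definition BI' (mu y : C) : C := expser mu (dcoef mu (bes mu)) y.

Lemma INR_ge (x : R) : exists N : nat, (x <= INR N)%R.
Proof.
  destruct (nfloor_ex (Rabs x) (Rabs_pos x)) as [n Hn]. exists (S n). rewrite S_INR.
  assert (X := Rle_abs x). lra.
Qed.

(** For k <= N the arguments stay in a fixed disc. Beyond that |mu + k + 1| >= 1, and 1/Gamma(w) =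
    w/Gamma(w + 1) shows that the modulus no longer increases with k. *)
Lemma rGam_shift_bound (S : R) : (0 <= S)%R ->
  exists K, (0 <= K)%R /\ forall mu k, (Cmod mu <= S)%R -> (Cmod (rGam (mu + RtoC (INR k) + 1)) <= K)%R.
Proof.
  intros HS. destruct (INR_ge S) as [N HN].
  assert (HSN : (0 <= S + INR N + 1)%R) by (assert (X := pos_INR N); lra).
  exists (rgn_bound (S + INR N + 1)). split; [now apply rgn_bound_ge_0|].
  intros mu k Hmu. induction k as [|k IH].
  - apply rGam_bounded; auto. eapply Rle_trans; [apply Cmod_triangle|].
    eapply Rle_trans; [apply Rplus_le_compat_r, Cmod_triangle|].
    simpl INR. rewrite Cmod_0, Cmod_1. assert (X := pos_INR N). lra.
  - destruct (le_lt_dec (Datatypes.S k) N) as [L|L].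
    + apply rGam_bounded; auto. eapply Rle_trans; [apply Cmod_triangle|].
      eapply Rle_trans; [apply Rplus_le_compat_r, Cmod_triangle|].
      rewrite Cmod_RtoC_pos, Cmod_1 by apply pos_INR. assert (X := le_INR _ _ L). lra.
    + rewrite rGam_rec in IH. rewrite Cmod_mult in IH.
      replace (mu + RtoC (INR k) + 1 + 1) with (mu + RtoC (INR (Datatypes.S k)) + 1) in IH
        by (rewrite RtoC_INR_S; ring).
      apply Rle_trans with (2 := IH).
      assert (G : (1 <= Cmod (mu + RtoC (INR k) + 1))%R).
      { replace (mu + RtoC (INR k) + 1) with (RtoC (INR (Datatypes.S k)) - (- mu)) by (rewrite RtoC_INR_S; ring).
        eapply Rle_trans; [|apply Cmod_triangle_rev]. rewrite Cmod_opp, Cmod_RtoC_pos, S_INR by apply pos_INR.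
        assert (X : (INR N <= INR k)%R) by (apply le_INR; lia). lra. }
      assert (P := Cmod_ge_0 (rGam (mu + RtoC (INR (Datatypes.S k)) + 1))). nra.
Qed.

Lemma Cmod_inv_fact k : Cmod (/ RtoC (INR (fact k))) = (/ INR (fact k))%R.
Proof. rewrite Cmod_inv, Cmod_RtoC_pos; auto using pos_INR, INR_fact_neq_0_C. Qed.

Lemma entire_inv_fact : entire (fun k => / RtoC (INR (fact k))).
Proof.
  intros r _. assert (H := is_exp_Reals r).
  exists (exp r). apply (proj1 (is_pseries_R _ _ _)) in H. revert H. apply is_series_ext. intros k.
  now rewrite Cmod_inv_fact.
Qed.

Lemma bes_uniform (S : R) : (0 <= S)%R -> exists M, entire M /\
  forall mu k, (Cmod mu <= S)%R -> (Cmod (bes mu k) <= Cmod (M k))%R.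
Proof.
  intros HS. destruct (rGam_shift_bound S HS) as [K [K0 HK]].
  exists (fun k => RtoC K * / RtoC (INR (fact k))). split.
  - apply entire_scal, entire_inv_fact.
  - intros mu k Hmu. unfold bes, Cdiv. rewrite !Cmod_mult, (Cmod_RtoC_pos K) by auto.
    apply Rmult_le_compat_r; [apply Cmod_ge_0 | now apply HK].
Qed.

Lemma entire_bes mu : entire (bes mu).
Proof.
  destruct (bes_uniform (Cmod mu) (Cmod_ge_0 mu)) as [M [HM H]].
  apply entire_le with (C := 1%R) (B := 1%R) (4 := HM); try lra.
  intros k. rewrite pow1. specialize (H mu k (Rle_refl _)). lra.
Qed.

Lemma bes_rec mu k : RtoC (INR (S k)) * (mu + RtoC (INR (S k))) * bes mu (S k) = bes mu k.
Proof.
  unfold bes. rewrite RtoC_INR_fact_S, (rGam_rec (mu + RtoC (INR k) + 1)).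
  assert (N2 := INR_fact_neq_0_C k). assert (N3 : RtoC (INR (S k)) <> 0) by (apply RtoC_INR_neq_0; lia).
  replace (mu + RtoC (INR k) + 1 + 1) with (mu + RtoC (INR (S k)) + 1) by (rewrite RtoC_INR_S; ring).
  replace (mu + RtoC (INR k) + 1) with (mu + RtoC (INR (S k))) by (rewrite RtoC_INR_S; ring).
  field. auto.
Qed.

Lemma BI_diff mu y : Cdiff (BI mu) y (BI' mu y).
Proof. exact (expser_diff mu (bes mu) y (entire_bes mu)). Qed.

(** The modified Bessel equation in the variable y, with z^2 = 4 e^(2y). The term k = 0 drops out
    because its frequency is mu, and [bes_rec] shifts the others by one index. *)
Lemma BI'_diff mu y : Cdiff (BI' mu) y ((4 * Cexp (2 * y) + mu ^ 2) * BI mu y).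
Proof.
  assert (He := entire_bes mu).
  assert (He1 := entire_dcoef mu _ He). assert (He2 := entire_dcoef mu _ He1).
  eapply Cdiff_eq; [exact (expser_diff mu (dcoef mu (bes mu)) y He1)|].
  assert (E : expser mu (dcoef mu (dcoef mu (bes mu))) y - mu ^ 2 * BI mu y
    = 4 * Cexp (2 * y) * BI mu y).
  { unfold BI. rewrite <- (expser_scal mu (mu ^ 2)) by auto.
    rewrite <- (expser_minus mu _ (fun k => mu ^ 2 * bes mu k)) by (auto; now apply entire_scal).
    rewrite !expser_pow; auto.
    2: { apply entire_minus; [exact He2 | now apply entire_scal]. }
    rewrite CSeries_incr_1.
    2: { apply (entire_pow_summable (fun k => dcoef mu (dcoef mu (bes mu)) k - mu ^ 2 * bes mu k)).
         apply entire_minus; [exact He2 | now apply entire_scal]. }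
    unfold dcoef at 1 2. simpl INR.
    rewrite <- (CSeries_ext (fun k => 4 * Cexp (2 * y) * (bes mu k * Cexp (2 * y) ^ k))).
    - rewrite CSeries_scal by now apply entire_pow_summable. ring.
    - intros k. unfold dcoef. rewrite <- (bes_rec mu k). simpl Cpow. ring. }
  rewrite Cmult_plus_distr_r, <- E. ring.
Qed.

Definition wronsk (s t y : C) : C := BI s y * BI' t y - BI t y * BI' s y.

Lemma wronsk_diff s t y : Cdiff (wronsk s t) y ((t ^ 2 - s ^ 2) * (BI s y * BI t y)).
Proof.
  eapply Cdiff_eq.
  - apply Cdiff_minus.
    + apply (Cdiff_mult (BI s) (BI' t)); [apply BI_diff | apply BI'_diff].
    + apply (Cdiff_mult (BI t) (BI' s)); [apply BI_diff | apply BI'_diff].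
  - ring.
Qed.

(** * Products of Bessel functions *)

Lemma Csum_S_l a n : Csum a (S n) = a O + Csum (fun k => a (S k)) n.
Proof.
  induction n as [|n IH]; [simpl; ring|].
  change (Csum a (S (S n))) with (Csum a (S n) + a (S n)). rewrite IH. simpl. ring.
Qed.

Lemma Csum_plus a b n : Csum (fun k => a k + b k) n = Csum a n + Csum b n.
Proof. induction n as [|n IH]; simpl; [ring | rewrite IH; ring]. Qed.

(* The Leibniz rule for formal power series. *)
Lemma conv_derivation f g k :
  RtoC (INR (S k)) * conv f g (S k) =
  conv (fun n => RtoC (INR (S n)) * f (S n)) g k + conv f (fun n => RtoC (INR (S n)) * g (S n)) k.
Proof.
  transitivity (Csum (fun j => RtoC (INR j) * f j * g (S k - j)%nat) (S (S k))
    + Csum (fun j => f j * (RtoC (INR (S k - j)) * g (S k - j)%nat)) (S (S k))).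
  - rewrite <- Csum_plus. unfold conv. rewrite <- Csum_scal. apply Csum_ext. intros j Hj.
    rewrite minus_INR by lia. rewrite RtoC_minus. ring.
  - f_equal.
    + rewrite Csum_S_l. simpl INR. rewrite !Cmult_0_l, Cplus_0_l. apply Csum_ext. intros j Hj.
      reflexivity.
    + change (Csum ?a (S (S k))) with (Csum a (S k) + a (S k)). cbv beta.
      rewrite Nat.sub_diag. simpl (INR 0). unfold conv.
      rewrite Cmult_0_l, Cmult_0_r, Cplus_0_r. apply Csum_ext. intros j Hj.
      now rewrite Nat.sub_succ_l by lia.
Qed.

Fixpoint falling (a : C) (n : nat) : C :=
  match n with O => 1 | S m => falling a m * (a - RtoC (INR m)) end.

Definition fbin (a : C) (n : nat) : C := falling a n / RtoC (INR (fact n)).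

Lemma fbin_rec a n : RtoC (INR (S n)) * fbin a (S n) = (a - RtoC (INR n)) * fbin a n.
Proof.
  unfold fbin. rewrite RtoC_INR_fact_S. simpl falling.
  assert (N2 := INR_fact_neq_0_C n). assert (N3 : RtoC (INR (S n)) <> 0) by (apply RtoC_INR_neq_0; lia).
  field. auto.
Qed.

(** Coefficientwise form of (1 + x) F' = (a + b) F for F = (1 + x)^a (1 + x)^b: both sides satisfy
    the same first-order recurrence. *)
Lemma vandermonde a b k : conv (fbin a) (fbin b) k = fbin (a + b) k.
Proof.
  induction k as [|k IH].
  - unfold conv, fbin. simpl. field.
  - assert (N3 : RtoC (INR (S k)) <> 0) by (apply RtoC_INR_neq_0; lia).
    assert (E : RtoC (INR (S k)) * conv (fbin a) (fbin b) (S k) = RtoC (INR (S k)) * fbin (a + b) (S k)).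
    { rewrite conv_derivation, fbin_rec, <- IH. unfold conv. rewrite <- Csum_scal, <- Csum_plus.
      apply Csum_ext. intros j Hj. rewrite !fbin_rec, minus_INR, RtoC_minus by lia. ring. }
    transitivity (RtoC (INR (S k)) * conv (fbin a) (fbin b) (S k) / RtoC (INR (S k))).
    + field; auto.
    + rewrite E. field; auto.
Qed.

Lemma rising_falling a n : rising a n = falling (a + RtoC (INR n) - 1) n.
Proof.
  revert a. induction n as [|n IH]; intros a; [reflexivity|].
  rewrite rising_S_l, IH. change (falling ?b (S n)) with (falling b n * (b - RtoC (INR n))).
  rewrite RtoC_INR_S.
  replace (a + 1 + RtoC (INR n) - 1) with (a + (RtoC (INR n) + 1) - 1) by ring. ring.
Qed.

(** Coefficients of I_s I_t. The usual quotient Gamma(s + t + 2k + 1)/Gamma(s + t + k + 1) is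
    written as a rising factorial, a polynomial in s + t, so the coefficient is entire in s and
    t. *)
Definition bes2 (s t : C) (k : nat) : C :=
  rising (s + t + RtoC (INR k) + 1) k * rGam (s + RtoC (INR k) + 1) * rGam (t + RtoC (INR k) + 1)
  / RtoC (INR (fact k)).

Lemma bes_fbin s k j : (j <= k)%nat ->
  bes s j = rGam (s + RtoC (INR k) + 1) * (falling (s + RtoC (INR k)) (k - j) / RtoC (INR (fact j))).
Proof.
  intros Hj. unfold bes. rewrite (rGam_rising _ (k - j)), rising_falling.
  replace (s + RtoC (INR j) + 1 + RtoC (INR (k - j))) with (s + RtoC (INR k) + 1)
    by (rewrite minus_INR, RtoC_minus by lia; ring).
  replace (s + RtoC (INR k) + 1 - 1) with (s + RtoC (INR k)) by ring.
  assert (N2 := INR_fact_neq_0_C j). field. auto.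
Qed.

(** Factoring out 1/(Gamma(s + k + 1) Gamma(t + k + 1)) leaves falling factorials of s + k and t +
    k. After the two factorials j! and (k - j)! are exchanged, the sum is Vandermonde's for these
    upper parameters, with s and t in reversed order. *)
Lemma conv_bes s t k : conv (bes s) (bes t) k = bes2 s t k.
Proof.
  assert (V := vandermonde (t + RtoC (INR k)) (s + RtoC (INR k)) k). unfold fbin at 3 in V.
  unfold bes2. rewrite rising_falling.
  replace (s + t + RtoC (INR k) + 1 + RtoC (INR k) - 1) with (t + RtoC (INR k) + (s + RtoC (INR k))) by ring.
  replace (falling (t + RtoC (INR k) + (s + RtoC (INR k))) k * rGam (s + RtoC (INR k) + 1) *
     rGam (t + RtoC (INR k) + 1) / RtoC (INR (fact k))) with
    (rGam (s + RtoC (INR k) + 1) * rGam (t + RtoC (INR k) + 1) *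
     (falling (t + RtoC (INR k) + (s + RtoC (INR k))) k / RtoC (INR (fact k))))
    by (unfold Cdiv; ring).
  rewrite <- V. unfold conv. rewrite <- Csum_scal. apply Csum_ext. intros j Hj.
  rewrite (bes_fbin s k j), (bes_fbin t k (k - j)) by lia.
  replace (k - (k - j))%nat with j by lia. unfold fbin.
  assert (N2 := INR_fact_neq_0_C j). assert (N3 := INR_fact_neq_0_C (k - j)). field. auto.
Qed.

Lemma bes2_comm s t k : bes2 s t k = bes2 t s k.
Proof.
  unfold bes2. rewrite (Cplus_comm s t).
  assert (N2 := INR_fact_neq_0_C k). field. auto.
Qed.

Lemma bes2_0 s t : bes2 s t 0 = rGam (s + 1) * rGam (t + 1).
Proof. unfold bes2. simpl. rewrite !Cplus_0_r. field. Qed.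

Lemma entire_bes2 s t : entire (bes2 s t).
Proof.
  assert (H := entire_conv _ _ (entire_bes s) (entire_bes t)).
  intros r Hr. specialize (H r Hr). revert H. apply ex_series_ext. intros k. now rewrite conv_bes.
Qed.

Lemma BI_mult s t y : BI s y * BI t y = expser (s + t) (bes2 s t) y.
Proof.
  unfold BI. rewrite expser_mult by apply entire_bes. apply expser_ext, conv_bes.
Qed.

Lemma conv_dominated (a b : nat -> C) (a' b' : nat -> C) k :
  (forall j, (Cmod (a j) <= Cmod (a' j))%R) -> (forall j, (Cmod (b j) <= Cmod (b' j))%R) ->
  (Cmod (conv a b k) <=
   Cmod (conv (fun j => RtoC (Cmod (a' j))) (fun j => RtoC (Cmod (b' j))) k))%R.
Proof.
  intros Ha Hb.
  assert (E : conv (fun j => RtoC (Cmod (a' j))) (fun j => RtoC (Cmod (b' j))) k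
    = RtoC (sum_f_R0 (fun j => Cmod (a' j) * Cmod (b' (k - j)%nat))%R k)).
  { apply C_eq; unfold conv; rewrite ?Re_Csum, ?Im_Csum; simpl.
    - apply sum_eq. intros i _. ring.
    - transitivity (sum_f_R0 (fun _ => 0%R) k); [apply sum_eq; intros i _; ring|].
      induction k as [|k IH]; simpl; [reflexivity | rewrite IH; ring]. }
  rewrite E, Cmod_R. eapply Rle_trans; [|apply Rle_abs].
  unfold conv. eapply Rle_trans; [apply Csum_mod_le|]. apply sum_Rle. intros j Hj.
  rewrite Cmod_mult. apply Rmult_le_compat; auto; apply Cmod_ge_0.
Qed.

Lemma entire_Cmod a : entire a -> entire (fun k => RtoC (Cmod (a k))).
Proof.
  apply entire_le with (C := 1%R) (B := 1%R); try lra. intros k.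
  rewrite pow1, Cmod_RtoC_pos by apply Cmod_ge_0. lra.
Qed.

Lemma bes2_uniform (S : R) : (0 <= S)%R -> exists M, entire M /\
  forall s t k, (Cmod s <= S)%R -> (Cmod t <= S)%R -> (Cmod (bes2 s t k) <= Cmod (M k))%R.
Proof.
  intros HS. destruct (bes_uniform S HS) as [M [HM H]].
  exists (conv (fun j => RtoC (Cmod (M j))) (fun j => RtoC (Cmod (M j)))). split.
  - apply entire_conv; now apply entire_Cmod.
  - intros s t k Hs Ht. rewrite <- conv_bes. apply conv_dominated; intros j; now apply H.
Qed.

Lemma Clim_locally {T} (F : (T -> Prop) -> Prop) (f : C -> C) (g : T -> C) z l :
  Filter F -> Cdiff f z l -> Clim F g z -> Clim F (fun t => f (g t)) (f z).
Proof.
  intros FF Hf Hg. apply (Clim_comp F (@locally C_UniformSpace z)).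
  - apply (Cdiff_cont f z l Hf).
  - now apply Clim_filterlim.
Qed.

Lemma Clim_bes2 {T} (F : (T -> Prop) -> Prop) {FF : Filter F} (f g : T -> C) s t k :
  Clim F f s -> Clim F g t -> Clim F (fun x => bes2 (f x) (g x) k) (bes2 s t k).
Proof.
  intros Hf Hg.
  assert (B : forall h z j, Clim F h z -> Clim F (fun x => bes (h x) j) (bes z j)).
  { intros h z j H. apply Clim_div; [|apply Clim_const | apply INR_fact_neq_0_C].
    apply (Clim_locally F rGam (fun x => h x + RtoC (INR j) + 1) _ _ FF (rGam_diff _)).
    apply (Clim_plus (fun x => h x + RtoC (INR j)) (fun _ => 1)); [|apply Clim_const].
    apply (Clim_plus h (fun _ => RtoC (INR j))); [auto | apply Clim_const]. }
  rewrite <- conv_bes. apply Clim_ext with (fun x => conv (bes (f x)) (bes (g x)) k).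
  { intros x. apply conv_bes. }
  unfold conv. apply (Clim_Csum F (fun x j => bes (f x) j * bes (g x) (k - j)%nat)).
  intros j. apply Clim_mult; now apply B.
Qed.

(** Beyond the index N the frequencies have modulus at least 1; only finitely many remain. *)
Lemma freq_lower_bound s : (forall k, s + 2 * RtoC (INR k) <> 0) ->
  exists d, (0 < d)%R /\ forall k, (d <= Cmod (s + 2 * RtoC (INR k)))%R.
Proof.
  intros H. destruct (INR_ge (Cmod s + 1)) as [N HN].
  assert (X : forall n, exists d, (0 < d)%R /\ forall k, (k < n)%nat -> (d <= Cmod (s + 2 * RtoC (INR k)))%R).
  { induction n as [|n [d [D IH]]]; [exists 1%R; split; [lra | intros; lia]|].
    exists (Rmin d (Cmod (s + 2 * RtoC (INR n)))). split.
    - apply Rmin_pos; auto. apply Cmod_gt_0, H.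
    - intros k Hk. destruct (Nat.eq_dec k n) as [->|E]; [apply Rmin_r|].
      eapply Rle_trans; [apply Rmin_l | apply IH; lia]. }
  destruct (X N) as [d [D Hd]]. exists (Rmin d 1). split; [apply Rmin_pos; lra|].
  intros k. destruct (le_lt_dec N k) as [L|L].
  - eapply Rle_trans; [apply Rmin_r|].
    replace (s + 2 * RtoC (INR k)) with (2 * RtoC (INR k) - - s) by ring.
    eapply Rle_trans; [|apply Cmod_triangle_rev].
    rewrite Cmod_opp, Cmod_mult, !Cmod_RtoC_pos; try lra; try apply pos_INR.
    assert (Y := le_INR _ _ L). assert (Z := Cmod_ge_0 s). lra.
  - eapply Rle_trans; [apply Rmin_l | now apply Hd].
Qed.

(* The termwise primitive of [expser s c]. *)
Definition icoef (s : C) (c : nat -> C) (k : nat) : C := c k / (s + 2 * RtoC (INR k)).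

Lemma icoef_bound s c d k : (0 < d)%R -> (d <= Cmod (s + 2 * RtoC (INR k)))%R ->
  (Cmod (icoef s c k) <= / d * Cmod (c k))%R.
Proof.
  intros D H. unfold icoef. rewrite Cmod_div by (apply Cmod_gt_0; lra).
  unfold Rdiv. rewrite Rmult_comm. apply Rmult_le_compat_r; [apply Cmod_ge_0|].
  apply Rinv_le_contravar; auto.
Qed.

Lemma entire_icoef s c : (forall k, s + 2 * RtoC (INR k) <> 0) -> entire c -> entire (icoef s c).
Proof.
  intros H. destruct (freq_lower_bound s H) as [d [D Hd]].
  apply entire_le with (C := (/ d)%R) (B := 1%R); try lra.
  - left. now apply Rinv_0_lt_compat.
  - intros k. rewrite pow1, Rmult_1_r. apply icoef_bound; auto.
Qed.

Lemma expser_icoef_diff s c y : (forall k, s + 2 * RtoC (INR k) <> 0) -> entire c ->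
  Cdiff (expser s (icoef s c)) y (expser s c y).
Proof.
  intros H Hc. eapply Cdiff_eq; [apply expser_diff; now apply entire_icoef|].
  apply expser_ext. intros k. unfold dcoef, icoef. field. apply H.
Qed.

(** If all |s0 + 2k| are at least d, then |s + 2k| >= d/2 for s near s0, uniformly in k; the divided
    coefficients therefore keep a common majorant. *)
Lemma Clim_expser_icoef {T} (F : (T -> Prop) -> Prop) {FF : ProperFilter F}
  (s : T -> C) (c : T -> nat -> C) s0 c0 (M : nat -> C) y :
  (forall k, s0 + 2 * RtoC (INR k) <> 0) ->
  Clim F s s0 -> (forall k, Clim F (fun t => c t k) (c0 k)) ->
  F (fun t => forall k, (Cmod (c t k) <= Cmod (M k))%R) -> entire M ->
  Clim F (fun t => expser (s t) (icoef (s t) (c t)) y) (expser s0 (icoef s0 c0) y).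
Proof.
  intros H Hs Hc Hb HM. destruct (freq_lower_bound s0 H) as [d [D Hd]].
  assert (D2 : (0 < d / 2)%R) by lra.
  apply (Clim_expser F s (fun t => icoef (s t) (c t)) s0 (icoef s0 c0) (fun k => RtoC (/ (d / 2)) * M k)); auto.
  - intros k. apply Clim_div; auto. apply (Clim_plus s (fun _ => 2 * RtoC (INR k))); auto. apply Clim_const.
  - generalize (filter_and _ _ Hb (Hs _ D2)). apply filter_imp. intros t [A B] k.
    rewrite Cmod_mult, Cmod_RtoC_pos by (left; now apply Rinv_0_lt_compat).
    eapply Rle_trans.
    + apply (icoef_bound (s t) (c t) (d / 2)); auto.
      specialize (Hd k). assert (X := Cmod_triangle_rev (s0 + 2 * RtoC (INR k)) (s0 - s t)).
      replace (s0 + 2 * RtoC (INR k) - (s0 - s t)) with (s t + 2 * RtoC (INR k)) in X by ring.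
      rewrite (Cmod_sub_comm s0) in X. lra.
    + apply Rmult_le_compat_l; [left; now apply Rinv_0_lt_compat | apply A].
  - now apply entire_scal.
Qed.

Lemma expser_head s a y : entire a ->
  expser s a y = a O * Cexp (s * y) + expser (s + 2) (fun k => a (S k)) y.
Proof.
  intros Ha. unfold expser. rewrite CSeries_incr_1 by now apply expser_summable.
  f_equal.
  - simpl INR. do 2 f_equal. ring.
  - apply CSeries_ext. intros k. rewrite RtoC_INR_S. do 2 f_equal. ring.
Qed.

Lemma entire_shift a : entire a -> entire (fun k => a (S k)).
Proof.
  intros Ha r Hr.
  destruct (Req_dec r 0) as [->|N].
  - apply ex_series_pos_le with (fun k => Cmod (a (S k)) * 1 ^ k)%R.
    + intros k. assert (P := Cmod_ge_0 (a (S k))). rewrite pow1.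
      assert (0 <= 0 ^ k <= 1)%R by (destruct k; simpl; lra). nra.
    + assert (H := Ha 1%R Rle_0_1). rewrite ex_series_incr_1 in H. revert H.
      apply ex_series_ext. intros k. now rewrite !pow1.
  - assert (H := Ha r Hr). rewrite ex_series_incr_1 in H.
    apply (ex_series_scal (K := R_AbsRing) (V := R_NormedModule) (/ r)%R) in H. revert H.
    apply ex_series_ext. intros k. unfold scal; simpl. unfold mult; simpl. field. auto.
Qed.

(** * Primitives of products *)

Definition BIprim (s t y : C) : C := expser (s + t) (icoef (s + t) (bes2 s t)) y.

(** Equivalent to s not being an even integer. In the form of a multiplier it is what makes a
    constant of integration vanish, and it is visibly an open condition. *)
Definition nonperiodic (s : C) : Prop := Cexp (Ci * RtoC PI * s) <> 1.

Lemma Cexp_2PI_Ci_INR k : Cexp (Ci * RtoC PI * (2 * RtoC (INR k))) = 1.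
Proof.
  replace (Ci * RtoC PI * (2 * RtoC (INR k))) with (RtoC (INR k) * (Ci * RtoC PI + Ci * RtoC PI)) by ring.
  rewrite Cexp_INR_mult, Cexp_plus, Cexp_PI_Ci. replace (- (1) * - (1)) with (RtoC 1) by ring.
  apply Cpow_1_l.
Qed.

Lemma nonperiodic_freq s : nonperiodic s -> forall k, s + 2 * RtoC (INR k) <> 0.
Proof.
  intros H k E. apply H.
  replace s with (- (2 * RtoC (INR k))) by (replace s with (s + 2 * RtoC (INR k) - 2 * RtoC (INR k)) by ring; rewrite E; ring).
  replace (Ci * RtoC PI * - (2 * RtoC (INR k))) with (- (Ci * RtoC PI * (2 * RtoC (INR k)))) by ring.
  rewrite Cexp_opp, Cexp_2PI_Ci_INR. field.
Qed.

Lemma BIprim_diff s t y : (forall k, s + t + 2 * RtoC (INR k) <> 0) -> Cdiff (BIprim s t) y (BI s y * BI t y).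
Proof.
  intros H. rewrite BI_mult. unfold BIprim. apply expser_icoef_diff; auto. apply entire_bes2.
Qed.

(* The two sides have the same derivative, and the constant vanishes because a
   shift of [y] by [i PI] multiplies both sides by [exp (i PI (s + t))]. *)
Lemma BIprim_wronsk s t y : nonperiodic (s + t) -> (t ^ 2 - s ^ 2) * BIprim s t y = wronsk s t y.
Proof.
  intros Hn. assert (Hf := nonperiodic_freq _ Hn).
  set (D := fun w => (t ^ 2 - s ^ 2) * BIprim s t w - wronsk s t w).
  assert (DC : forall z w, D z = D w).
  { apply Cdiff_zero_const. intros z. eapply Cdiff_eq.
    - apply Cdiff_minus; [apply Cdiff_scal, BIprim_diff, Hf | apply wronsk_diff].
    - ring. }
  assert (Sh : D (y + Ci * RtoC PI) = Cexp (Ci * RtoC PI * (s + t)) * D y).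
  { assert (E1 := entire_icoef _ _ Hf (entire_bes2 s t)).
    assert (E2 := entire_bes s). assert (E3 := entire_bes t).
    assert (E4 := entire_dcoef s _ E2). assert (E5 := entire_dcoef t _ E3).
    unfold D, BIprim, wronsk, BI, BI'.
    rewrite (expser_shift _ _ _ E1), (expser_shift _ _ _ E2), (expser_shift _ _ _ E3),
      (expser_shift _ _ _ E4), (expser_shift _ _ _ E5).
    rewrite Cmult_plus_distr_l, Cexp_plus. ring. }
  rewrite (DC _ y) in Sh. apply Ceq_minus. fold (D y).
  apply NNPP. intros N. apply Hn.
  apply Ceq_minus. transitivity ((Cexp (Ci * RtoC PI * (s + t)) * D y - D y) / D y); [field; auto|].
  rewrite <- Sh. field. auto.
Qed.

(* At [z = 2 e^y] this is [(2 / pi) sin (pi mu) K_mu(z)]. *)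
Definition LK (mu y : C) : C := BI (- mu) y - BI mu y.
Definition LK' (mu y : C) : C := BI' (- mu) y - BI' mu y.

Lemma LK_diff mu y : Cdiff (LK mu) y (LK' mu y).
Proof. apply Cdiff_minus; apply BI_diff. Qed.

Lemma LK'_diff mu y : Cdiff (LK' mu) y ((4 * Cexp (2 * y) + mu ^ 2) * LK mu y).
Proof.
  eapply Cdiff_eq; [apply Cdiff_minus; apply BI'_diff|]. unfold LK. ring.
Qed.

Definition LKprim2 (mu nu y : C) : C :=
  BIprim (- mu) (- nu) y + BIprim mu nu y - BIprim mu (- nu) y - BIprim (- mu) nu y.

Lemma nonperiodic_opp s : nonperiodic s -> nonperiodic (- s).
Proof.
  intros H E. apply H. replace (Ci * RtoC PI * s) with (- (Ci * RtoC PI * - s)) by ring.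
  rewrite Cexp_opp, E. field.
Qed.

Lemma LKprim2_diff mu nu y : nonperiodic (mu + nu) -> nonperiodic (mu - nu) ->
  Cdiff (LKprim2 mu nu) y (LK mu y * LK nu y).
Proof.
  intros H1 H2. assert (H1' := nonperiodic_opp _ H1). assert (H2' := nonperiodic_opp _ H2).
  replace (- (mu + nu)) with (- mu + - nu) in H1' by ring.
  replace (- (mu - nu)) with (- mu + nu) in H2' by ring.
  eapply Cdiff_eq.
  - repeat apply Cdiff_minus; [apply Cdiff_plus| |]; apply BIprim_diff, nonperiodic_freq; auto.
  - unfold LK. ring.
Qed.

(** Changing the signs of mu and nu does not affect nu^2 - mu^2, so the four Wronskians share one
    factor and add up bilinearly. *)
Lemma LKprim2_wronsk mu nu y : nonperiodic (mu + nu) -> nonperiodic (mu - nu) ->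
  (nu ^ 2 - mu ^ 2) * LKprim2 mu nu y = LK mu y * LK' nu y - LK nu y * LK' mu y.
Proof.
  intros H1 H2. assert (H1' := nonperiodic_opp _ H1). assert (H2' := nonperiodic_opp _ H2).
  replace (- (mu + nu)) with (- mu + - nu) in H1' by ring.
  replace (- (mu - nu)) with (- mu + nu) in H2' by ring.
  assert (E1 := BIprim_wronsk (- mu) (- nu) y H1'). assert (E2 := BIprim_wronsk mu nu y H1).
  assert (E3 := BIprim_wronsk mu (- nu) y H2). assert (E4 := BIprim_wronsk (- mu) nu y H2').
  replace ((- nu) ^ 2 - (- mu) ^ 2) with (nu ^ 2 - mu ^ 2) in E1 by ring.
  replace ((- nu) ^ 2 - mu ^ 2) with (nu ^ 2 - mu ^ 2) in E3 by ring.
  replace (nu ^ 2 - (- mu) ^ 2) with (nu ^ 2 - mu ^ 2) in E4 by ring.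
  unfold LKprim2.
  transitivity (wronsk (- mu) (- nu) y + wronsk mu nu y - wronsk mu (- nu) y - wronsk (- mu) nu y).
  - rewrite <- E1, <- E2, <- E3, <- E4. ring.
  - unfold wronsk, LK, LK'. ring.
Qed.

(** * The confluent case *)

(* The limit of [BIprim mu (- nu) + BIprim (- mu) nu] as [mu] tends to [nu]. *)
Definition BIcross (nu y : C) : C :=
  rGam' (1 + nu) * rGam (1 - nu) + rGam' (1 - nu) * rGam (1 + nu)
  + 2 * y * (rGam (1 + nu) * rGam (1 - nu))
  + 2 * expser 2 (icoef 2 (fun k => bes2 nu (- nu) (S k))) y.

Lemma freq2_neq_0 k : 2 + 2 * RtoC (INR k) <> 0.
Proof.
  replace (2 + 2 * RtoC (INR k)) with (2 * RtoC (INR (S k))) by (rewrite RtoC_INR_S; ring).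
  apply Cmult_neq_0; [apply C2_neq_0 | apply RtoC_INR_neq_0; lia].
Qed.

Lemma BIcross_diff nu y : Cdiff (BIcross nu) y (2 * (BI nu y * BI (- nu) y)).
Proof.
  assert (He := entire_bes2 nu (- nu)).
  eapply Cdiff_eq.
  - apply Cdiff_plus; [apply Cdiff_plus; [apply Cdiff_const|]|].
    + apply Cdiff_ext with (fun y => 2 * (rGam (1 + nu) * rGam (1 - nu)) * y + 0); [intros; ring|].
      apply Cdiff_affine.
    + apply Cdiff_scal. apply expser_icoef_diff; [apply freq2_neq_0 | now apply entire_shift].
  - rewrite BI_mult, (expser_head (nu + - nu)), bes2_0 by auto.
    replace (nu + - nu) with (RtoC 0) by ring. rewrite Cmult_0_l, Cexp_0, Cplus_0_l, Cplus_0_l.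
    rewrite (Cplus_comm nu 1). replace (- nu + 1) with (1 - nu) by ring. ring.
Qed.

Definition LKprim (nu y : C) : C :=
  BIprim (- nu) (- nu) y + BIprim nu nu y - BIcross nu y.

Lemma LKprim_diff nu y : nonperiodic (2 * nu) -> Cdiff (LKprim nu) y (LK nu y ^ 2).
Proof.
  intros H1. assert (H1' := nonperiodic_opp _ H1).
  replace (- (2 * nu)) with (- nu + - nu) in H1' by ring.
  replace (2 * nu) with (nu + nu) in H1 by ring.
  eapply Cdiff_eq.
  - apply Cdiff_minus; [apply Cdiff_plus | apply BIcross_diff]; apply BIprim_diff, nonperiodic_freq; auto.
  - unfold LK. ring.
Qed.

Lemma Clim_BIprim {T} (F : (T -> Prop) -> Prop) {FF : ProperFilter F} (f g : T -> C) s t y :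
  (forall k, s + t + 2 * RtoC (INR k) <> 0) -> Clim F f s -> Clim F g t ->
  Clim F (fun x => BIprim (f x) (g x) y) (BIprim s t y).
Proof.
  intros H Hf Hg.
  destruct (bes2_uniform (Cmod s + 1 + (Cmod t + 1))) as [M [HM HB]].
  { assert (X := Cmod_ge_0 s). assert (Y := Cmod_ge_0 t). lra. }
  apply (Clim_expser_icoef F (fun x => f x + g x) (fun x => bes2 (f x) (g x)) (s + t) (bes2 s t) M); auto.
  - now apply Clim_plus.
  - intros k. exact (Clim_bes2 F f g s t k Hf Hg).
  - generalize (filter_and _ _ (Clim_bounded _ _ Hf) (Clim_bounded _ _ Hg)).
    apply filter_imp. intros x [A B] k. assert (X := Cmod_ge_0 s). assert (Y := Cmod_ge_0 t).
    apply HB; lra.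
Qed.

Lemma Clim_id_locally' z : Clim (@locally' C_UniformSpace z) (fun w => w) z.
Proof. intros eps He. apply locally'_Cmod. exists eps. auto. Qed.

(* The terms of [BIprim s t] of positive index, which stay regular at [s + t = 0]. *)
Definition BItail (s t y : C) : C :=
  expser (s + t + 2) (icoef (s + t + 2) (fun k => bes2 s t (S k))) y.

Lemma BIprim_head s t y : nonperiodic (s + t) ->
  BIprim s t y = rGam (s + 1) * rGam (t + 1) * Cexp ((s + t) * y) / (s + t) + BItail s t y.
Proof.
  intros H. assert (Hf := nonperiodic_freq _ H). unfold BIprim.
  rewrite expser_head by (apply entire_icoef; [auto | apply entire_bes2]). f_equal.
  - unfold icoef. rewrite bes2_0. simpl INR. rewrite Cmult_0_r, Cplus_0_r.
    specialize (Hf O). simpl INR in Hf. rewrite Cmult_0_r, Cplus_0_r in Hf. field. auto.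
  - apply expser_ext. intros k. unfold icoef. f_equal. rewrite RtoC_INR_S. ring.
Qed.

Lemma Clim_BItail {T} (F : (T -> Prop) -> Prop) {FF : ProperFilter F} (f g : T -> C) s t y :
  s + t = 0 -> Clim F f s -> Clim F g t ->
  Clim F (fun x => BItail (f x) (g x) y) (expser 2 (icoef 2 (fun k => bes2 s t (S k))) y).
Proof.
  intros H Hf Hg.
  destruct (bes2_uniform (Cmod s + 1 + (Cmod t + 1))) as [M [HM HB]].
  { assert (X := Cmod_ge_0 s). assert (Y := Cmod_ge_0 t). lra. }
  apply (Clim_expser_icoef F (fun x => f x + g x + 2) (fun x k => bes2 (f x) (g x) (S k)) 2
    (fun k => bes2 s t (S k)) (fun k => M (S k))).
  - apply freq2_neq_0.
  - apply Clim_eq with (s + t + 2); [|rewrite H; ring].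
    apply (Clim_plus (fun x => f x + g x) (fun _ => RtoC 2)); [now apply Clim_plus | apply Clim_const].
  - intros k. exact (Clim_bes2 F f g s t (S k) Hf Hg).
  - generalize (filter_and _ _ (Clim_bounded _ _ Hf) (Clim_bounded _ _ Hg)).
    apply filter_imp. intros x [A B] k. assert (X := Cmod_ge_0 s). assert (Y := Cmod_ge_0 t).
    apply HB; lra.
  - now apply entire_shift.
Qed.

Lemma BIcross_head_diff nu y :
  Cdiff (fun mu => rGam (mu + 1) * rGam (- nu + 1) * Cexp ((mu + - nu) * y)
     - rGam (- mu + 1) * rGam (nu + 1) * Cexp ((- mu + nu) * y)) nu
  (rGam' (1 + nu) * rGam (1 - nu) + rGam' (1 - nu) * rGam (1 + nu)
   + 2 * y * (rGam (1 + nu) * rGam (1 - nu))).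
Proof.
  apply Cdiff_ext with (fun mu => rGam (- nu + 1) * (rGam (1 * mu + 1) * Cexp (y * mu + - nu * y))
     - rGam (nu + 1) * (rGam (- (1) * mu + 1) * Cexp (- y * mu + nu * y))).
  { intros mu. replace (1 * mu + 1) with (mu + 1) by ring. replace (- (1) * mu + 1) with (- mu + 1) by ring.
    replace (y * mu + - nu * y) with ((mu + - nu) * y) by ring.
    replace (- y * mu + nu * y) with ((- mu + nu) * y) by ring. ring. }
  eapply Cdiff_eq.
  - apply Cdiff_minus; apply Cdiff_scal.
    + apply (Cdiff_mult (fun mu => rGam (1 * mu + 1)) (fun mu => Cexp (y * mu + - nu * y))).
      * apply (Cdiff_comp rGam (fun mu => 1 * mu + 1)); [apply Cdiff_affine | apply rGam_diff].
      * apply (Cdiff_comp Cexp (fun mu => y * mu + - nu * y)); [apply Cdiff_affine | apply Cdiff_Cexp].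
    + apply (Cdiff_mult (fun mu => rGam (- (1) * mu + 1)) (fun mu => Cexp (- y * mu + nu * y))).
      * apply (Cdiff_comp rGam (fun mu => - (1) * mu + 1)); [apply Cdiff_affine | apply rGam_diff].
      * apply (Cdiff_comp Cexp (fun mu => - y * mu + nu * y)); [apply Cdiff_affine | apply Cdiff_Cexp].
  - replace (y * nu + - nu * y) with (RtoC 0) by ring. replace (- y * nu + nu * y) with (RtoC 0) by ring.
    rewrite Cexp_0. replace (1 * nu + 1) with (1 + nu) by ring.
    replace (- (1) * nu + 1) with (1 - nu) by ring. replace (nu + 1) with (1 + nu) by ring.
    replace (- nu + 1) with (1 - nu) by ring. ring.
Qed.

Lemma nonperiodic_near (s : C) : nonperiodic s ->
  forall (f : C -> C) z, f z = s -> (exists l, Cdiff f z l) -> @locally' C_UniformSpace z (fun w => nonperiodic (f w)).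
Proof.
  intros H f z E [l Hl].
  assert (K : Clim (@locally' C_UniformSpace z) (fun w => Cexp (Ci * RtoC PI * f w) - 1) (Cexp (Ci * RtoC PI * s) - 1)).
  { apply Clim_minus; [|apply Clim_const].
    apply (Clim_Cexp _ (fun w => Ci * RtoC PI * f w)). apply Clim_mult; [apply Clim_const|].
    rewrite <- E. apply (Clim_locally _ f (fun w => w) z l _ Hl). apply Clim_id_locally'. }
  assert (N : Cexp (Ci * RtoC PI * s) - 1 <> 0) by now apply Cminus_eq_contra.
  generalize (Clim_nonzero _ _ K N). apply filter_imp. intros w Hw E1.
  rewrite E1 in Hw. replace (1 - 1) with (RtoC 0) in Hw by ring. rewrite Cmod_0 in Hw.
  apply Cmod_gt_0 in N. lra.
Qed.

(** The exponential has derivative 1 at 0, hence takes the value 1 only once near 0. *)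
Lemma nonperiodic_small : exists d, (0 < d)%R /\ forall h : C, h <> 0 -> (Cmod h < d)%R -> nonperiodic h.
Proof.
  destruct (Cdiff_Cexp 0 (1 / 2)%R) as [d [D B]]; [lra|].
  assert (HP := PI_RGT_0).
  exists (d / PI)%R. split; [now apply Rdiv_lt_0_compat|]. intros h Nh Hh E.
  assert (Hm : Cmod (Ci * RtoC PI * h) = (PI * Cmod h)%R).
  { rewrite !Cmod_mult, Cmod_Ci, Cmod_RtoC_pos by lra. ring. }
  specialize (B (Ci * RtoC PI * h)). rewrite Hm in B.
  rewrite Cplus_0_l, E, Cexp_0 in B. replace (1 - 1 - 1 * (Ci * RtoC PI * h)) with (- (Ci * RtoC PI * h)) in B by ring.
  rewrite Cmod_opp, Hm in B. apply Cmod_gt_0 in Nh.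
  assert (PI * Cmod h < d)%R.
  { apply Rmult_lt_compat_l with (r := PI) in Hh; auto. replace (PI * (d / PI))%R with d in Hh by (field; lra). exact Hh. }
  specialize (B H). assert (0 < PI * Cmod h)%R by now apply Rmult_lt_0_compat. lra.
Qed.

Lemma nonperiodic_diff_near nu : @locally' C_UniformSpace nu (fun mu => nonperiodic (mu - nu)).
Proof.
  destruct nonperiodic_small as [d [D H]]. apply locally'_Cmod. exists d. split; auto.
  intros w Nw Hw. apply H; auto. now apply Cminus_eq_contra.
Qed.

(** The heads of the two cross terms have poles of opposite sign at mu = nu. Together they form the
    difference quotient of a function vanishing at nu, whose derivative contributes 2 y and the
    derivatives of 1/Gamma. *)
Lemma LKprim_lim nu y : nonperiodic (2 * nu) ->
  Clim (@locally' C_UniformSpace nu) (fun mu => LKprim2 mu nu y) (LKprim nu y).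
Proof.
  intros H1. assert (H1' := nonperiodic_opp _ H1).
  replace (- (2 * nu)) with (- nu + - nu) in H1' by ring.
  replace (2 * nu) with (nu + nu) in H1 by ring.
  assert (Id := Clim_id_locally' nu).
  set (h := fun mu => rGam (mu + 1) * rGam (- nu + 1) * Cexp ((mu + - nu) * y)
     - rGam (- mu + 1) * rGam (nu + 1) * Cexp ((- mu + nu) * y)).
  assert (h0 : h nu = 0).
  { unfold h. replace ((nu + - nu) * y) with (RtoC 0) by ring. replace ((- nu + nu) * y) with (RtoC 0) by ring. ring. }
  apply Clim_ext_loc with (fun mu => BIprim (- mu) (- nu) y + BIprim mu nu y
     - ((h mu - h nu) / (mu - nu) + (BItail mu (- nu) y + BItail (- mu) nu y))).
  - generalize (filter_and _ _ (nonperiodic_diff_near nu)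
      (filter_and _ _ (nonperiodic_diff_near nu) (nonperiodic_diff_near nu))).
    apply filter_imp. intros mu [N _]. assert (N' := nonperiodic_opp _ N).
    assert (N0 := nonperiodic_freq _ N O). simpl INR in N0. rewrite Cmult_0_r, Cplus_0_r in N0.
    unfold LKprim2. rewrite (BIprim_head mu (- nu)), (BIprim_head (- mu) nu); auto.
    2: { replace (- mu + nu) with (- (mu - nu)) by ring. exact N'. }
    rewrite h0. unfold h.
    replace (- mu + nu) with (- (mu - nu)) by ring. replace (mu + - nu) with (mu - nu) by ring.
    field. auto.
  - unfold LKprim. apply Clim_minus; [apply Clim_plus|].
    + apply (Clim_BIprim (@locally' C_UniformSpace nu) (fun mu => - mu) (fun _ => - nu));
        [now apply nonperiodic_freq | now apply Clim_opp | apply Clim_const].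
    + apply (Clim_BIprim (@locally' C_UniformSpace nu) (fun mu => mu) (fun _ => nu));
        [now apply nonperiodic_freq | exact Id | apply Clim_const].
    + unfold BIcross. apply Clim_plus.
      * apply Cdiff_slope. apply BIcross_head_diff.
      * apply Clim_eq with (expser 2 (icoef 2 (fun k => bes2 nu (- nu) (S k))) y
          + expser 2 (icoef 2 (fun k => bes2 (- nu) nu (S k))) y).
        -- apply Clim_plus.
           ++ apply (Clim_BItail (@locally' C_UniformSpace nu) (fun mu => mu) (fun _ => - nu));
                [ring | exact Id | apply Clim_const].
           ++ apply (Clim_BItail (@locally' C_UniformSpace nu) (fun mu => - mu) (fun _ => nu));
                [ring | now apply Clim_opp | apply Clim_const].
        -- replace (expser 2 (icoef 2 (fun k => bes2 (- nu) nu (S k))) y) with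
             (expser 2 (icoef 2 (fun k => bes2 nu (- nu) (S k))) y); [ring|].
           apply expser_ext. intros k. unfold icoef. now rewrite bes2_comm.
Qed.

(** The Taylor bounds at s and at t, with base point and end point exchanged, add up to (f'(s) -
    f'(t)) (s - t). This gives continuity of the derivative without a second derivative. *)
Lemma rGam'_lipschitz (S : R) s t : (0 <= S)%R -> (Cmod s <= S)%R -> (Cmod t <= S)%R ->
  (Cmod (rGam' s - rGam' t) <= 2 * rgn_bound S * Cmod (s - t))%R.
Proof.
  intros HS Hs Ht. destruct (Ceq_dec s t) as [->|N].
  - replace (rGam' t - rGam' t) with (RtoC 0) by ring. rewrite Cmod_0.
    apply Rmult_le_pos; [|apply Cmod_ge_0]. assert (X := rgn_bound_ge_0 S HS). lra.
  - assert (J1 := rGam_jet S HS t (s - t) Ht). assert (J2 := rGam_jet S HS s (t - s) Hs).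
    replace (t + (s - t)) with s in J1 by ring. replace (s + (t - s)) with t in J2 by ring.
    destruct (J1 Hs) as [_ [_ A]]. destruct (J2 Ht) as [_ [_ B]].
    rewrite (Cmod_sub_comm t s) in B.
    assert (P : (0 < Cmod (s - t))%R) by (now apply Cmod_gt_0, Cminus_eq_contra).
    apply Rmult_le_reg_r with (Cmod (s - t)); auto. rewrite <- Cmod_mult.
    replace ((rGam' s - rGam' t) * (s - t)) with
      ((rGam s - rGam t - rGam' t * (s - t)) + (rGam t - rGam s - rGam' s * (t - s))) by ring.
    eapply Rle_trans; [apply Cmod_triangle|].
    replace (2 * rgn_bound S * Cmod (s - t) * Cmod (s - t))%R with
      (rgn_bound S * Cmod (s - t) ^ 2 + rgn_bound S * Cmod (s - t) ^ 2)%R by ring. lra.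
Qed.

Lemma Clim_rGam' {T} (F : (T -> Prop) -> Prop) {FF : Filter F} (f : T -> C) s :
  Clim F f s -> Clim F (fun t => rGam' (f t)) (rGam' s).
Proof.
  intros H. assert (Ps := Cmod_ge_0 s).
  set (B := (2 * rgn_bound (Cmod s + 1))%R).
  assert (B0 : (0 <= B)%R) by (unfold B; assert (X := rgn_bound_ge_0 (Cmod s + 1) ltac:(lra)); lra).
  apply Clim_squeeze with (fun t => B * Cmod (f t - s))%R.
  - generalize (Clim_bounded _ _ H). apply filter_imp. intros t Ht. apply rGam'_lipschitz; lra.
  - intros eps He. assert (P : (0 < eps / (B + 1))%R) by (apply Rdiv_lt_0_compat; lra).
    generalize (H _ P). apply filter_imp. intros t Ht. assert (Q := Cmod_ge_0 (f t - s)).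
    apply Rle_lt_trans with ((B + 1) * Cmod (f t - s))%R; [nra|].
    apply Rmult_lt_compat_l with (r := (B + 1)%R) in Ht; [|lra].
    replace ((B + 1) * (eps / (B + 1)))%R with eps in Ht by (field; lra). exact Ht.
Qed.

Lemma Clim_rGam {T} (F : (T -> Prop) -> Prop) {FF : Filter F} (f : T -> C) s :
  Clim F f s -> Clim F (fun t => rGam (f t)) (rGam s).
Proof. intros H. exact (Clim_locally F rGam f s _ FF (rGam_diff s) H). Qed.

(** The condition reads e^(2 pi i nu) <> 1. It also holds at half-integers, where the hypergeometric
    form breaks down but the primitive does not. *)
Lemma LKprim_cont nu y : nonperiodic (2 * nu) ->
  Clim (@locally' C_UniformSpace nu) (fun n => LKprim n y) (LKprim nu y).
Proof.
  intros H1. assert (H1' := nonperiodic_opp _ H1).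
  replace (- (2 * nu)) with (- nu + - nu) in H1' by ring.
  replace (2 * nu) with (nu + nu) in H1 by ring.
  assert (Id := Clim_id_locally' nu). assert (Op := Clim_opp _ _ Id). cbv beta in Op.
  unfold LKprim. apply Clim_minus; [apply Clim_plus|].
  - apply (Clim_BIprim (@locally' C_UniformSpace nu) (fun n => - n) (fun n => - n)); auto.
    now apply nonperiodic_freq.
  - apply (Clim_BIprim (@locally' C_UniformSpace nu) (fun n => n) (fun n => n)); auto.
    now apply nonperiodic_freq.
  - assert (P1 : Clim (@locally' C_UniformSpace nu) (fun n => 1 + n) (1 + nu))
      by (apply Clim_plus; [apply Clim_const | exact Id]).
    assert (P2 : Clim (@locally' C_UniformSpace nu) (fun n => 1 - n) (1 - nu))
      by (apply Clim_minus; [apply Clim_const | exact Id]).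
    assert (G1 := Clim_rGam _ _ _ P1). assert (G2 := Clim_rGam _ _ _ P2).
    assert (G3 := Clim_rGam' _ _ _ P1). assert (G4 := Clim_rGam' _ _ _ P2).
    unfold BIcross. apply Clim_plus; [apply Clim_plus; [apply Clim_plus|]|].
    + exact (Clim_mult _ _ _ _ G3 G2).
    + exact (Clim_mult _ _ _ _ G4 G1).
    + apply Clim_mult; [apply Clim_const|]. exact (Clim_mult _ _ _ _ G1 G2).
    + apply Clim_mult; [apply Clim_const|].
      apply Clim_ext with (fun n => BItail n (- n) y).
      { intros n. unfold BItail. replace (n + - n + 2) with (RtoC 2) by ring. reflexivity. }
      apply (Clim_BItail (@locally' C_UniformSpace nu) (fun n => n) (fun n => - n)); auto. ring.
Qed.

(** * Comparison with the function of order zero on the positive axis *)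

(* [I0 x] is the modified Bessel function of order 0 at [2 x]. *)
Definition wt (x : R) (k : nat) : R := (x ^ (2 * k) / INR (fact k) ^ 2)%R.
Definition I0 (x : R) : R := Series (wt x).

Local Open Scope R_scope.

Lemma INR_S_ge_1 k : 1 <= INR (S k).
Proof. apply (le_INR 1). lia. Qed.

Lemma wt_ge_0 x k : 0 <= wt x k.
Proof.
  unfold wt. apply Rmult_le_pos; [rewrite pow_mult; apply pow_le, pow2_ge_0|].
  left. apply Rinv_0_lt_compat, pow_lt, INR_fact_lt_0.
Qed.

Lemma wt_S x k : wt x (S k) * INR (S k) ^ 2 = x ^ 2 * wt x k.
Proof.
  unfold wt. replace (2 * S k)%nat with (2 * k + 2)%nat by lia.
  rewrite pow_add, fact_simpl, mult_INR.
  assert (A := INR_fact_lt_0 k). assert (B := INR_S_ge_1 k). field. lra.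
Qed.

Lemma wt_0 x : wt x 0 = 1.
Proof. unfold wt. simpl. field. Qed.

Lemma wt_1 x : wt x 1 = x ^ 2.
Proof. unfold wt. simpl. field. Qed.

Lemma ex_series_wt x : ex_series (wt x).
Proof.
  apply ex_series_pos_le with (fun k => (x ^ 2) ^ k * / INR (fact k)).
  - intros k. split; [apply wt_ge_0|]. unfold wt. rewrite pow_mult.
    apply Rmult_le_compat_l; [apply pow_le, pow2_ge_0|].
    assert (A : 1 <= INR (fact k)) by (apply (le_INR 1), lt_O_fact).
    apply Rinv_le_contravar; [lra|]. simpl. nra.
  - exists (exp (x ^ 2)). assert (H := is_exp_Reals (x ^ 2)).
    apply (proj1 (is_pseries_R _ _ _)) in H. revert H. apply is_series_ext. intros k. apply Rmult_comm.
Qed.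

Lemma I0_ge x : 1 + x ^ 2 <= I0 x.
Proof.
  assert (H := ex_series_wt x). unfold I0.
  rewrite Series_incr_1, wt_0 by auto.
  rewrite Series_incr_1, wt_1 by now apply (ex_series_incr_1 (wt x)).
  assert (0 <= Series (fun k => wt x (S (S k)))); [|lra].
  apply Series_ge_0; [intros; apply wt_ge_0|]. now apply (ex_series_incr_n (wt x) 2).
Qed.

Lemma I0_pos x : 0 < I0 x.
Proof. assert (H := I0_ge x). assert (X := pow2_ge_0 x). lra. Qed.

Lemma I0_shift x n : ex_series (fun k => wt x (n + k)%nat) /\ 0 <= Series (fun k => wt x (n + k)%nat) <= I0 x.
Proof.
  assert (H := ex_series_wt x).
  assert (E : ex_series (fun k => wt x (n + k)%nat)) by now apply (ex_series_incr_n (wt x)).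
  split; auto. split; [apply Series_ge_0; auto; intros; apply wt_ge_0|].
  unfold I0. destruct n as [|n]; [apply Rle_refl|].
  rewrite (Series_incr_n (wt x) (S n)) by (auto; lia).
  assert (0 <= sum_f_R0 (wt x) (pred (S n))); [|lra].
  apply cond_pos_sum. intros; apply wt_ge_0.
Qed.

Lemma INR_SS_le k : INR (S (S k)) <= 2 * INR (S k).
Proof. rewrite !S_INR. assert (X := pos_INR k). lra. Qed.

(** By [wt_S], two powers of the index cost a factor x^2 and a shift of the index. The shift is
    undone by k + 2 <= 2 (k + 1), whence the powers of 4. *)
Lemma wt_pos_moment (M : nat) : exists C, 0 <= C /\ forall x, 1 <= x ->
  ex_series (fun k => INR (S k) ^ (2 * M) * wt x k) /\
  Series (fun k => INR (S k) ^ (2 * M) * wt x k) <= C * x ^ (2 * M) * I0 x.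
Proof.
  induction M as [|M [C [HC IH]]].
  - exists 1. split; [lra|]. intros x Hx.
    assert (E : forall k, wt x k = INR (S k) ^ (2 * 0) * wt x k) by (intros k; simpl; ring).
    split.
    + apply ex_series_ext with (wt x); auto. apply ex_series_wt.
    + rewrite <- (Series_ext _ _ E). simpl. fold (I0 x). lra.
  - exists (1 + 4 ^ S M * C). split; [assert (0 <= 4 ^ S M) by (apply pow_le; lra); nra|].
    intros x Hx. destruct (IH x Hx) as [IH1 IH2].
    assert (Hk : forall k, 0 <= INR (S (S k)) ^ (2 * S M) * wt x (S k)
       <= 4 ^ S M * x ^ 2 * (INR (S k) ^ (2 * M) * wt x k)).
    { intros k. split; [apply Rmult_le_pos; [apply pow_le, pos_INR | apply wt_ge_0]|].
      apply Rle_trans with ((2 * INR (S k)) ^ (2 * S M) * wt x (S k)).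
      - apply Rmult_le_compat_r; [apply wt_ge_0|]. apply pow_incr. split; [apply pos_INR | apply INR_SS_le].
      - rewrite Rpow_mult_distr. replace (2 ^ (2 * S M)) with (4 ^ S M).
        + replace (2 * S M)%nat with (2 * M + 2)%nat by lia. rewrite pow_add.
          replace (4 ^ S M * (INR (S k) ^ (2 * M) * INR (S k) ^ 2) * wt x (S k)) with
            (4 ^ S M * INR (S k) ^ (2 * M) * (wt x (S k) * INR (S k) ^ 2)) by ring.
          rewrite wt_S. apply Req_le. ring.
        + rewrite pow_mult. f_equal. ring. }
    assert (S1 : ex_series (fun k => INR (S (S k)) ^ (2 * S M) * wt x (S k))).
    { apply ex_series_pos_le with (1 := Hk).
      now apply (ex_series_scal (K := R_AbsRing) (V := R_NormedModule)). }
    assert (S0 : ex_series (fun k => INR (S k) ^ (2 * S M) * wt x k)) by now apply ex_series_incr_1.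
    split; auto. rewrite Series_incr_1, wt_0 by auto.
    assert (B : Series (fun k => INR (S (S k)) ^ (2 * S M) * wt x (S k))
      <= 4 ^ S M * x ^ 2 * (C * x ^ (2 * M) * I0 x)).
    { eapply Rle_trans; [apply Series_le; [exact Hk|]|].
      - now apply (ex_series_scal (K := R_AbsRing) (V := R_NormedModule)).
      - rewrite Series_scal_l. apply Rmult_le_compat_l; auto.
        apply Rmult_le_pos; [apply pow_le; lra | apply pow2_ge_0]. }
    assert (P1 : 1 <= x ^ (2 * S M) * I0 x).
    { assert (1 <= x ^ (2 * S M)) by now apply pow_R1_Rle.
      assert (X := I0_ge x). assert (Y := pow2_ge_0 x). nra. }
    simpl (INR 1). rewrite pow1.
    replace ((1 + 4 ^ S M * C) * x ^ (2 * S M) * I0 x) with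
      (x ^ (2 * S M) * I0 x + 4 ^ S M * x ^ 2 * (C * x ^ (2 * M) * I0 x)).
    + lra.
    + replace (2 * S M)%nat with (2 * M + 2)%nat by lia. rewrite !pow_add. ring.
Qed.

(** The recurrence in the opposite direction: (x/(k + 1))^2 times the weight k is the weight k +
    1. *)
Lemma wt_neg_moment (M : nat) : exists C, 0 <= C /\ forall x, 1 <= x ->
  ex_series (fun k => (x / INR (S k)) ^ (2 * M) * wt x k) /\
  Series (fun k => (x / INR (S k)) ^ (2 * M) * wt x k) <= C * I0 x.
Proof.
  induction M as [|M [C [HC IH]]].
  - exists 1. split; [lra|]. intros x Hx.
    assert (E : forall k, wt x k = (x / INR (S k)) ^ (2 * 0) * wt x k) by (intros k; simpl; ring).
    split.
    + apply ex_series_ext with (wt x); auto. apply ex_series_wt.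
    + rewrite <- (Series_ext _ _ E). fold (I0 x). lra.
  - exists (4 ^ M * C). split; [assert (0 <= 4 ^ M) by (apply pow_le; lra); nra|].
    intros x Hx. destruct (IH x Hx) as [IH1 IH2].
    assert (Hk : forall k, 0 <= (x / INR (S k)) ^ (2 * S M) * wt x k
       <= 4 ^ M * ((x / INR (S (S k))) ^ (2 * M) * wt x (S k))).
    { intros k. assert (A := INR_S_ge_1 k). assert (B := INR_S_ge_1 (S k)).
      split; [apply Rmult_le_pos; [apply pow_le, Rmult_le_pos; [lra | left; apply Rinv_0_lt_compat; lra] | apply wt_ge_0]|].
      replace (2 * S M)%nat with (2 * M + 2)%nat by lia. rewrite pow_add.
      replace ((x / INR (S k)) ^ (2 * M) * (x / INR (S k)) ^ 2 * wt x k) with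
        ((x / INR (S k)) ^ (2 * M) * (x ^ 2 * wt x k / INR (S k) ^ 2)) by (field; lra).
      rewrite <- wt_S. replace (wt x (S k) * INR (S k) ^ 2 / INR (S k) ^ 2) with (wt x (S k)) by (field; lra).
      rewrite <- Rmult_assoc. apply Rmult_le_compat_r; [apply wt_ge_0|].
      replace (4 ^ M) with (2 ^ (2 * M)) by (rewrite pow_mult; f_equal; ring).
      rewrite <- Rpow_mult_distr. apply pow_incr.
      split; [apply Rmult_le_pos; [lra | left; apply Rinv_0_lt_compat; lra]|].
      unfold Rdiv. replace (2 * (x * / INR (S (S k)))) with (x * (2 * / INR (S (S k)))) by ring.
      apply Rmult_le_compat_l; [lra|].
      replace (2 * / INR (S (S k))) with (/ (INR (S (S k)) / 2)) by (field; lra).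
      apply Rinv_le_contravar; [lra|]. assert (X := INR_SS_le k). lra. }
    assert (S1 : ex_series (fun k => (x / INR (S (S k))) ^ (2 * M) * wt x (S k)))
      by now apply (ex_series_incr_1 (fun k => (x / INR (S k)) ^ (2 * M) * wt x k)).
    assert (S2 : ex_series (fun k => 4 ^ M * ((x / INR (S (S k))) ^ (2 * M) * wt x (S k))))
      by now apply (ex_series_scal (K := R_AbsRing) (V := R_NormedModule)).
    split; [now apply ex_series_pos_le with (1 := Hk)|].
    eapply Rle_trans; [apply Series_le; [exact Hk | exact S2]|].
    rewrite Series_scal_l, Rmult_assoc. apply Rmult_le_compat_l; [apply pow_le; lra|].
    apply Rle_trans with (2 := IH2). rewrite (Series_incr_1 (fun k => (x / INR (S k)) ^ (2 * M) * wt x k)) by auto.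
    assert (0 <= (x / INR 1) ^ (2 * M) * wt x 0); [|lra].
    apply Rmult_le_pos; [|apply wt_ge_0]. apply pow_le. simpl. lra.
Qed.

(* The weights concentrate where [k + 1] is close to [x]. *)
Lemma wt_concentration x : 1 <= x ->
  ex_series (fun k => ((x / INR (S k)) ^ 2 - 1) ^ 2 * wt x k) /\
  Series (fun k => ((x / INR (S k)) ^ 2 - 1) ^ 2 * wt x k) <= 10 * I0 x / x.
Proof.
  (* With n = k + 1, expanding the square and using [wt_S] gives ((n + 1)/n)^2 w_(k+2) - 2 w_(k+1) +
     w_k. Up to a correction of relative order 1/x this is a second difference, whose sum is
     elementary. *)
  intros Hx. set (B := fun k => ((wt x (2 + k) + 9 / (2 * x) * (wt x (2 + k) + wt x (3 + k))) - 2 * wt x (1 + k)) + wt x k).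
  destruct (I0_shift x 1) as [E1 F1]. destruct (I0_shift x 2) as [E2 F2]. destruct (I0_shift x 3) as [E3 F3].
  assert (E0 := ex_series_wt x).
  assert (Hk : forall k, 0 <= ((x / INR (S k)) ^ 2 - 1) ^ 2 * wt x k <= B k).
  { intros k. split; [apply Rmult_le_pos; [apply pow2_ge_0 | apply wt_ge_0]|].
    assert (A1 := INR_S_ge_1 k).
    assert (H1 := wt_S x k). assert (H2 := wt_S x (S k)). assert (H3 := wt_S x (S (S k))).
    assert (W0 := wt_ge_0 x k). assert (W1 := wt_ge_0 x (S k)). assert (W2 := wt_ge_0 x (S (S k))).
    assert (W3 := wt_ge_0 x (S (S (S k)))).
    unfold B. simpl Nat.add.
    replace (INR (S (S (S k)))) with (INR (S k) + 2) in * by (rewrite !S_INR; ring).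
    replace (INR (S (S k))) with (INR (S k) + 1) in * by (rewrite !S_INR; ring).
    set (n := INR (S k)) in *. set (w0 := wt x k) in *. set (w1 := wt x (S k)) in *.
    set (w2 := wt x (S (S k))) in *. set (w3 := wt x (S (S (S k)))) in *.
    assert (Z2 : (x / n) ^ 2 * w0 = w1).
    { replace ((x / n) ^ 2 * w0) with (x ^ 2 * w0 / n ^ 2) by (field; lra). rewrite <- H1. field. lra. }
    assert (Z4 : (x / n) ^ 2 * w1 = w2 * ((n + 1) / n) ^ 2).
    { replace ((x / n) ^ 2 * w1) with (x ^ 2 * w1 / n ^ 2) by (field; lra). rewrite <- H2. field. lra. }
    replace (((x / n) ^ 2 - 1) ^ 2 * w0) with ((x / n) ^ 2 * ((x / n) ^ 2 * w0) - 2 * ((x / n) ^ 2 * w0) + w0) by ring.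
    rewrite Z2, Z4.
    (* ((n + 1)/n)^2 <= 1 + 9/(n + 2), with equality at n = 1. Then 2 x (n + 2) <= (n + 2)^2 + x^2
       trades 1/(n + 2) for 1/(2x), since (n + 2)^2 w3 = x^2 w2. *)
    assert (Q : w2 * ((n + 1) / n) ^ 2 <= w2 + 9 / (2 * x) * (w2 + w3)); [|lra].
    apply Rle_trans with (w2 * (1 + 9 / (n + 2))).
    { apply Rmult_le_compat_l; auto.
      apply Rmult_le_reg_r with (n ^ 2 * (n + 2)); [apply Rmult_lt_0_compat; [apply pow_lt|]; lra|].
      replace (((n + 1) / n) ^ 2 * (n ^ 2 * (n + 2))) with ((n + 1) ^ 2 * (n + 2)) by (field; lra).
      replace ((1 + 9 / (n + 2)) * (n ^ 2 * (n + 2))) with ((n + 2 + 9) * n ^ 2) by (field; lra).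
      nra. }
    rewrite Rmult_plus_distr_l, Rmult_1_r. apply Rplus_le_compat_l.
    replace (9 / (2 * x) * (w2 + w3)) with (9 * ((w2 + w3) / (2 * x))) by (field; lra).
    replace (w2 * (9 / (n + 2))) with (9 * (w2 / (n + 2))) by (field; lra).
    apply Rmult_le_compat_l; [lra|].
    assert (E : w3 = x ^ 2 * w2 / (n + 2) ^ 2) by (rewrite <- H3; field; lra).
    rewrite E. apply Rmult_le_reg_r with (2 * x * (n + 2) ^ 2).
    { apply Rmult_lt_0_compat; [lra | apply pow_lt; lra]. }
    replace (w2 / (n + 2) * (2 * x * (n + 2) ^ 2)) with (w2 * (2 * x * (n + 2))) by (field; lra).
    replace ((w2 + x ^ 2 * w2 / (n + 2) ^ 2) / (2 * x) * (2 * x * (n + 2) ^ 2)) with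
      (w2 * ((n + 2) ^ 2 + x ^ 2)) by (field; lra).
    apply Rmult_le_compat_l; auto. assert (Sq := Rle_0_sqr (n + 2 - x)). unfold Rsqr in Sq. lra. }
  assert (X1 : ex_series (fun k => wt x (2 + k) + wt x (3 + k))) by now apply (ex_series_plus (fun k => wt x (2 + k)) (fun k => wt x (3 + k))).
  assert (X2 : ex_series (fun k => 9 / (2 * x) * (wt x (2 + k) + wt x (3 + k))))
    by now apply (ex_series_scal (K := R_AbsRing) (V := R_NormedModule)).
  assert (X3 : ex_series (fun k => wt x (2 + k) + 9 / (2 * x) * (wt x (2 + k) + wt x (3 + k))))
    by now apply (ex_series_plus (fun k => wt x (2 + k)) (fun k => 9 / (2 * x) * (wt x (2 + k) + wt x (3 + k)))).
  assert (X4 : ex_series (fun k => 2 * wt x (1 + k))) by now apply (ex_series_scal (K := R_AbsRing) (V := R_NormedModule)).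
  assert (X5 : ex_series (fun k => wt x (2 + k) + 9 / (2 * x) * (wt x (2 + k) + wt x (3 + k)) - 2 * wt x (1 + k)))
    by now apply (ex_series_minus (fun k => wt x (2 + k) + 9 / (2 * x) * (wt x (2 + k) + wt x (3 + k))) (fun k => 2 * wt x (1 + k))).
  assert (XB : ex_series B) by now apply (ex_series_plus (fun k => wt x (2 + k) + 9 / (2 * x) * (wt x (2 + k) + wt x (3 + k)) - 2 * wt x (1 + k)) (wt x)).
  split; [now apply ex_series_pos_le with (1 := Hk)|].
  eapply Rle_trans; [apply Series_le; [exact Hk | exact XB]|].
  unfold B. rewrite Series_plus, Series_minus, Series_plus, !Series_scal_l, Series_plus by auto.
  assert (G1 : I0 x = 1 + Series (fun k => wt x (1 + k))).
  { unfold I0. now rewrite Series_incr_1, wt_0 by auto. }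
  assert (G2 : Series (fun k => wt x (1 + k)) = x ^ 2 + Series (fun k => wt x (2 + k))).
  { rewrite (Series_incr_1 (fun k => wt x (1 + k))) by auto. simpl Nat.add. now rewrite wt_1. }
  change (Series (wt x)) with (I0 x).
  set (s1 := Series (fun k => wt x (1 + k))) in *. set (s2 := Series (fun k => wt x (2 + k))) in *.
  set (s3 := Series (fun k => wt x (3 + k))) in *.
  assert (L : 9 / (2 * x) * (s2 + s3) <= 9 / (2 * x) * (2 * I0 x)).
  { apply Rmult_le_compat_l; [|lra]. apply Rmult_le_pos; [lra | left; apply Rinv_0_lt_compat; lra]. }
  replace (9 / (2 * x) * (2 * I0 x)) with (9 * (I0 x / x)) in L by (field; lra).
  replace (10 * I0 x / x) with (9 * (I0 x / x) + I0 x / x) by (field; lra).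
  assert (U : 1 <= I0 x / x).
  { apply Rmult_le_reg_r with x; [lra|]. unfold Rdiv. rewrite Rmult_assoc, Rinv_l by lra.
    assert (X := I0_ge x). assert (x * 1 <= x ^ 2) by (simpl; apply Rmult_le_compat_l; lra). lra. }
  assert (V := pow2_ge_0 x). lra.
Qed.

(** * Termwise comparison of I_mu with I_0 *)

Lemma exp_abs_ln (z : R) : 0 < z -> exp (Rabs (ln z)) <= z + / z.
Proof.
  intros Hz. assert (P : 0 < / z) by now apply Rinv_0_lt_compat.
  unfold Rabs. destruct (Rcase_abs (ln z)).
  - rewrite exp_Ropp, exp_ln by auto. lra.
  - rewrite exp_ln by auto. lra.
Qed.

(** The concentration estimate controls z^2 - 1, with z = x/(k + 1), whereas the terms involve ln z;
    this converts one into the other at the price of a factor that the moments absorb. *)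
Lemma abs_ln_le (z : R) : 0 < z -> Rabs (ln z) <= Rabs (z ^ 2 - 1) * (z + / z).
Proof.
  intros Hz. assert (P : 0 < / z) by now apply Rinv_0_lt_compat.
  assert (E : z * / z = 1) by (apply Rinv_r; lra).
  assert (U := ln_le_sub1 z Hz). assert (V := ln_le_sub1 (/ z) P). rewrite ln_Rinv in V by auto.
  assert (Q : 2 <= z + / z).
  { assert (X := Rle_0_sqr (z - 1)). unfold Rsqr in X. nra. }
  destruct (Rle_dec 1 z) as [L|L].
  - rewrite (Rabs_pos_eq (z ^ 2 - 1)) by nra.
    rewrite Rabs_pos_eq by (rewrite <- ln_1; apply ln_le; lra). nra.
  - assert (L1 : / z - 1 = (1 - z) * / z) by lra.
    rewrite (Rabs_left1 (z ^ 2 - 1)) by nra.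
    rewrite Rabs_left1 by (rewrite <- ln_1; apply ln_le; lra).
    apply Rle_trans with ((1 - z) * / z); [lra|].
    apply Rmult_le_compat; try lra. nra.
Qed.

(** k! (k + 1)^mu / Gamma(mu + k + 1), which tends to 1. Up to the factor (x/(k + 1))^mu it is the
    ratio of the k-th terms of I_mu and I_0, as [BI_term] shows. *)
Definition bcoef (mu : C) (k : nat) : C :=
  (RtoC (INR (fact k)) * Cexp (mu * RtoC (ln (INR (S k)))) * rGam (mu + RtoC (INR k) + 1))%C.

Lemma bcoef_rgn mu k : (bcoef mu k * rgn k mu = rGam mu)%C.
Proof.
  rewrite rgn_closed, (rGam_rising mu (S k)). unfold bcoef.
  replace (mu + RtoC (INR (S k)))%C with (mu + RtoC (INR k) + 1)%C by (rewrite RtoC_INR_S; ring).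
  assert (N1 := Cexp_neq_0 (mu * RtoC (ln (INR (S k))))). assert (N2 := INR_fact_neq_0_C k).
  field. auto.
Qed.

(** By [bcoef_rgn] the deviation from 1 is the relative error of the partial product. For k >= N
    that error has rate 1/k and a denominator at least m/2; the smaller k are covered by a crude
    bound D multiplied by N + 1. *)
Lemma bcoef_limit (S m : R) : 0 <= S -> 0 < m -> exists K, 0 <= K /\
  forall mu k, Cmod mu <= S -> m <= Cmod (rGam mu) ->
  Cmod (bcoef mu k - 1) <= K / INR (Datatypes.S k).
Proof.
  intros HS Hm. set (A := rgn_rate S). assert (HA : 0 <= A) by now apply rgn_rate_ge_0.
  destruct (INR_ge (2 * A / m)) as [N HN].
  destruct (rGam_shift_bound S HS) as [K1 [HK1 HB]].
  set (D := 1 + INR (fact N) * exp (S * INR (Datatypes.S N)) * K1).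
  assert (HF : 0 < INR (fact N)) by apply INR_fact_lt_0.
  assert (HE : 0 < exp (S * INR (Datatypes.S N))) by apply exp_pos.
  assert (HD : 0 <= D).
  { unfold D. assert (0 <= INR (fact N) * exp (S * INR (Datatypes.S N)) * K1); [|lra].
    apply Rmult_le_pos; auto. apply Rmult_le_pos; lra. }
  assert (H2A : 0 <= 2 * A / m) by (apply Rmult_le_pos; [lra | left; now apply Rinv_0_lt_compat]).
  assert (HNN : 0 <= D * INR (Datatypes.S N)) by (apply Rmult_le_pos; auto using pos_INR).
  exists (2 * A / m + D * INR (Datatypes.S N)). split; [lra|].
  intros mu k Hmu Hg. assert (Pk := INR_S_ge_1 k).
  assert (Ik : 0 < / INR (Datatypes.S k)) by (apply Rinv_0_lt_compat; lra).
  destruct (le_lt_dec N k) as [L|L].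
  - assert (Hr := rGam_rate S k mu HS Hmu). fold A in Hr.
    assert (LN : INR N <= INR k) by now apply le_INR. rewrite S_INR in Pk.
    assert (Hs : A * / INR (Datatypes.S k) <= m / 2).
    { apply Rmult_le_reg_r with (INR (Datatypes.S k)); [rewrite S_INR; lra|].
      rewrite Rmult_assoc, Rinv_l, S_INR by (rewrite S_INR; lra).
      assert (Q : 2 * A / m * m <= (INR k + 1) * m) by (apply Rmult_le_compat_r; lra).
      replace (2 * A / m * m) with (2 * A) in Q by (field; lra). lra. }
    assert (Hl : m / 2 <= Cmod (rgn k mu)).
    { assert (X := Cmod_triangle_rev (rGam mu) (rGam mu - rgn k mu)).
      replace (rGam mu - (rGam mu - rgn k mu))%C with (rgn k mu) in X by ring. lra. }
    assert (Nz : rgn k mu <> 0%C) by (apply Cmod_gt_0; lra).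
    replace (bcoef mu k - 1)%C with ((rGam mu - rgn k mu) / rgn k mu)%C
      by (rewrite <- (bcoef_rgn mu k); field; auto).
    rewrite Cmod_div by auto.
    apply Rle_trans with (A * / INR (Datatypes.S k) * (2 / m)).
    { unfold Rdiv. apply Rmult_le_compat; auto using Cmod_ge_0.
      - left. apply Rinv_0_lt_compat. lra.
      - replace (2 * / m) with (/ (m / 2)) by (field; lra). apply Rinv_le_contravar; lra. }
    replace ((2 * A / m + D * INR (Datatypes.S N)) / INR (Datatypes.S k)) with
      (A * / INR (Datatypes.S k) * (2 / m) + D * INR (Datatypes.S N) * / INR (Datatypes.S k))
      by (field; rewrite S_INR; lra).
    assert (0 <= D * INR (Datatypes.S N) * / INR (Datatypes.S k)) by (apply Rmult_le_pos; lra). lra.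
  - apply Rle_trans with D.
    + eapply Rle_trans; [apply Cmod_triangle_sub|]. rewrite Cmod_1. unfold D.
      assert (Q : Cmod (bcoef mu k) <= INR (fact N) * exp (S * INR (Datatypes.S N)) * K1); [|lra].
      unfold bcoef. rewrite !Cmod_mult, Cmod_RtoC_pos by apply pos_INR.
      apply Rmult_le_compat; auto; try apply Cmod_ge_0.
      * apply Rmult_le_pos; [apply pos_INR | apply Cmod_ge_0].
      * apply Rmult_le_compat; [apply pos_INR | apply Cmod_ge_0 | apply le_INR, fact_le; lia |].
        eapply Rle_trans; [apply Cmod_Cexp_le|]. apply exp_le. rewrite Cmod_mult, Cmod_R.
        assert (0 <= ln (INR (Datatypes.S k))) by (rewrite <- ln_1; apply ln_le; lra).
        rewrite Rabs_pos_eq by auto. apply Rmult_le_compat; auto using Cmod_ge_0.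
        eapply Rle_trans; [apply ln_le_sub1; lra|].
        assert (INR (Datatypes.S k) <= INR (Datatypes.S N)) by (apply le_INR; lia). lra.
    + apply Rmult_le_reg_r with (INR (Datatypes.S k)); [lra|].
      unfold Rdiv. rewrite Rmult_assoc, Rinv_l, Rmult_1_r by lra.
      assert (D * INR (Datatypes.S k) <= D * INR (Datatypes.S N)); [|lra].
      apply Rmult_le_compat_l; auto. apply le_INR. lia.
Qed.

Lemma BI_term mu k (y : R) :
  (bes mu k * Cexp ((mu + 2 * RtoC (INR k)) * RtoC y) =
   RtoC (wt (exp y) k) * (bcoef mu k * Cexp (mu * RtoC (ln (exp y / INR (S k))))))%C.
Proof.
  assert (P := INR_S_ge_1 k). assert (F := INR_fact_lt_0 k).
  assert (Pi : 0 < / INR (S k)) by (apply Rinv_0_lt_compat; lra).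
  unfold Rdiv. rewrite ln_mult, ln_exp, ln_Rinv by (try apply exp_pos; lra).
  rewrite Cexp_freq. rewrite <- RtoC_mult, Cexp_RtoC.
  replace (2 * y) with (y + y) by ring. rewrite exp_plus.
  unfold bcoef, bes, wt. rewrite pow_mult, RtoC_div, !RtoC_pow, RtoC_mult by (apply pow_nonzero; lra).
  replace (RtoC (exp y) ^ 2)%C with (RtoC (exp y) * RtoC (exp y))%C by ring.
  replace (mu * RtoC (y + - ln (INR (S k))))%C with (mu * RtoC y + - (mu * RtoC (ln (INR (S k)))))%C
    by (rewrite RtoC_plus, RtoC_opp; ring).
  rewrite Cexp_plus, Cexp_opp.
  assert (N1 := Cexp_neq_0 (mu * RtoC (ln (INR (S k))))). assert (N2 := INR_fact_neq_0_C k).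
  field. auto.
Qed.

(** Here z stands for x/(k + 1). The bound is quadratic in z^2 - 1 because only the mean square of
    that quantity is known to be small. The integer N >= S turns z^mu into integer powers of z +
    1/z, accessible to the moments. *)
Lemma term_bound (S K : R) (N : nat) (b mu : C) (z x : R) :
  0 <= S -> 0 <= K -> S <= INR N -> 0 < z -> 1 <= x -> Cmod mu <= S -> Cmod (b - 1) <= K * (z / x) ->
  Cmod (b * Cexp (mu * RtoC (ln z)) - 1) <=
  (2 * S) * (sqrt x * (z ^ 2 - 1) ^ 2) + (K + 2 * S) * ((z + / z) ^ (2 * (N + 1)) / sqrt x).
Proof.
  intros HS HK HN Hz Hx Hmu Hb.
  assert (Pz : 0 < / z) by now apply Rinv_0_lt_compat.
  assert (E : z * / z = 1) by (apply Rinv_r; lra).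
  set (Y := z + / z). assert (HY : 2 <= Y).
  { unfold Y. assert (X := Rle_0_sqr (z - 1)). unfold Rsqr in X. nra. }
  set (u := ln z).
  assert (Hu : Rabs u <= Rabs (z ^ 2 - 1) * Y) by now apply abs_ln_le.
  assert (He : exp (S * Rabs u) <= Y ^ N).
  { apply Rle_trans with (exp (Rabs u * INR N)); [apply exp_le; assert (X := Rabs_pos u); nra|].
    rewrite exp_INR_mult. apply pow_incr. split; [left; apply exp_pos | now apply exp_abs_ln]. }
  assert (Hmu' : Cmod (mu * RtoC u) <= S * Rabs u).
  { rewrite Cmod_mult, Cmod_R. apply Rmult_le_compat_r; auto. apply Rabs_pos. }
  assert (YN : 1 <= Y ^ N) by (apply pow_R1_Rle; lra).
  assert (E1 : Cmod (Cexp (mu * RtoC u)) <= Y ^ N).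
  { eapply Rle_trans; [apply Cmod_Cexp_le|]. apply Rle_trans with (2 := He). now apply exp_le. }
  assert (E2 : Cmod (Cexp (mu * RtoC u) - 1) <= 3 * (S * Rabs u) * Y ^ N).
  { eapply Rle_trans; [apply Cmod_Cexp_sub1|]. apply Rmult_le_compat.
    - assert (X := Cmod_ge_0 (mu * RtoC u)). lra.
    - left; apply exp_pos.
    - lra.
    - apply Rle_trans with (2 := He). now apply exp_le. }
  replace (b * Cexp (mu * RtoC u) - 1)%C with ((b - 1) * Cexp (mu * RtoC u) + (Cexp (mu * RtoC u) - 1))%C by ring.
  eapply Rle_trans; [apply Cmod_triangle|]. rewrite Cmod_mult.
  set (r := sqrt x). assert (Hr : r * r = x) by (apply sqrt_sqrt; lra).
  assert (Hr1 : 1 <= r) by (unfold r; rewrite <- sqrt_1; apply sqrt_le_1; lra).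
  assert (Ir : 0 < / r <= 1).
  { split; [apply Rinv_0_lt_compat; lra|]. rewrite <- Rinv_1. apply Rinv_le_contravar; lra. }
  set (V := Y ^ (N + 1)). assert (HV : V = Y * Y ^ N) by (unfold V; now rewrite Nat.add_1_r).
  assert (V1 : 1 <= V) by (apply pow_R1_Rle; lra).
  replace (Y ^ (2 * (N + 1))) with (V * V) by (unfold V; rewrite <- pow_add; f_equal; lia).
  set (g := Rabs (z ^ 2 - 1)) in *. assert (Pg : 0 <= g) by apply Rabs_pos.
  replace ((z ^ 2 - 1) ^ 2) with (g * g).
  2: { unfold g. rewrite <- Rabs_mult, Rabs_pos_eq; [ring | apply Rle_0_sqr]. }
  assert (T1 : Cmod (b - 1) * Cmod (Cexp (mu * RtoC u)) <= K * (V * V / r)).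
  { apply Rle_trans with (K * (z / x) * Y ^ N).
    - apply Rmult_le_compat; auto using Cmod_ge_0.
    - rewrite Rmult_assoc. apply Rmult_le_compat_l; auto.
      assert (Zx : z / x <= Y * / r).
      { unfold Rdiv. rewrite <- Hr, Rinv_mult. apply Rmult_le_compat; try lra.
        - nra.
        - unfold Y. lra.
        - nra. }
      apply Rle_trans with (Y * / r * Y ^ N); [apply Rmult_le_compat_r; lra|].
      replace (Y * / r * Y ^ N) with (V * / r) by (rewrite HV; ring).
      apply Rmult_le_compat_r; [lra | nra]. }
  assert (T2 : 3 * (S * Rabs u) * Y ^ N <= 3 * S * (g * V)).
  { replace (3 * (S * Rabs u) * Y ^ N) with (3 * S * (Rabs u * Y ^ N)) by ring.
    apply Rmult_le_compat_l; [lra|]. rewrite HV, <- Rmult_assoc. apply Rmult_le_compat_r; lra. }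
  (* The linear term in g is split with the weight sqrt x. The mean of g^2 being O(1/x), both
     resulting terms are O(1/sqrt x). *)
  assert (AG : g * V <= (r * (g * g) + V * V / r) / 2).
  { assert (X := Rle_0_sqr (r * g - V)). unfold Rsqr in X.
    apply Rmult_le_reg_r with r; [lra|].
    replace ((r * (g * g) + V * V / r) / 2 * r) with ((r * r * (g * g) + V * V) / 2) by (field; lra).
    nra. }
  assert (AG' : 3 * S * (g * V) <= 3 * S * ((r * (g * g) + V * V / r) / 2)) by (apply Rmult_le_compat_l; lra).
  assert (P1 : 0 <= S * (r * (g * g))) by (apply Rmult_le_pos; auto; apply Rmult_le_pos; nra).
  assert (P2 : 0 <= S * (V * V / r)).
  { apply Rmult_le_pos; auto. apply Rmult_le_pos; [nra | lra]. }
  lra.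
Qed.

(** Summing [term_bound] against the weights: the concentration gives sqrt x times 10/x, the two
    moments of order 2 (N + 1) give a constant over sqrt x. Both are multiples of 1/sqrt x. *)
Lemma BI_near_I0 (S m : R) : 0 <= S -> 0 < m -> exists A, 0 <= A /\
  forall mu y, Cmod mu <= S -> m <= Cmod (rGam mu) -> 1 <= exp y ->
  Cmod (BI mu (RtoC y) - RtoC (I0 (exp y))) <= A / sqrt (exp y) * I0 (exp y).
Proof.
  intros HS Hm. destruct (bcoef_limit S m HS Hm) as [K [HK HB]].
  destruct (INR_ge S) as [N HN]. set (p := (N + 1)%nat).
  destruct (wt_pos_moment p) as [C1 [HC1 T1]]. destruct (wt_neg_moment p) as [C2 [HC2 T2]].
  set (A := 2 * S * 10 + (K + 2 * S) * (4 ^ p * (C2 + C1))).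
  assert (P4 : 0 <= 4 ^ p) by (apply pow_le; lra).
  exists A. split.
  { unfold A. assert (0 <= (K + 2 * S) * (4 ^ p * (C2 + C1))); [|lra].
    apply Rmult_le_pos; [lra|]. apply Rmult_le_pos; lra. }
  intros mu y Hmu Hg Hx. set (x := exp y) in *.
  destruct (T1 x Hx) as [T1a T1b]. destruct (T2 x Hx) as [T2a T2b].
  destruct (wt_concentration x Hx) as [V1 V2].
  set (r := sqrt x). assert (Hr : r * r = x) by (apply sqrt_sqrt; lra).
  assert (Hr1 : 1 <= r) by (unfold r; rewrite <- sqrt_1; apply sqrt_le_1; lra).
  assert (Ir : 0 < / r) by (apply Rinv_0_lt_compat; lra).
  set (B := fun k => 2 * S * r * (((x / INR (Datatypes.S k)) ^ 2 - 1) ^ 2 * wt x k)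
    + (K + 2 * S) * 4 ^ p / r * ((x / INR (Datatypes.S k)) ^ (2 * p) * wt x k
         + / x ^ (2 * p) * (INR (Datatypes.S k) ^ (2 * p) * wt x k))).
  assert (X1 : ex_series (fun k => 2 * S * r * (((x / INR (Datatypes.S k)) ^ 2 - 1) ^ 2 * wt x k)))
    by now apply (ex_series_scal (K := R_AbsRing) (V := R_NormedModule)).
  assert (X2 : ex_series (fun k => / x ^ (2 * p) * (INR (Datatypes.S k) ^ (2 * p) * wt x k)))
    by now apply (ex_series_scal (K := R_AbsRing) (V := R_NormedModule)).
  assert (X3 : ex_series (fun k => (x / INR (Datatypes.S k)) ^ (2 * p) * wt x k
         + / x ^ (2 * p) * (INR (Datatypes.S k) ^ (2 * p) * wt x k)))
    by now apply (ex_series_plus (fun k => (x / INR (Datatypes.S k)) ^ (2 * p) * wt x k)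
         (fun k => / x ^ (2 * p) * (INR (Datatypes.S k) ^ (2 * p) * wt x k))).
  assert (X4 : ex_series (fun k => (K + 2 * S) * 4 ^ p / r * ((x / INR (Datatypes.S k)) ^ (2 * p) * wt x k
         + / x ^ (2 * p) * (INR (Datatypes.S k) ^ (2 * p) * wt x k))))
    by now apply (ex_series_scal (K := R_AbsRing) (V := R_NormedModule)).
  assert (XB : ex_series B) by now apply (ex_series_plus (fun k => 2 * S * r * (((x / INR (Datatypes.S k)) ^ 2 - 1) ^ 2 * wt x k)) _ X1 X4).
  assert (W : Csummable (fun k => RtoC (wt x k))).
  { apply Csummable_le with (2 := ex_series_wt x). intros k. rewrite Cmod_RtoC_pos; [apply Rle_refl | apply wt_ge_0]. }
  assert (EI : RtoC (I0 x) = CSeries (fun k => RtoC (wt x k)))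
    by (symmetry; apply CSeries_RtoC).
  unfold BI, expser. rewrite EI, <- CSeries_minus; auto.
  2: { apply expser_summable, entire_bes. }
  eapply Rle_trans; [apply CSeries_mod_le_dom with (b := B); [|exact XB]|].
  - intros k. rewrite BI_term. fold x. set (z := x / INR (Datatypes.S k)).
    assert (Pk := INR_S_ge_1 k).
    assert (Hz : 0 < z) by (apply Rdiv_lt_0_compat; lra).
    replace (RtoC (wt x k) * (bcoef mu k * Cexp (mu * RtoC (ln z))) - RtoC (wt x k))%C with
      (RtoC (wt x k) * (bcoef mu k * Cexp (mu * RtoC (ln z)) - 1))%C by ring.
    assert (W0 := wt_ge_0 x k). rewrite Cmod_mult, Cmod_RtoC_pos by auto.
    eapply Rle_trans; [apply Rmult_le_compat_l; [auto|]; apply (term_bound S K N (bcoef mu k) mu z x); auto|].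
    { replace (K * (z / x)) with (K / INR (Datatypes.S k)) by (unfold z; field; lra). now apply HB. }
    fold p r. unfold B. fold z.
    assert (Yb : (z + / z) ^ (2 * p) <= 4 ^ p * (z ^ (2 * p) + (/ z) ^ (2 * p))).
    { assert (Pz : 0 < / z) by now apply Rinv_0_lt_compat.
      replace (4 ^ p) with (2 ^ (2 * p)) by (rewrite pow_mult; f_equal; ring).
      rewrite Rmult_plus_distr_l, <- !Rpow_mult_distr.
      assert (Q1 : 0 <= (2 * z) ^ (2 * p)) by (apply pow_le; lra).
      assert (Q2 : 0 <= (2 * / z) ^ (2 * p)) by (apply pow_le; lra).
      destruct (Rle_dec z (/ z)) as [L|L].
      - assert ((z + / z) ^ (2 * p) <= (2 * / z) ^ (2 * p)) by (apply pow_incr; lra). lra.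
      - assert ((z + / z) ^ (2 * p) <= (2 * z) ^ (2 * p)) by (apply pow_incr; lra). lra. }
    replace (/ x ^ (2 * p) * (INR (Datatypes.S k) ^ (2 * p) * wt x k)) with ((/ z) ^ (2 * p) * wt x k).
    2: { unfold z. replace (/ (x / INR (Datatypes.S k))) with (INR (Datatypes.S k) * / x) by (field; lra).
         rewrite Rpow_mult_distr, pow_inv. ring. }
    apply Rle_trans with (wt x k * (2 * S * (r * (z ^ 2 - 1) ^ 2) + (K + 2 * S) * (4 ^ p * (z ^ (2 * p) + (/ z) ^ (2 * p)) / r))).
    + apply Rmult_le_compat_l; auto. apply Rplus_le_compat_l. apply Rmult_le_compat_l; [lra|].
      apply Rmult_le_compat_r; lra.
    + apply Req_le. field. lra.
  - unfold B. rewrite Series_plus, !Series_scal_l, Series_plus, Series_scal_l by auto.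
    set (i0 := I0 x) in *. assert (Pi : 0 < i0) by apply I0_pos.
    apply Rle_trans with (2 * S * r * (10 * i0 / x) + (K + 2 * S) * 4 ^ p / r * (C2 * i0 + C1 * i0)).
    + apply Rplus_le_compat.
      * apply Rmult_le_compat_l; auto. apply Rmult_le_pos; lra.
      * apply Rmult_le_compat_l; [apply Rmult_le_pos; [apply Rmult_le_pos|]; lra|].
        apply Rplus_le_compat; auto.
        assert (Px : 0 < x ^ (2 * p)) by (apply pow_lt; lra).
        apply Rmult_le_reg_l with (x ^ (2 * p)); auto.
        rewrite <- Rmult_assoc, Rinv_r, Rmult_1_l by lra. eapply Rle_trans; [exact T1b|]. apply Req_le. ring.
    + rewrite <- Hr. unfold A. apply Req_le. field. lra.
Qed.

(** * Recessiveness of the Macdonald function *)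

(* Cauchy-Schwarz: [e^(x/2) = sum (x^k/k!) 2^(-k)]. *)
Lemma I0_ge_exp x : 0 <= x -> 3 / 4 * exp x <= I0 x.
Proof.
  (* The weight in a b <= (l a^2 + b^2 / l)/2, chosen so that the geometric part, of sum 4/3,
     accounts for exactly half of e^(x/2). *)
  intros Hx. set (l := 4 / 3 * exp (- (x / 2))).
  assert (Hl : 0 < l) by (unfold l; assert (X := exp_pos (- (x / 2))); lra).
  assert (Hexp : is_series (fun k => (x / 2) ^ k * / INR (fact k)) (exp (x / 2))).
  { assert (H := is_exp_Reals (x / 2)). apply (proj1 (is_pseries_R _ _ _)) in H. revert H.
    apply is_series_ext. intros k. apply Rmult_comm. }
  assert (Hgeo : is_series (fun k => (/ 4) ^ k) (/ (1 - / 4))).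
  { apply is_series_geom. rewrite Rabs_pos_eq; lra. }
  set (B := fun k => l / 2 * wt x k + / (2 * l) * (/ 4) ^ k).
  assert (E1 : ex_series (fun k => l / 2 * wt x k))
    by (apply (ex_series_scal (K := R_AbsRing) (V := R_NormedModule)), ex_series_wt).
  assert (E2 : ex_series (fun k => / (2 * l) * (/ 4) ^ k))
    by (apply (ex_series_scal (K := R_AbsRing) (V := R_NormedModule)); eexists; exact Hgeo).
  assert (EB : ex_series B) by now apply (ex_series_plus (fun k => l / 2 * wt x k) (fun k => / (2 * l) * (/ 4) ^ k)).
  assert (L : exp (x / 2) <= Series B).
  { rewrite <- (is_series_unique _ _ Hexp). apply Series_le; auto. intros k.
    assert (F := INR_fact_lt_0 k).
    split; [apply Rmult_le_pos; [apply pow_le; lra | left; now apply Rinv_0_lt_compat]|].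
    unfold B, wt. set (a := x ^ k / INR (fact k)). set (b := (/ 2) ^ k).
    replace ((x / 2) ^ k * / INR (fact k)) with (a * b).
    2: { unfold a, b, Rdiv. rewrite Rpow_mult_distr. ring. }
    replace (x ^ (2 * k) / INR (fact k) ^ 2) with (a * a).
    2: { unfold a. rewrite Nat.mul_comm, pow_mult. field. lra. }
    replace ((/ 4) ^ k) with (b * b).
    2: { unfold b. rewrite <- Rpow_mult_distr. f_equal. lra. }
    apply Rmult_le_reg_r with (2 * l); [lra|].
    replace ((l / 2 * (a * a) + / (2 * l) * (b * b)) * (2 * l)) with ((l * a) * (l * a) + b * b) by (field; lra).
    assert (X := Rle_0_sqr (l * a - b)). unfold Rsqr in X. lra. }
  unfold B in L. rewrite Series_plus, !Series_scal_l in L by auto.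
  assert (EG : Series (pow (/ 4)) = / (1 - / 4)) by (apply is_series_unique, Hgeo).
  rewrite EG in L. change (Series (wt x)) with (I0 x) in L.
  assert (Ee : exp (x / 2) * exp (- (x / 2)) = 1) by (rewrite <- exp_plus, Rplus_opp_r; apply exp_0).
  assert (Ex : exp x = exp (x / 2) * exp (x / 2)) by (rewrite <- exp_plus; f_equal; lra).
  assert (P := exp_pos (x / 2)). set (e := exp (x / 2)) in *.
  assert (Hle : l * e = 4 / 3) by (unfold l; rewrite Rmult_assoc, (Rmult_comm _ e), Ee; lra).
  apply Rmult_le_compat_r with (r := e) in L; [|lra].
  replace ((l / 2 * I0 x + / (2 * l) * / (1 - / 4)) * e) with
    (l * e / 2 * I0 x + e * / l * (2 / 3)) in L by (field; lra).
  assert (Hil : / l = 3 / 4 * e).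
  { apply Rmult_eq_reg_l with l; [|lra]. rewrite Rinv_r by lra. lra. }
  rewrite Hle, Hil in L. rewrite Ex. lra.
Qed.

Lemma rGam_INR_S k : rGam (RtoC (INR k) + 1) = (/ RtoC (INR (fact k)))%C.
Proof.
  assert (H := rGam_rising 1 k). rewrite rGam_1, rising_1 in H.
  replace (RtoC (INR k) + 1)%C with (1 + RtoC (INR k))%C by ring.
  assert (N2 := INR_fact_neq_0_C k).
  replace (rGam (1 + RtoC (INR k))) with (RtoC (INR (fact k)) * rGam (1 + RtoC (INR k)) / RtoC (INR (fact k)))%C
    by (field; auto).
  rewrite <- H. field. auto.
Qed.

Lemma bes_0_term y k : (bes 0 k * Cexp ((0 + 2 * RtoC (INR k)) * RtoC y))%C = RtoC (wt (exp y) k).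
Proof.
  unfold bes, wt. rewrite !Cplus_0_l, rGam_INR_S.
  assert (F := INR_fact_lt_0 k). assert (N2 := INR_fact_neq_0_C k).
  rewrite <- !RtoC_mult, Cexp_RtoC.
  replace (2 * INR k * y) with ((2 * y) * INR k) by ring. rewrite exp_INR_mult.
  rewrite pow_mult, RtoC_div by (apply pow_nonzero; lra).
  replace (exp (2 * y)) with (exp y ^ 2) by (simpl; rewrite Rmult_1_r, <- exp_plus; f_equal; ring).
  rewrite (RtoC_pow (INR (fact k)) 2). field. auto.
Qed.

Lemma BI_0 y : BI 0 (RtoC y) = RtoC (I0 (exp y)).
Proof.
  unfold I0. rewrite <- CSeries_RtoC. apply CSeries_ext. intros k. apply bes_0_term.
Qed.

(** Replacing the factors 2 k by 2 for k >= 1 leaves 2 (I0 - 1), and I0 >= 2 as soon as x >= 1. *)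
Lemma Re_BI'_0_ge y : 0 <= y -> I0 (exp y) <= Re (BI' 0 (RtoC y)).
Proof.
  intros Hy. set (x := exp y). assert (Hx : 1 <= x) by (unfold x; rewrite <- exp_0; now apply exp_le).
  assert (Hs := Csummable_re _ (expser_summable 0 (dcoef 0 (bes 0)) (RtoC y) (entire_dcoef 0 _ (entire_bes 0)))).
  assert (E : forall k, Re (dcoef 0 (bes 0) k * Cexp ((0 + 2 * RtoC (INR k)) * RtoC y)) = 2 * INR k * wt x k).
  { intros k. unfold dcoef.
    replace ((0 + 2 * RtoC (INR k)) * bes 0 k * Cexp ((0 + 2 * RtoC (INR k)) * RtoC y))%C with
      (2 * RtoC (INR k) * (bes 0 k * Cexp ((0 + 2 * RtoC (INR k)) * RtoC y)))%C by ring.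
    rewrite bes_0_term, <- !RtoC_mult. reflexivity. }
  assert (Hs' : ex_series (fun k => 2 * INR k * wt x k)) by (revert Hs; apply ex_series_ext; exact E).
  change (Re (BI' 0 (RtoC y))) with (Series (fun k => Re (dcoef 0 (bes 0) k * Cexp ((0 + 2 * RtoC (INR k)) * RtoC y)))).
  rewrite (Series_ext _ _ E).
  apply Rle_trans with (Series (fun k => 2 * wt x k) - 2).
  - rewrite Series_scal_l. fold (I0 x). assert (G := I0_ge x). nra.
  - assert (E2 : ex_series (fun k => 2 * wt x k)) by (apply (ex_series_scal (K := R_AbsRing) (V := R_NormedModule)), ex_series_wt).
    rewrite Series_incr_1, wt_0 by auto. rewrite (Series_incr_1 (fun k => 2 * INR k * wt x k)) by auto.
    simpl (INR 0). apply Rle_trans with (Series (fun k => 2 * wt x (S k))); [lra|].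
    rewrite Rmult_0_r, Rmult_0_l, Rplus_0_l. apply Series_le; [|now apply (ex_series_incr_1 (fun k => 2 * INR k * wt x k))].
    intros k. assert (W := wt_ge_0 x (S k)). assert (P := INR_S_ge_1 k). split; nra.
Qed.

Lemma I0_exp_derive y : is_derive (fun t => I0 (exp t)) y (Re (BI' 0 (RtoC y))).
Proof.
  apply is_derive_ext with (fun t => Re (BI 0 (RtoC t))). { intros t. now rewrite BI_0. }
  apply (Rdiff_is_derive_re (fun t => BI 0 (RtoC t))). apply Cdiff_Rdiff, BI_diff.
Qed.

(** Bounds, uniformly in mu, the constant Wronskian of I_mu and I_{-mu} by its value at y = 0. *)
Lemma BI_bound_0 (S : R) : 0 <= S -> exists B, 0 <= B /\
  forall mu, Cmod mu <= S -> Cmod (BI mu 0) <= B /\ Cmod (BI' mu 0) <= B.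
Proof.
  intros HS. destruct (bes_uniform S HS) as [M [HM HB]].
  assert (HM' := entire_dcoef (RtoC S) M HM).
  assert (S1 : ex_series (fun k => Cmod (M k))).
  { assert (H := HM 1 Rle_0_1). revert H. apply ex_series_ext. intros k. rewrite pow1. apply Rmult_1_r. }
  assert (S2 : ex_series (fun k => Cmod (dcoef (RtoC S) M k))).
  { assert (H := HM' 1 Rle_0_1). revert H. apply ex_series_ext. intros k. rewrite pow1. apply Rmult_1_r. }
  assert (P1 : 0 <= Series (fun k => Cmod (M k))) by (apply Series_ge_0; auto; intros; apply Cmod_ge_0).
  assert (P2 : 0 <= Series (fun k => Cmod (dcoef (RtoC S) M k))) by (apply Series_ge_0; auto; intros; apply Cmod_ge_0).
  exists (Series (fun k => Cmod (M k)) + Series (fun k => Cmod (dcoef (RtoC S) M k))). split; [lra|].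
  intros mu Hmu. split.
  - apply Rle_trans with (Series (fun k => Cmod (M k))); [|lra].
    apply CSeries_mod_le_dom; auto. intros k. rewrite Cmult_0_r, Cexp_0, Cmult_1_r. now apply HB.
  - apply Rle_trans with (Series (fun k => Cmod (dcoef (RtoC S) M k))); [|lra].
    apply CSeries_mod_le_dom; auto. intros k. rewrite Cmult_0_r, Cexp_0, Cmult_1_r.
    unfold dcoef. rewrite !Cmod_mult. apply Rmult_le_compat; auto using Cmod_ge_0.
    eapply Rle_trans; [apply freq_bound|].
    assert (Pk := pos_INR k). rewrite <- RtoC_mult, <- RtoC_plus, Cmod_RtoC_pos; lra.
Qed.

Lemma wronsk_opp_const mu y z : wronsk mu (- mu) y = wronsk mu (- mu) z.
Proof.
  apply Cdiff_zero_const. intros w. eapply Cdiff_eq; [apply wronsk_diff|]. ring.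
Qed.

Lemma LK_bound (S m : R) : 0 <= S -> 0 < m -> exists A y0, 0 <= A /\ 0 <= y0 /\
  forall mu y, Cmod mu <= S -> m <= Cmod (rGam mu) -> m <= Cmod (rGam (- mu)) -> y0 <= y ->
  Cmod (LK mu (RtoC y)) <= A * exp (- exp y).
Proof.
  intros HS Hm. destruct (BI_near_I0 S m HS Hm) as [A [HA HN]].
  destruct (BI_bound_0 S HS) as [B [HB HB0]].
  (* For y beyond this threshold sqrt(e^y) >= 2 A, so |I_mu| lies between I0/2 and 2 I0. The
     constant is 2 times 4 times the bound 2 B^2 of the Wronskian, doubled by I0 >= e^x / 2. *)
  exists (32 * B ^ 2), (ln (1 + 4 * A ^ 2)).
  assert (HB2 : 0 <= B ^ 2) by apply pow2_ge_0. assert (HA2 : 0 <= A ^ 2) by apply pow2_ge_0.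
  assert (Hy0 : 0 <= ln (1 + 4 * A ^ 2)) by (rewrite <- ln_1; apply ln_le; lra).
  split; [lra|]. split; [exact Hy0|].
  intros mu y Hmu Hg Hg' Hy.
  assert (Hbig : forall t, y <= t -> 1 + 4 * A ^ 2 <= exp t).
  { intros t Ht. rewrite <- (exp_ln (1 + 4 * A ^ 2)) by lra. apply exp_le. lra. }
  assert (Hsq : forall t, y <= t -> 0 < sqrt (exp t) /\ 2 * A <= sqrt (exp t)).
  { intros t Ht. assert (Hb := Hbig t Ht). split; [apply sqrt_lt_R0; lra|].
    rewrite <- (sqrt_Rsqr (2 * A)) by lra. apply sqrt_le_1; [apply Rle_0_sqr | lra |]. unfold Rsqr. lra. }
  assert (Near : forall s t, y <= t -> Cmod s <= S -> m <= Cmod (rGam s) ->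
    Cmod (BI s (RtoC t) - RtoC (I0 (exp t))) <= A / sqrt (exp t) * I0 (exp t) /\
    I0 (exp t) / 2 <= Cmod (BI s (RtoC t)) <= 2 * I0 (exp t)).
  { intros s t Ht Hs Hgs. assert (Hb := Hbig t Ht). destruct (Hsq t Ht) as [Q1 Q2].
    assert (N := HN s t Hs Hgs ltac:(lra)). split; auto.
    assert (P := I0_pos (exp t)).
    assert (H12 : A / sqrt (exp t) <= 1 / 2).
    { apply Rmult_le_reg_r with (sqrt (exp t)); auto. unfold Rdiv at 1. rewrite Rmult_assoc, Rinv_l; lra. }
    assert (N' : Cmod (BI s (RtoC t) - RtoC (I0 (exp t))) <= 1 / 2 * I0 (exp t)).
    { eapply Rle_trans; [exact N|]. apply Rmult_le_compat_r; lra. }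
    assert (X := Cmod_triangle_rev (RtoC (I0 (exp t))) (BI s (RtoC t))).
    rewrite (Cmod_sub_comm (RtoC _)), Cmod_RtoC_pos in X by lra.
    assert (Y := Cmod_triangle_rev (BI s (RtoC t)) (RtoC (I0 (exp t)))).
    rewrite Cmod_RtoC_pos in Y by lra. lra. }
  assert (Hmu' : Cmod (- mu) <= S) by now rewrite Cmod_opp.
  set (c := wronsk mu (- mu) 0).
  assert (Hc : Cmod c <= 2 * B ^ 2).
  { unfold c, wronsk. destruct (HB0 mu Hmu) as [b1 b2]. destruct (HB0 (- mu)%C Hmu') as [b3 b4].
    eapply Rle_trans; [apply Cmod_triangle_sub|]. rewrite !Cmod_mult.
    assert (Cmod (BI mu 0) * Cmod (BI' (- mu) 0) <= B * B) by (apply Rmult_le_compat; auto using Cmod_ge_0).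
    assert (Cmod (BI (- mu) 0) * Cmod (BI' mu 0) <= B * B) by (apply Rmult_le_compat; auto using Cmod_ge_0).
    simpl. lra. }
  set (q := fun t => (BI (- mu) (RtoC t) * / BI mu (RtoC t))%C).
  set (Phi := fun t => / (I0 (exp t) * I0 (exp t))).
  assert (Nz : forall t, y <= t -> BI mu (RtoC t) <> 0%C).
  { intros t Ht. destruct (Near mu t Ht Hmu Hg) as [_ [X _]]. apply Cmod_gt_0.
    assert (P := I0_pos (exp t)). lra. }
  assert (Step : forall Y, y <= Y -> Cmod (q Y - q y) <= 4 * Cmod c * Phi y).
  { intros Y HY.
    (* The majorant 8 |c| I0' / I0^3 is the derivative of -4 |c| / I0^2. It dominates |q'| = |c| /
       |I_mu|^2 because |I_mu| >= I0/2 and I0' >= I0. *)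
    assert (M := Rdiff_mean_value q (fun t => c / (BI mu (RtoC t) * BI mu (RtoC t)))%C
      (fun t => - (4 * Cmod c * Phi t))
      (fun t => 4 * Cmod c * (2 * Re (BI' 0 (RtoC t)) / (I0 (exp t) * I0 (exp t) * I0 (exp t)))) y Y HY).
    assert (PY : 0 <= 4 * Cmod c * Phi Y).
    { apply Rmult_le_pos; [assert (X := Cmod_ge_0 c); lra|]. left. apply Rinv_0_lt_compat.
      apply Rmult_lt_0_compat; apply I0_pos. }
    cut (Cmod (q Y - q y) <= - (4 * Cmod c * Phi Y) - - (4 * Cmod c * Phi y)); [lra|].
    apply M.
    - intros t [Ht _]. unfold q.
      apply (Cdiff_Rdiff (fun w => BI (- mu) w * / BI mu w)%C).
      eapply Cdiff_eq.
      + apply (Cdiff_mult (BI (- mu)) (fun w => / BI mu w)%C); [apply BI_diff|].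
        apply (Cdiff_inv (BI mu)); [apply BI_diff | now apply Nz].
      + unfold c. rewrite (wronsk_opp_const mu 0 (RtoC t)). unfold wronsk. field. now apply Nz.
    - intros t [Ht _]. assert (P := I0_pos (exp t)). assert (D := I0_exp_derive t).
      assert (D2 : is_derive (fun u => - (4 * Cmod c * / (u * u))) (I0 (exp t))
        (4 * Cmod c * (2 / (I0 (exp t) * I0 (exp t) * I0 (exp t))))).
      { auto_derive; [nra | field; lra]. }
      assert (K := is_derive_comp (fun u => - (4 * Cmod c * / (u * u))) (fun t => I0 (exp t)) t _ _ D2 D).
      replace (4 * Cmod c * (2 * Re (BI' 0 (RtoC t)) / (I0 (exp t) * I0 (exp t) * I0 (exp t)))) with
        (scal (Re (BI' 0 (RtoC t))) (4 * Cmod c * (2 / (I0 (exp t) * I0 (exp t) * I0 (exp t))))).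
      + exact K.
      + unfold scal; simpl. unfold mult; simpl. field. lra.
    - intros t [Ht _]. assert (P := I0_pos (exp t)).
      destruct (Near mu t Ht Hmu Hg) as [_ [X _]].
      rewrite Cmod_div by (apply Cmult_neq_0; now apply Nz). rewrite Cmod_mult.
      assert (G := Re_BI'_0_ge t ltac:(lra)). assert (Pc := Cmod_ge_0 c).
      set (i := I0 (exp t)) in *. set (b := Cmod (BI mu (RtoC t))) in *.
      apply Rle_trans with (Cmod c * / (i / 2 * (i / 2))).
      { apply Rmult_le_compat_l; auto. apply Rinv_le_contravar; [apply Rmult_lt_0_compat; lra|].
        apply Rmult_le_compat; lra. }
      replace (Cmod c * / (i / 2 * (i / 2))) with (4 * Cmod c * (i / (i * i * i))) by (field; lra).
      apply Rmult_le_compat_l; [lra|]. unfold Rdiv. apply Rmult_le_compat_r; [|lra].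
      left. apply Rinv_0_lt_compat. repeat apply Rmult_lt_0_compat; auto. }
  assert (Lim : Cmod (1 - q y) <= 4 * Cmod c * Phi y).
  { apply Rnot_lt_le. intros N. set (e := Cmod (1 - q y) - 4 * Cmod c * Phi y) in *.
    assert (He : 0 < e) by (unfold e; lra).
    (* Ensures 4 A / sqrt(e^Y) < e, where the left side bounds |1 - q Y|: each numerator error is A
       I0 / sqrt(e^Y) and the denominator is at least I0/2. *)
    set (Y := Rmax y (2 * ln (1 + 4 * A / e))).
    assert (HY : y <= Y) by apply Rmax_l.
    assert (St := Step Y HY).
    assert (Hae : 0 <= 4 * A / e) by (apply Rmult_le_pos; [lra | left; now apply Rinv_0_lt_compat]).
    destruct (Hsq Y HY) as [Q1 _]. destruct (Near mu Y HY Hmu Hg) as [N1 [N2 _]].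
    destruct (Near (- mu)%C Y HY Hmu' Hg') as [N3 _]. assert (P := I0_pos (exp Y)).
    assert (Qe : 4 * A / e < sqrt (exp Y)).
    { assert (exp (ln (1 + 4 * A / e)) <= sqrt (exp Y)).
      - rewrite <- (sqrt_Rsqr (exp (ln _))) by (left; apply exp_pos).
        apply sqrt_le_1; [apply Rle_0_sqr | left; apply exp_pos |].
        unfold Rsqr. rewrite <- exp_plus. apply exp_le.
        apply Rle_trans with (2 * ln (1 + 4 * A / e)); [lra | apply Rmax_r].
      - rewrite exp_ln in H; lra. }
    assert (Hq : Cmod (1 - q Y) < e).
    { unfold q. replace (1 - BI (- mu) (RtoC Y) * / BI mu (RtoC Y))%C with
        ((BI mu (RtoC Y) - BI (- mu) (RtoC Y)) / BI mu (RtoC Y))%C by (field; now apply Nz).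
      rewrite Cmod_div by now apply Nz.
      replace (BI mu (RtoC Y) - BI (- mu) (RtoC Y))%C with
        ((BI mu (RtoC Y) - RtoC (I0 (exp Y))) - (BI (- mu) (RtoC Y) - RtoC (I0 (exp Y))))%C by ring.
      assert (T := Cmod_triangle_sub (BI mu (RtoC Y) - RtoC (I0 (exp Y))) (BI (- mu) (RtoC Y) - RtoC (I0 (exp Y)))).
      apply Rle_lt_trans with (2 * (A / sqrt (exp Y) * I0 (exp Y)) * / (I0 (exp Y) / 2)).
      - apply Rmult_le_compat; [apply Cmod_ge_0 | left; apply Rinv_0_lt_compat; lra | lra |].
        apply Rinv_le_contravar; lra.
      - replace (2 * (A / sqrt (exp Y) * I0 (exp Y)) * / (I0 (exp Y) / 2)) with (4 * A / sqrt (exp Y)) by (field; lra).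
        apply Rmult_lt_reg_r with (sqrt (exp Y)); auto. unfold Rdiv. rewrite Rmult_assoc, Rinv_l, Rmult_1_r by lra.
        apply Rmult_lt_compat_l with (r := e) in Qe; auto.
        replace (e * (4 * A / e)) with (4 * A) in Qe by (field; lra). exact Qe. }
    assert (T := Cmod_triangle (1 - q Y) (q Y - q y)).
    replace (1 - q Y + (q Y - q y))%C with (1 - q y)%C in T by ring. unfold e in Hq. lra. }
  destruct (Near mu y (Rle_refl y) Hmu Hg) as [_ [_ X2]].
  assert (P := I0_pos (exp y)). assert (Pe := exp_pos y).
  replace (LK mu (RtoC y)) with (- (BI mu (RtoC y) * (1 - q y)))%C.
  2: { unfold LK, q. field. apply Nz. lra. }
  rewrite Cmod_opp, Cmod_mult.
  apply Rle_trans with (2 * I0 (exp y) * (4 * (2 * B ^ 2) * Phi y)).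
  { apply Rmult_le_compat; auto using Cmod_ge_0. eapply Rle_trans; [exact Lim|].
    apply Rmult_le_compat_r; [|lra]. left. apply Rinv_0_lt_compat. now apply Rmult_lt_0_compat. }
  unfold Phi. replace (2 * I0 (exp y) * (4 * (2 * B ^ 2) * / (I0 (exp y) * I0 (exp y)))) with
    (16 * B ^ 2 * / I0 (exp y)) by (field; lra).
  replace (32 * B ^ 2 * exp (- exp y)) with (16 * B ^ 2 * (2 * exp (- exp y))) by ring.
  apply Rmult_le_compat_l; [lra|].
  assert (G := I0_ge_exp (exp y) (Rlt_le _ _ Pe)). assert (P2 := exp_pos (exp y)).
  rewrite exp_Ropp. replace (2 * / exp (exp y)) with (/ (exp (exp y) / 2)) by (field; lra).
  apply Rinv_le_contravar; lra.
Qed.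

Lemma Rdiff_increment (f f' : R -> C) (M a b : R) : a <= b ->
  (forall s, a <= s <= b -> Rdiff f s (f' s)) -> (forall s, a <= s <= b -> Cmod (f' s) <= M) ->
  Cmod (f b - f a) <= M * (b - a).
Proof.
  intros Hab Hf Hb. replace (M * (b - a)) with (M * b - M * a) by ring.
  apply (Rdiff_mean_value f f' (fun t => M * t) (fun _ => M)); auto.
  intros s _. auto_derive; auto. ring.
Qed.

Lemma Cmod_Cexp_2RtoC s : Cmod (Cexp (2 * RtoC s)) = exp s * exp s.
Proof.
  rewrite <- RtoC_mult, Cexp_RtoC, Cmod_RtoC_pos by (left; apply exp_pos).
  rewrite <- exp_plus. f_equal. ring.
Qed.

(* A function and its second derivative control the first derivative. *)
Lemma LK'_bound (S m : R) : 0 <= S -> 0 < m -> exists A y0, 0 <= A /\ 0 <= y0 /\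
  forall mu y, Cmod mu <= S -> m <= Cmod (rGam mu) -> m <= Cmod (rGam (- mu)) -> y0 <= y ->
  Cmod (LK mu (RtoC y)) <= A * exp (- exp y) /\
  Cmod (LK' mu (RtoC y)) <= A * (1 + exp y ^ 2) * exp (- exp y).
Proof.
  intros HS Hm. destruct (LK_bound S m HS Hm) as [A [y0 [HA [Hy0 HB]]]].
  (* D (1 + e^(2y)) bounds the coefficient 4 e^(2s) + mu^2 of the differential equation on
     [y, y + 1]; the factor e^2 comes from the unit length of the interval. *)
  set (D := 4 * (exp 1 * exp 1) + S ^ 2). assert (e1 := exp_pos 1).
  assert (HD : 0 <= D) by (unfold D; assert (X := pow2_ge_0 S); nra).
  assert (HAD : 0 <= A * (2 + D)) by (apply Rmult_le_pos; lra).
  exists (A + A * (2 + D)), y0. split; [lra|]. split; auto.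
  intros mu y Hmu Hg Hg' Hy. assert (Pe := exp_pos (- exp y)).
  assert (B : forall s, y <= s -> Cmod (LK mu (RtoC s)) <= A * exp (- exp y)).
  { intros s Hs. eapply Rle_trans; [apply HB; auto; lra|]. apply Rmult_le_compat_l; auto.
    apply exp_le. assert (exp y <= exp s) by now apply exp_le. lra. }
  assert (HAe : 0 <= A * exp (- exp y)) by (apply Rmult_le_pos; lra).
  assert (HDe : 0 <= A * D * exp (- exp y)) by (apply Rmult_le_pos; [apply Rmult_le_pos|]; lra).
  split.
  { eapply Rle_trans; [now apply B|]. apply Rmult_le_compat_r; lra. }
  set (M := D * (1 + exp y ^ 2) * (A * exp (- exp y))).
  assert (P2 := pow2_ge_0 (exp y)).
  assert (HM : 0 <= M) by (unfold M; apply Rmult_le_pos; auto; apply Rmult_le_pos; lra).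
  assert (B2 : forall s, y <= s <= y + 1 -> Cmod ((4 * Cexp (2 * RtoC s) + mu ^ 2) * LK mu (RtoC s)) <= M).
  { intros s Hs. rewrite Cmod_mult. apply Rmult_le_compat; auto using Cmod_ge_0; [|apply B; lra].
    eapply Rle_trans; [apply Cmod_triangle|].
    rewrite Cmod_mult, Cmod_pow, Cmod_Cexp_2RtoC, Cmod_RtoC_pos by lra.
    assert (Es : exp s <= exp y * exp 1) by (rewrite <- exp_plus; apply exp_le; lra).
    assert (Ps := exp_pos s). assert (Py := exp_pos y).
    assert (exp s * exp s <= (exp y * exp 1) * (exp y * exp 1)) by (apply Rmult_le_compat; lra).
    assert (Cmod mu ^ 2 <= S ^ 2) by (apply pow_incr; auto using Cmod_ge_0).
    assert (0 <= S ^ 2 * exp y ^ 2) by (apply Rmult_le_pos; auto; apply pow2_ge_0).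
    assert (0 <= 4 * (exp 1 * exp 1)) by nra.
    unfold D. replace ((4 * (exp 1 * exp 1) + S ^ 2) * (1 + exp y ^ 2)) with
      (4 * (exp 1 * exp 1) + 4 * ((exp y * exp 1) * (exp y * exp 1)) + S ^ 2 + S ^ 2 * exp y ^ 2) by ring.
    lra. }
  assert (Inc : forall s, y <= s <= y + 1 -> Cmod (LK' mu (RtoC s) - LK' mu (RtoC y)) <= M).
  { intros s Hs. apply Rle_trans with (M * (s - y)); [|nra].
    apply (Rdiff_increment (fun t => LK' mu (RtoC t)) (fun t => (4 * Cexp (2 * RtoC t) + mu ^ 2) * LK mu (RtoC t))%C); [lra | |].
    - intros t _. apply (Cdiff_Rdiff (LK' mu)), LK'_diff.
    - intros t Ht. apply B2. lra. }
  (* Subtracting the tangent leaves a function whose derivative is the increment of [LK'], already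
     bounded by [M]; its increment over the unit interval therefore isolates [LK'] at y. *)
  assert (Inc2 := Rdiff_increment (fun t => LK mu (RtoC t) - LK' mu (RtoC y) * RtoC t)%C
    (fun t => LK' mu (RtoC t) - LK' mu (RtoC y))%C M y (y + 1) ltac:(lra)).
  cbv beta in Inc2. replace (M * (y + 1 - y)) with M in Inc2 by ring.
  assert (I : Cmod (LK mu (RtoC (y + 1)) - LK' mu (RtoC y) * RtoC (y + 1) - (LK mu (RtoC y) - LK' mu (RtoC y) * RtoC y)) <= M).
  { apply Inc2; auto. intros t _. apply Rdiff_minus.
    - apply (Cdiff_Rdiff (LK mu)), LK_diff.
    - apply Rdiff_ext with (fun t => LK' mu (RtoC y) * RtoC t + 0)%C; [intros; ring|].
      apply (Cdiff_Rdiff (fun w => LK' mu (RtoC y) * w + 0)%C), Cdiff_affine. }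
  replace (LK mu (RtoC (y + 1)) - LK' mu (RtoC y) * RtoC (y + 1) - (LK mu (RtoC y) - LK' mu (RtoC y) * RtoC y))%C
    with ((LK mu (RtoC (y + 1)) - LK mu (RtoC y)) - LK' mu (RtoC y))%C in I by (rewrite RtoC_plus; ring).
  rewrite Cmod_sub_comm in I.
  assert (T := Cmod_triangle_rev (LK' mu (RtoC y)) (LK mu (RtoC (y + 1)) - LK mu (RtoC y))).
  assert (T2 := Cmod_triangle_sub (LK mu (RtoC (y + 1))) (LK mu (RtoC y))).
  assert (T3 := B (y + 1) ltac:(lra)). assert (T4 := B y ltac:(lra)).
  apply Rle_trans with (2 * (A * exp (- exp y)) + M); [lra|].
  unfold M. replace ((A + A * (2 + D)) * (1 + exp y ^ 2) * exp (- exp y)) with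
    (A * exp (- exp y) * (1 + exp y ^ 2) + 2 * (A * exp (- exp y)) + 2 * (A * exp (- exp y)) * exp y ^ 2
      + D * (1 + exp y ^ 2) * (A * exp (- exp y))) by ring.
  assert (0 <= A * exp (- exp y) * (1 + exp y ^ 2)) by (apply Rmult_le_pos; lra).
  assert (0 <= 2 * (A * exp (- exp y)) * exp y ^ 2) by (apply Rmult_le_pos; lra). lra.
Qed.

(** Fourth power of 1 + x <= 8 e^(x/8); 4096 is 8^4. *)
Lemma exp_quad_bound (x : R) : 0 <= x -> (1 + x ^ 2) ^ 2 <= 4096 * exp (x / 2).
Proof.
  intros Hx. assert (H := exp_ge_1_plus (x / 8)). assert (P := exp_pos (x / 8)).
  assert (E : 1 + x <= 8 * exp (x / 8)) by lra.
  assert (F : (1 + x) ^ 4 <= (8 * exp (x / 8)) ^ 4) by (apply pow_incr; lra).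
  rewrite Rpow_mult_distr, <- exp_INR_mult in F.
  replace (x / 8 * INR 4) with (x / 2) in F by (simpl; field).
  replace (8 ^ 4) with 4096 in F by ring.
  apply Rle_trans with (2 := F). replace ((1 + x) ^ 4) with (((1 + x) ^ 2) ^ 2) by ring.
  apply pow_incr. assert (X := pow2_ge_0 x). split; nra.
Qed.

(** Supplies the lower bound m with which one set of constants of [LK'_bound] serves nu and all mu
    near nu. *)
Lemma uniform_rGam_near nu : rGam nu <> 0%C -> rGam (- nu) <> 0%C -> exists m, 0 < m /\
  @locally' C_UniformSpace nu (fun mu => m <= Cmod (rGam mu) /\ m <= Cmod (rGam (- mu)) /\ Cmod mu <= Cmod nu + 1) /\
  m <= Cmod (rGam nu) /\ m <= Cmod (rGam (- nu)).
Proof.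
  intros H1 H2. assert (P1 := proj1 (Cmod_gt_0 _) H1). assert (P2 := proj1 (Cmod_gt_0 _) H2).
  exists (Rmin (Cmod (rGam nu) / 2) (Cmod (rGam (- nu)) / 2)).
  assert (M1 := Rmin_l (Cmod (rGam nu) / 2) (Cmod (rGam (- nu)) / 2)).
  assert (M2 := Rmin_r (Cmod (rGam nu) / 2) (Cmod (rGam (- nu)) / 2)).
  split; [apply Rmin_pos; lra|]. split; [|split; lra].
  assert (Id := Clim_id_locally' nu). assert (Op := Clim_opp _ _ Id). cbv beta in Op.
  assert (G1 := Clim_rGam _ _ _ Id). assert (G2 := Clim_rGam _ _ _ Op). cbv beta in G1, G2.
  generalize (filter_and _ _ (Clim_nonzero _ _ G1 H1) (filter_and _ _ (Clim_nonzero _ _ G2 H2) (Clim_bounded _ _ Id))).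
  apply filter_imp. intros mu [A1 [A2 A3]]. repeat split; lra.
Qed.

Lemma exp_neg_exp_le y : 0 <= y -> exp (- exp y) <= exp (- y).
Proof. intros H. apply exp_le. assert (X := exp_ge_1_plus y). lra. Qed.

Lemma exp_neg_small (C e : R) : 0 <= C -> 0 < e -> exists y0, 0 <= y0 /\ forall y, y0 <= y -> C * exp (- y) < e.
Proof.
  intros HC He. assert (Hce : 0 <= C / e) by (apply Rmult_le_pos; [lra | left; now apply Rinv_0_lt_compat]).
  exists (C / e). split; auto. intros y Hy.
  assert (X := exp_ge_1_plus y). assert (P := exp_pos y). rewrite exp_Ropp.
  apply Rmult_lt_reg_r with (exp y); auto. rewrite Rmult_assoc, Rinv_l, Rmult_1_r by lra.
  apply Rle_lt_trans with (e * y); [|nra].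
  apply Rmult_le_compat_l with (r := e) in Hy; [|lra]. replace (e * (C / e)) with C in Hy by (field; lra). exact Hy.
Qed.

(** For mu <> nu the increments of [LKprim2] are bounded by integrating A^2 e^(-2t), uniformly in
    mu, while its limit at +oo is 0 by the Wronskian, not uniformly. The resulting bound no longer
    contains nu^2 - mu^2 and passes to mu = nu. *)
Lemma LKprim_decay_real nu : rGam nu <> 0%C -> rGam (- nu) <> 0%C -> nonperiodic (2 * nu) ->
  exists A y0, 0 <= A /\ 0 <= y0 /\ forall y, y0 <= y -> Cmod (LKprim nu (RtoC y)) <= A * exp (- (2 * y)).
Proof.
  intros H1 H2 Hn. destruct (uniform_rGam_near nu H1 H2) as [m [Hm [Hl [Hnu1 Hnu2]]]].
  set (S := Cmod nu + 1). assert (HS : 0 <= S) by (unfold S; assert (X := Cmod_ge_0 nu); lra).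
  destruct (LK'_bound S m HS Hm) as [A [y0 [HA [Hy0 HB]]]].
  exists (A * A / 2), y0. split; [nra|]. split; auto. intros y Hy.
  apply (Clim_mod_le (@locally' C_UniformSpace nu) (fun mu => LKprim2 mu nu (RtoC y))); [now apply LKprim_lim|].
  assert (N1 : @locally' C_UniformSpace nu (fun mu => nonperiodic (mu + nu))).
  { apply (nonperiodic_near (2 * nu) Hn (fun mu => mu + nu)%C); [ring|].
    exists 1%C. apply Cdiff_ext with (fun mu => 1 * mu + nu)%C; [intros; ring | apply Cdiff_affine]. }
  generalize (filter_and _ _ Hl (filter_and _ _ N1 (nonperiodic_diff_near nu))).
  apply filter_imp. intros mu [[G1 [G2 G3]] [Np Nm]].
  assert (Hnu : Cmod nu <= S) by (unfold S; lra).
  assert (Dq : forall s, Cdiff (LKprim2 mu nu) s (LK mu s * LK nu s)) by (intros s; now apply LKprim2_diff).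
  assert (Inc : forall Y, y <= Y -> Cmod (LKprim2 mu nu (RtoC Y) - LKprim2 mu nu (RtoC y)) <= A * A / 2 * exp (- (2 * y))).
  { intros Y HY.
    assert (M := Rdiff_mean_value (fun t => LKprim2 mu nu (RtoC t)) (fun t => LK mu (RtoC t) * LK nu (RtoC t))%C
      (fun t => - (A * A / 2 * exp (- (2 * t)))) (fun t => A * A * exp (- (2 * t))) y Y HY).
    assert (PY := exp_pos (- (2 * Y))).
    assert (0 <= A * A / 2 * exp (- (2 * Y))) by (apply Rmult_le_pos; nra).
    cut (Cmod (LKprim2 mu nu (RtoC Y) - LKprim2 mu nu (RtoC y)) <= - (A * A / 2 * exp (- (2 * Y))) - - (A * A / 2 * exp (- (2 * y)))); [lra|].
    apply M.
    - intros t _. apply (Cdiff_Rdiff (LKprim2 mu nu)), Dq.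
    - intros t _. auto_derive; auto. field.
    - intros t [Ht _]. rewrite Cmod_mult.
      destruct (HB mu t G3 G1 G2 ltac:(lra)) as [B1 _]. destruct (HB nu t Hnu Hnu1 Hnu2 ltac:(lra)) as [B2 _].
      assert (E := exp_neg_exp_le t ltac:(lra)). assert (Pe := exp_pos (- exp t)).
      replace (A * A * exp (- (2 * t))) with ((A * exp (- t)) * (A * exp (- t))).
      2: { replace (- (2 * t)) with (- t + - t) by ring. rewrite exp_plus. ring. }
      apply Rmult_le_compat; auto using Cmod_ge_0;
        (eapply Rle_trans; [eassumption | apply Rmult_le_compat_l; auto]). }
  assert (N0 : (nu ^ 2 - mu ^ 2)%C <> 0%C).
  { replace (nu ^ 2 - mu ^ 2)%C with (- ((mu + nu) * (mu - nu)))%C by ring.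
    assert (F1 := nonperiodic_freq _ Np O). assert (F2 := nonperiodic_freq _ Nm O). simpl INR in F1, F2.
    rewrite Cmult_0_r, Cplus_0_r in F1, F2. intros E. apply (Cmult_neq_0 _ _ F1 F2).
    replace ((mu + nu) * (mu - nu))%C with (- - ((mu + nu) * (mu - nu)))%C by ring. rewrite E. ring. }
  assert (Pd := proj1 (Cmod_gt_0 _) N0). set (d := Cmod (nu ^ 2 - mu ^ 2)) in *.
  apply Rnot_lt_le. intros Hlt.
  set (e := Cmod (LKprim2 mu nu (RtoC y)) - A * A / 2 * exp (- (2 * y))) in *.
  assert (He : 0 < e) by (unfold e; lra).
  (* Each of the two products in the Wronskian is at most 4096 A^2 e^(-Y), since (1 + x^2) e^(-x) <=
     4096 and e^(-x) <= e^(-Y) for x = e^Y. *)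
  destruct (exp_neg_small (8192 * (A * A) / d) e) as [y1 [Hy1 Hsm]]; auto.
  { apply Rmult_le_pos; [nra | left; now apply Rinv_0_lt_compat]. }
  set (Y := Rmax y y1). assert (HY1 : y <= Y) by apply Rmax_l. assert (HY2 : y1 <= Y) by apply Rmax_r.
  assert (In := Inc Y HY1).
  assert (Wr := LKprim2_wronsk mu nu (RtoC Y) Np Nm).
  destruct (HB mu Y G3 G1 G2 ltac:(lra)) as [B1 B1']. destruct (HB nu Y Hnu Hnu1 Hnu2 ltac:(lra)) as [B2 B2'].
  assert (Q : Cmod (LKprim2 mu nu (RtoC Y)) < e).
  { apply Rmult_lt_reg_l with d; auto. unfold d. rewrite <- Cmod_mult, Wr.
    eapply Rle_lt_trans; [apply Cmod_triangle_sub|]. rewrite !Cmod_mult. fold d.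
    set (x := exp Y) in *. assert (Hx : 0 < x) by apply exp_pos. assert (Pe := exp_pos (- x)).
    assert (Px := pow2_ge_0 x).
    assert (L1 : Cmod (LK mu (RtoC Y)) * Cmod (LK' nu (RtoC Y)) <= A * exp (- x) * (A * (1 + x ^ 2) * exp (- x)))
      by (apply Rmult_le_compat; auto using Cmod_ge_0).
    assert (L2 : Cmod (LK nu (RtoC Y)) * Cmod (LK' mu (RtoC Y)) <= A * exp (- x) * (A * (1 + x ^ 2) * exp (- x)))
      by (apply Rmult_le_compat; auto using Cmod_ge_0).
    assert (U : (1 + x ^ 2) * exp (- x) <= 4096).
    { assert (X := exp_quad_bound x ltac:(lra)).
      apply Rle_trans with ((1 + x ^ 2) ^ 2 * exp (- x)); [apply Rmult_le_compat_r; nra|].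
      apply Rle_trans with (4096 * exp (x / 2) * exp (- x)); [apply Rmult_le_compat_r; lra|].
      rewrite Rmult_assoc, <- exp_plus. rewrite <- (Rmult_1_r 4096) at 2. apply Rmult_le_compat_l; [lra|].
      rewrite <- exp_0. apply exp_le. lra. }
    assert (V := exp_neg_exp_le Y ltac:(lra)). fold x in V.
    apply Rle_lt_trans with (8192 * (A * A) * exp (- Y)).
    - apply Rle_trans with (2 * (A * A) * (exp (- x) * ((1 + x ^ 2) * exp (- x)))); [lra|].
      replace (8192 * (A * A) * exp (- Y)) with (2 * (A * A) * (exp (- Y) * 4096)) by ring.
      apply Rmult_le_compat_l; [nra|]. apply Rmult_le_compat; try lra. apply Rmult_le_pos; lra.
    - assert (Sm := Hsm Y HY2). apply Rmult_lt_compat_l with (r := d) in Sm; auto.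
      replace (d * (8192 * (A * A) / d * exp (- Y))) with (8192 * (A * A) * exp (- Y)) in Sm by (field; lra). exact Sm. }
  assert (T := Cmod_triangle_sub (LKprim2 mu nu (RtoC Y)) (LKprim2 mu nu (RtoC Y) - LKprim2 mu nu (RtoC y))).
  replace (LKprim2 mu nu (RtoC Y) - (LKprim2 mu nu (RtoC Y) - LKprim2 mu nu (RtoC y)))%C with (LKprim2 mu nu (RtoC y)) in T by ring.
  unfold e in Q. lra.
Qed.

(** * Extension of the decay from the positive axis to a sector *)

Lemma dot_le (a b : C) : Re a * Re b + Im a * Im b <= Cmod a * Cmod b.
Proof.
  assert (H := Rle_trans _ _ _ (Rle_abs _) (re_le_Cmod (a * Cconj b))).
  rewrite Cmod_mult, Cmod_conj, re_mult, re_conj, im_conj in H. lra.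
Qed.

Lemma sq_norm_derive f s l : Rdiff f s l ->
  is_derive (fun t => Re (f t) * Re (f t) + Im (f t) * Im (f t)) s (2 * (Re (f s) * Re l + Im (f s) * Im l)).
Proof.
  intros H. assert (H1 := Rdiff_is_derive_re _ _ _ H). assert (H2 := Rdiff_is_derive_im _ _ _ H).
  assert (K : forall g x, is_derive g s x -> is_derive (fun t => g t * g t) s (2 * (g s * x))).
  { intros g x Hg. replace (2 * (g s * x)) with (x * g s + g s * x) by ring.
    apply (is_derive_mult g g s x x); auto. intros; apply Rmult_comm. }
  replace (2 * (Re (f s) * Re l + Im (f s) * Im l)) with (2 * (Re (f s) * Re l) + 2 * (Im (f s) * Im l)) by ring.
  apply (is_derive_plus (fun t => Re (f t) * Re (f t)) (fun t => Im (f t) * Im (f t))).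
  - now apply (K (fun t => Re (f t))).
  - now apply (K (fun t => Im (f t))).
Qed.

Lemma Cmod_sq z : Re z * Re z + Im z * Im z = Cmod z * Cmod z.
Proof. assert (H := Cmod2_alt z). lra. Qed.

Lemma gronwall (E E' : R -> R) (lam : R) :
  (forall s, 0 <= s <= 1 -> is_derive E s (E' s)) -> (forall s, 0 <= s <= 1 -> E' s <= lam * E s) ->
  forall s, 0 <= s <= 1 -> E s <= E 0 * exp (lam * s).
Proof.
  intros HE Hb s Hs.
  assert (N := nondecreasing_derive (fun t => - (E t * exp (- (lam * t))))
    (fun t => (lam * E t - E' t) * exp (- (lam * t))) 0 s (proj1 Hs)).
  cbv beta in N. rewrite Rmult_0_r, Ropp_0, exp_0 in N.
  assert (K : - (E 0 * 1) <= - (E s * exp (- (lam * s)))).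
  { apply N.
    - intros t Ht. assert (Ht' : 0 <= t <= 1) by lra.
      assert (D2 : is_derive (fun t => exp (- (lam * t))) t (- lam * exp (- (lam * t)))).
      { auto_derive; auto. ring. }
      assert (D := is_derive_opp _ _ _ (is_derive_mult E (fun t => exp (- (lam * t))) t _ _ (HE t Ht') D2 Rmult_comm)).
      replace ((lam * E t - E' t) * exp (- (lam * t))) with
        (opp (plus (mult (E' t) (exp (- (lam * t)))) (mult (E t) (- lam * exp (- (lam * t)))))).
      + exact D.
      + unfold opp, plus, mult; simpl. ring.
    - intros t Ht. apply Rmult_le_pos; [|left; apply exp_pos]. assert (X := Hb t ltac:(lra)). lra. }
  assert (P := exp_pos (lam * s)).
  assert (Ee : exp (- (lam * s)) * exp (lam * s) = 1) by (rewrite <- exp_plus, Rplus_opp_l; apply exp_0).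
  apply Rmult_le_compat_r with (r := exp (lam * s)) in K; [|lra].
  replace (- (E s * exp (- (lam * s))) * exp (lam * s)) with (- (E s * (exp (- (lam * s)) * exp (lam * s)))) in K by ring.
  rewrite Ee in K. lra.
Qed.

(* Along the arc [s -> y + i th s] of modulus [x = e^y], the energy
   [4 x^2 |K|^2 + |K'|^2] grows at most like [exp (4 x |th|)], which for small
   [th] does not destroy the decay known on the positive axis. *)
Lemma LK_arc_bound nu : rGam nu <> 0%C -> rGam (- nu) <> 0%C -> exists A y0, 0 <= A /\ 0 <= y0 /\
  forall y th, y0 <= y -> Rabs th <= 1 / 4 ->
  Cmod (LK nu (RtoC y + Ci * RtoC th)) ^ 2 <= A * exp (- (y / 2)).
Proof.
  intros H1 H2.
  set (m := Rmin (Cmod (rGam nu)) (Cmod (rGam (- nu)))).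
  assert (Hm : 0 < m) by (apply Rmin_pos; now apply Cmod_gt_0).
  destruct (LK'_bound (Cmod nu) m (Cmod_ge_0 nu) Hm) as [A [y0 [HA [Hy0 HB]]]].
  set (n2 := Cmod nu ^ 2). assert (Hn2 : 0 <= n2) by apply pow2_ge_0.
  assert (Pn := exp_pos n2). assert (HA2 := pow2_ge_0 A).
  (* 5 from 4 x^2 + (1 + x^2)^2 <= 5 (1 + x^2)^2, 4096 from [exp_quad_bound], e^(|nu|^2) from the
     term nu^2 of the equation. With |th| <= 1/4 the growth is e^x, which against e^(-2x) and the
     e^(x/2) of the polynomial leaves e^(-x/2). *)
  exists (5 * A ^ 2 * exp n2 * 4096), y0.
  split; [repeat apply Rmult_le_pos; lra|]. split; auto. intros y th Hy Hth.
  destruct (HB nu y (Rle_refl _) (Rmin_l _ _) (Rmin_r _ _) Hy) as [B1 B2].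
  set (x := exp y) in *. assert (Hx : 1 <= x) by (unfold x; rewrite <- exp_0; apply exp_le; lra).
  set (H := fun s => LK nu (Ci * RtoC th * RtoC s + RtoC y)).
  set (G := fun s => LK' nu (Ci * RtoC th * RtoC s + RtoC y)).
  set (W := fun s => (4 * Cexp (2 * (Ci * RtoC th * RtoC s + RtoC y)) + nu ^ 2)%C).
  set (E := fun s => 4 * x ^ 2 * (Re (H s) * Re (H s) + Im (H s) * Im (H s)) + (Re (G s) * Re (G s) + Im (G s) * Im (G s))).
  set (E' := fun s => 4 * x ^ 2 * (2 * (Re (H s) * Re (G s * (Ci * RtoC th)) + Im (H s) * Im (G s * (Ci * RtoC th))))
    + 2 * (Re (G s) * Re (W s * H s * (Ci * RtoC th)) + Im (G s) * Im (W s * H s * (Ci * RtoC th)))).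
  assert (HW : forall s, Cmod (W s) <= 4 * x ^ 2 + n2).
  { intros s. unfold W. eapply Rle_trans; [apply Cmod_triangle|].
    rewrite Cmod_mult, Cmod_pow, Cmod_Cexp, Cmod_RtoC_pos by lra.
    apply Rplus_le_compat_r. apply Rmult_le_compat_l; [lra|]. apply Req_le.
    unfold x. simpl. rewrite Rmult_1_r, <- exp_plus. f_equal. ring. }
  assert (Hi : Cmod (Ci * RtoC th) = Rabs th) by (rewrite Cmod_mult, Cmod_Ci, Cmod_R; ring).
  assert (Gr : E 1 <= E 0 * exp (Rabs th * (4 * x + n2) * 1)).
  { apply (gronwall E E'); [| | lra].
    - intros s _. unfold E, E'.
      apply (is_derive_plus (fun s => 4 * x ^ 2 * (Re (H s) * Re (H s) + Im (H s) * Im (H s)))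
        (fun s => Re (G s) * Re (G s) + Im (G s) * Im (G s))).
      + apply (is_derive_scal (fun s => Re (H s) * Re (H s) + Im (H s) * Im (H s))).
        apply sq_norm_derive. apply (Cdiff_Rdiff_line (LK nu)), LK_diff.
      + apply sq_norm_derive. apply (Cdiff_Rdiff_line (LK' nu)), LK'_diff.
    - intros s _. unfold E', E. rewrite !Cmod_sq.
      assert (D1 := dot_le (H s) (G s * (Ci * RtoC th))). assert (D2 := dot_le (G s) (W s * H s * (Ci * RtoC th))).
      rewrite Cmod_mult, Hi in D1. rewrite (Cmod_mult (W s * H s)), Hi, (Cmod_mult (W s)) in D2.
      set (h := Cmod (H s)) in *. set (g := Cmod (G s)) in *. set (w := Cmod (W s)) in *.
      assert (Ph : 0 <= h) by apply Cmod_ge_0. assert (Pg : 0 <= g) by apply Cmod_ge_0.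
      assert (Pt := Rabs_pos th). set (t := Rabs th) in *.
      assert (Hw : w <= 4 * x ^ 2 + n2) by apply HW.
      assert (Phg : 0 <= h * g * t) by (apply Rmult_le_pos; auto; apply Rmult_le_pos; auto).
      assert (D2' : g * (w * h * t) <= h * g * t * (4 * x ^ 2 + n2)).
      { replace (g * (w * h * t)) with (h * g * t * w) by ring. apply Rmult_le_compat_l; auto. }
      assert (Px2 := pow2_ge_0 x).
      assert (D1' : 4 * x ^ 2 * (2 * (Re (H s) * Re (G s * (Ci * RtoC th)) + Im (H s) * Im (G s * (Ci * RtoC th))))
         <= 4 * x ^ 2 * (2 * (h * (g * t)))) by (apply Rmult_le_compat_l; lra).
      apply Rle_trans with (h * g * t * (16 * x ^ 2 + 2 * n2)); [lra|].
      (* The weight 4 x^2 in the energy is the leading coefficient of the equation, so h g is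
         bounded by the energy over 4 x; the growth rate is then of order x instead of x^2. *)
      assert (AG : 4 * x * (h * g) <= 4 * x ^ 2 * (h * h) + g * g).
      { assert (X := Rle_0_sqr (2 * x * h - g)). unfold Rsqr in X. nra. }
      assert (Px : 0 <= 4 * x + n2) by lra.
      assert (AG2 : t * (4 * x + n2) * (4 * x * (h * g)) <= t * (4 * x + n2) * (4 * x ^ 2 * (h * h) + g * g)).
      { apply Rmult_le_compat_l; auto. apply Rmult_le_pos; auto. }
      apply Rle_trans with (2 := AG2).
      replace (t * (4 * x + n2) * (4 * x * (h * g))) with (h * g * t * (16 * x ^ 2 + 4 * x * n2)) by ring.
      apply Rmult_le_compat_l; auto. nra. }
  assert (H0 : H 0 = LK nu (RtoC y)) by (unfold H; f_equal; ring).
  assert (G0 : G 0 = LK' nu (RtoC y)) by (unfold G; f_equal; ring).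
  assert (Hend : H 1 = LK nu (RtoC y + Ci * RtoC th)) by (unfold H; f_equal; ring).
  unfold E in Gr. rewrite !Cmod_sq, H0, G0, Hend in Gr.
  set (h := Cmod (LK nu (RtoC y + Ci * RtoC th))) in *. set (h0 := Cmod (LK nu (RtoC y))) in *.
  set (g0 := Cmod (LK' nu (RtoC y))) in *.
  assert (Ph : 0 <= h) by apply Cmod_ge_0. assert (Ph0 : 0 <= h0) by apply Cmod_ge_0.
  assert (Pg0 : 0 <= g0) by apply Cmod_ge_0. assert (Px2 := pow2_ge_0 x).
  assert (Pex := exp_pos (- x)).
  assert (Xq : x ^ 2 <= (1 + x ^ 2) ^ 2) by nra.
  assert (F1 : h0 * h0 <= A * exp (- x) * (A * exp (- x))) by (apply Rmult_le_compat; auto).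
  assert (F2 : g0 * g0 <= A * (1 + x ^ 2) * exp (- x) * (A * (1 + x ^ 2) * exp (- x))) by (apply Rmult_le_compat; auto).
  assert (Ee : exp (- x) * exp (- x) = exp (- (2 * x))) by (rewrite <- exp_plus; f_equal; ring).
  assert (Pe2 := exp_pos (- (2 * x))).
  assert (F : 4 * x ^ 2 * (h0 * h0) + g0 * g0 <= 5 * A ^ 2 * (1 + x ^ 2) ^ 2 * exp (- (2 * x))).
  { apply Rle_trans with (4 * x ^ 2 * (A * exp (- x) * (A * exp (- x))) + A * (1 + x ^ 2) * exp (- x) * (A * (1 + x ^ 2) * exp (- x))).
    - apply Rplus_le_compat; auto. apply Rmult_le_compat_l; lra.
    - replace (4 * x ^ 2 * (A * exp (- x) * (A * exp (- x))) + A * (1 + x ^ 2) * exp (- x) * (A * (1 + x ^ 2) * exp (- x)))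
        with (A ^ 2 * (exp (- x) * exp (- x)) * (4 * x ^ 2 + (1 + x ^ 2) ^ 2)) by ring.
      rewrite Ee. replace (5 * A ^ 2 * (1 + x ^ 2) ^ 2 * exp (- (2 * x))) with (A ^ 2 * exp (- (2 * x)) * (5 * (1 + x ^ 2) ^ 2)) by ring.
      apply Rmult_le_compat_l; [apply Rmult_le_pos; lra | lra]. }
  assert (Ex : exp (Rabs th * (4 * x + n2) * 1) <= exp n2 * exp x).
  { rewrite <- exp_plus. apply exp_le. assert (Pt := Rabs_pos th). nra. }
  assert (Q := exp_quad_bound x ltac:(lra)).
  assert (Pg1 := Rle_0_sqr (Cmod (G 1))). unfold Rsqr in Pg1.
  apply Rle_trans with (4 * x ^ 2 * (h * h) + Cmod (G 1) * Cmod (G 1)).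
  { assert (1 <= x ^ 2) by nra. assert (0 <= h * h) by nra. nra. }
  eapply Rle_trans; [exact Gr|].
  apply Rle_trans with (5 * A ^ 2 * (4096 * exp (x / 2)) * exp (- (2 * x)) * (exp n2 * exp x)).
  - apply Rmult_le_compat; auto.
    + assert (0 <= 4 * x ^ 2 * (h0 * h0)) by (apply Rmult_le_pos; nra). nra.
    + left; apply exp_pos.
    + eapply Rle_trans; [exact F|]. apply Rmult_le_compat_r; [lra|]. apply Rmult_le_compat_l; lra.
  - replace (5 * A ^ 2 * (4096 * exp (x / 2)) * exp (- (2 * x)) * (exp n2 * exp x)) with
      (5 * A ^ 2 * exp n2 * 4096 * (exp (x / 2) * exp (- (2 * x)) * exp x)) by ring.
    apply Rmult_le_compat_l; [repeat apply Rmult_le_pos; lra|].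
    rewrite <- !exp_plus. apply exp_le. assert (X := exp_ge_1_plus y). fold x in X. lra.
Qed.

(** The value on the real axis plus the integral of [LK nu ^ 2] along the arc leading to the point.
    The path eventually enters this sector. *)
Lemma LKprim_decay nu : rGam nu <> 0%C -> rGam (- nu) <> 0%C -> nonperiodic (2 * nu) ->
  forall e, 0 < e -> exists y0, forall y th, y0 <= y -> Rabs th <= 1 / 4 ->
  Cmod (LKprim nu (RtoC y + Ci * RtoC th)) < e.
Proof.
  intros H1 H2 Hn e He. assert (He2 : 0 < e / 2) by lra.
  destruct (LKprim_decay_real nu H1 H2 Hn) as [A [y1 [HA [Hy1 HB]]]].
  destruct (LK_arc_bound nu H1 H2) as [B [y2 [HB0 [Hy2 HC]]]].
  destruct (exp_neg_small A (e / 2) HA He2) as [y3 [Hy3 S3]].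
  destruct (exp_neg_small B (e / 2) HB0 He2) as [y4 [Hy4 S4]].
  (* The arc bound decays like e^(-y/2), hence the doubled threshold. *)
  exists (Rmax (Rmax y1 y2) (Rmax y3 (2 * y4))). intros y th Hy Hth.
  assert (L1 := Rmax_l y1 y2). assert (L2 := Rmax_r y1 y2). assert (L3 := Rmax_l y3 (2 * y4)). assert (L4 := Rmax_r y3 (2 * y4)).
  assert (L5 := Rmax_l (Rmax y1 y2) (Rmax y3 (2 * y4))). assert (L6 := Rmax_r (Rmax y1 y2) (Rmax y3 (2 * y4))).
  assert (R1 : Cmod (LKprim nu (RtoC y)) < e / 2).
  { eapply Rle_lt_trans; [apply HB; lra|]. apply S3. lra. }
  assert (R2 : Cmod (LKprim nu (RtoC y + Ci * RtoC th) - LKprim nu (RtoC y)) <= B * exp (- (y / 2)) * (1 - 0)).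
  { assert (I := Rdiff_increment (fun s => LKprim nu (Ci * RtoC th * RtoC s + RtoC y))
      (fun s => LK nu (Ci * RtoC th * RtoC s + RtoC y) ^ 2 * (Ci * RtoC th))%C (B * exp (- (y / 2))) 0 1 Rle_0_1).
    cbv beta in I.
    replace (Ci * RtoC th * 1 + RtoC y)%C with (RtoC y + Ci * RtoC th)%C in I by ring.
    replace (Ci * RtoC th * 0 + RtoC y)%C with (RtoC y) in I by ring.
    apply I.
    - intros s _. apply (Cdiff_Rdiff_line (LKprim nu)). now apply LKprim_diff.
    - intros s Hs. rewrite !Cmod_mult, Cmod_pow, Cmod_Ci, Cmod_R.
      replace (Ci * RtoC th * RtoC s + RtoC y)%C with (RtoC y + Ci * RtoC (th * s))%C by (rewrite RtoC_mult; ring).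
      assert (Pt := Rabs_pos th).
      assert (K := HC y (th * s) ltac:(lra)). rewrite Rabs_mult, (Rabs_pos_eq s) in K by lra.
      assert (K' := K ltac:(nra)). set (q := Cmod (LK nu (RtoC y + Ci * RtoC (th * s))) ^ 2) in *.
      assert (Pq : 0 <= q) by apply pow2_ge_0. nra. }
  assert (R3 := S4 (y / 2) ltac:(lra)).
  assert (T := Cmod_triangle (LKprim nu (RtoC y + Ci * RtoC th) - LKprim nu (RtoC y)) (LKprim nu (RtoC y))).
  replace (LKprim nu (RtoC y + Ci * RtoC th) - LKprim nu (RtoC y) + LKprim nu (RtoC y))%C with (LKprim nu (RtoC y + Ci * RtoC th)) in T by ring.
  lra.
Qed.

Local Open Scope C_scope.

(** * Hypergeometric form of the primitive *)

Definition nonint (s : C) : Prop := forall m : Z, s <> RtoC (IZR m).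

Lemma Csin_eq_exp z : Csin z = 0 -> Cexp (Ci * z) = Cexp (- (Ci * z)).
Proof.
  intros H. unfold Csin in H. apply Ceq_minus.
  replace (Cexp (Ci * z) - Cexp (- (Ci * z))) with
    ((Cexp (Ci * z) - Cexp (- (Ci * z))) / (2 * Ci) * (2 * Ci)) by (field; nz).
  rewrite H. ring.
Qed.

(** A zero makes e^(i pi s) and e^(-i pi s) equal in modulus, which forces s to be real and reduces
    to the real sine. *)
Lemma Csin_PI_neq_0 s : nonint s -> Csin (RtoC PI * s) <> 0.
Proof.
  intros Hs E. assert (HP := PI_RGT_0).
  assert (E1 := f_equal Cmod (Csin_eq_exp _ E)). rewrite !Cmod_Cexp in E1. apply exp_inv in E1.
  rewrite re_opp, !re_mult, !im_mult in E1. simpl in E1.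
  assert (I0 : Im s = 0%R).
  { apply Rmult_eq_reg_l with PI; [|lra]. unfold Im in *. lra. }
  assert (Es : s = RtoC (Re s)) by (apply C_eq; auto).
  rewrite Es, <- RtoC_mult, Csin_RtoC in E. apply RtoC_inj in E.
  destruct (sin_eq_0_0 _ E) as [k Hk]. apply (Hs k). rewrite Es. f_equal.
  apply Rmult_eq_reg_l with PI; lra.
Qed.

Lemma nonint_nonperiodic s : nonint s -> nonperiodic (2 * s).
Proof.
  intros Hs E. apply (Csin_PI_neq_0 s Hs). unfold Csin.
  assert (E1 : Cexp (Ci * (RtoC PI * s)) * Cexp (Ci * (RtoC PI * s)) = 1).
  { rewrite <- Cexp_plus, <- E. f_equal. ring. }
  assert (N := Cexp_neq_0 (Ci * (RtoC PI * s))).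
  rewrite Cexp_opp. set (e := Cexp (Ci * (RtoC PI * s))) in *.
  replace (e - / e) with ((e * e - 1) / e) by (field; auto). rewrite E1. field; nz.
Qed.

Lemma nonint_opp s : nonint s -> nonint (- s).
Proof.
  intros H m E. apply (H (- m)%Z). rewrite opp_IZR, RtoC_opp, <- E. ring.
Qed.

Lemma nonint_plus_IZR s k : nonint s -> nonint (s + RtoC (IZR k)).
Proof.
  intros H m E. apply (H (m - k)%Z). rewrite minus_IZR, RtoC_minus, <- E. ring.
Qed.

Lemma nonint_1_plus s : nonint s -> nonint (1 + s).
Proof. intros H. rewrite Cplus_comm. apply (nonint_plus_IZR s 1 H). Qed.

Lemma nonint_double s : nonint (2 * s) -> nonint s.
Proof. intros H m E. apply (H (2 * m)%Z). rewrite E, mult_IZR, RtoC_mult. reflexivity. Qed.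

Lemma nonint_half s : nonint (2 * s) -> nonint (1 / 2 + s).
Proof.
  intros H m E. apply (H (2 * m - 1)%Z). rewrite minus_IZR, mult_IZR, RtoC_minus, RtoC_mult, <- E.
  field.
Qed.

Lemma nonint_neq_0 s : nonint s -> s <> 0.
Proof. intros H. apply (H 0%Z). Qed.

Lemma rGam_neq_0 s : nonint s -> rGam s <> 0.
Proof.
  intros H E. apply (Csin_PI_neq_0 s H). rewrite <- rGam_reflection, E. ring.
Qed.

(** The quotient defining [pochhammer] is meaningful only away from the poles of Gamma; if c is not
    a pole, neither is c + k. *)
Lemma pochhammer_rising c k : rGam c <> 0 -> pochhammer c k = rising c k.
Proof.
  intros H. assert (E := rGam_rising c k).
  assert (H2 : rGam (c + RtoC (INR k)) <> 0).
  { intros E2. apply H. rewrite E, E2. ring. }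
  unfold pochhammer. rewrite !Gamma_rGam by auto. rewrite E. field. split; auto.
  intros E3. apply H. rewrite E, E3. ring.
Qed.

Lemma rising_neq_0 c k : rGam c <> 0 -> rising c k <> 0.
Proof. intros H E. apply H. rewrite (rGam_rising c k), E. ring. Qed.

Lemma rising_add a n k : rising a (n + k) = rising a n * rising (a + RtoC (INR n)) k.
Proof.
  induction k as [|k IH]; [rewrite Nat.add_0_r; simpl; ring|].
  rewrite Nat.add_succ_r. simpl rising. rewrite IH, plus_INR, RtoC_plus. ring.
Qed.

(** Legendre's duplication for Pochhammer symbols. It produces the parameter 1/2 + s, and its 4^k
    turns e^(2y) into z^2. *)
Lemma rising_duplication s k :
  rising (1 + 2 * s) (k + k) = 4 ^ k * (rising (1 / 2 + s) k * rising (1 + s) k).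
Proof.
  induction k as [|k IH]; [simpl; ring|].
  replace (S k + S k)%nat with (S (S (k + k))) by lia.
  change (rising (1 + 2 * s) (S (S (k + k)))) with
    (rising (1 + 2 * s) (k + k) * (1 + 2 * s + RtoC (INR (k + k))) * (1 + 2 * s + RtoC (INR (S (k + k))))).
  rewrite IH, RtoC_INR_S, plus_INR, RtoC_plus. simpl rising. rewrite Cpow_S. field.
Qed.

(** The parameter s arises from the termwise integration: 1/(s + k) = (s)_k / (s (1 + s)_k). The
    numerator factor (1 + s)_k given by the duplication cancels one of the three copies below. *)
Lemma bes2_square_coef s k : nonint (2 * s) ->
  icoef (s + s) (bes2 s s) k =
  rGam (1 + s) ^ 2 / (2 * s) *
  (Cprod (map (fun c => pochhammer c k) [s; 1 / 2 + s])
   / Cprod (map (fun c => pochhammer c k) [1 + s; 1 + s; 1 + 2 * s])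
   * (4 ^ k / RtoC (INR (fact k)))).
Proof.
  intros H. assert (Hs := nonint_double s H).
  assert (G1 := rGam_neq_0 _ Hs). assert (G2 := rGam_neq_0 _ (nonint_half s H)).
  assert (G3 := rGam_neq_0 _ (nonint_1_plus s Hs)). assert (G4 := rGam_neq_0 _ (nonint_1_plus _ H)).
  cbn [map Cprod fold_right]. rewrite !pochhammer_rising by auto.
  assert (R3 := rising_neq_0 _ k G3). assert (R4 := rising_neq_0 _ k G4).
  unfold icoef, bes2.
  assert (E1 : rGam (1 + s) = rising (1 + s) k * rGam (s + RtoC (INR k) + 1)).
  { rewrite (rGam_rising (1 + s) k). do 2 f_equal. ring. }
  assert (E2 : rising (1 + 2 * s) k * rising (s + s + RtoC (INR k) + 1) k
     = 4 ^ k * (rising (1 / 2 + s) k * rising (1 + s) k)).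
  { rewrite <- rising_duplication, rising_add. do 2 f_equal. ring. }
  assert (E3 : rising s k * (s + RtoC (INR k)) = s * rising (1 + s) k).
  { change (rising s k * (s + RtoC (INR k))) with (rising s (S k)). rewrite rising_S_l. do 2 f_equal. ring. }
  assert (N := INR_fact_neq_0_C k). assert (Ns := nonint_neq_0 s Hs).
  assert (Nk : s + RtoC (INR k) <> 0).
  { rewrite INR_IZR_INZ. apply nonint_neq_0. now apply nonint_plus_IZR. }
  replace (rising (s + s + RtoC (INR k) + 1) k) with
    (4 ^ k * (rising (1 / 2 + s) k * rising (1 + s) k) / rising (1 + 2 * s) k) by (rewrite <- E2; field; auto).
  replace (rising s k) with (s * rising (1 + s) k / (s + RtoC (INR k))) by (rewrite <- E3; field; auto).
  rewrite E1. replace (s + s + 2 * RtoC (INR k)) with (2 * (s + RtoC (INR k))) by ring.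
  field; nz.
Qed.

Lemma Cpow_mult_Cexp2 y k : (4 * Cexp (2 * y)) ^ k = 4 ^ k * Cexp (2 * y) ^ k.
Proof. apply Cpow_mult_l. Qed.

Lemma BIprim_hypergeom s y : nonint (2 * s) ->
  BIprim s s y = Cexp (2 * s * y) * (rGam (1 + s) ^ 2 / (2 * s)) *
    hypergeom [s; 1 / 2 + s] [1 + s; 1 + s; 1 + 2 * s] (4 * Cexp (2 * y)).
Proof.
  intros H. assert (Hs := nonint_double s H).
  assert (He : entire (icoef (s + s) (bes2 s s))).
  { apply entire_icoef; [|apply entire_bes2]. replace (s + s) with (2 * s) by ring.
    now apply nonperiodic_freq, nonint_nonperiodic. }
  unfold BIprim. rewrite expser_pow by auto. replace (s + s) with (2 * s) at 1 by ring.
  rewrite <- (Cmult_assoc (Cexp (2 * s * y))). f_equal.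
  (* Pulling the constant out of the series requires the hypergeometric series to be summable;
     dividing the convergent primitive by this nonzero constant provides that. *)
  assert (Hc : rGam (1 + s) ^ 2 / (2 * s) <> 0).
  { assert (G3 := rGam_neq_0 _ (nonint_1_plus s Hs)). assert (Ns := nonint_neq_0 s Hs).
    unfold Cdiv. apply Cmult_neq_0; [now apply Cpow_nz|].
    intros E. apply C1_nz. rewrite <- (Cinv_r (2 * s)), E; [ring|]. apply Cmult_neq_0; nz. }
  unfold hypergeom. set (c := rGam (1 + s) ^ 2 / (2 * s)) in *.
  rewrite <- CSeries_scal.
  - apply CSeries_ext. intros k. rewrite bes2_square_coef by auto. fold c. rewrite Cpow_mult_Cexp2.
    unfold Cdiv. ring.
  - assert (S0 := Csummable_scal (/ c) _ (entire_pow_summable _ (Cexp (2 * y)) He)).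
    revert S0. apply ex_series_ext. intros k. f_equal. rewrite bes2_square_coef by auto. fold c.
    rewrite Cpow_mult_Cexp2. assert (N := INR_fact_neq_0_C k).
    match goal with |- context [Cprod ?a / Cprod ?b] => generalize (Cprod a / Cprod b) end.
    intros u. field; auto.
Qed.

Lemma rGam_2 : rGam 2 = 1.
Proof.
  assert (H := rGam_rec 1). rewrite rGam_1 in H.
  replace (1 + 1) with (RtoC 2) in H by (rewrite <- RtoC_plus; f_equal; lra).
  rewrite <- (Cmult_1_l (rGam 2)). auto.
Qed.

Lemma nonint_3_2 : nonint (3 / 2).
Proof.
  intros m E.
  assert (E2 : RtoC 3 = RtoC (IZR (2 * m))).
  { rewrite mult_IZR, RtoC_mult, <- E. field; nz. }
  apply RtoC_inj in E2. apply (eq_IZR 3) in E2. lia.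
Qed.

Lemma rising_2 k : rising 2 k = RtoC (INR (fact (S k))).
Proof.
  rewrite <- rising_1, rising_S_l. replace (1 + 1) with (RtoC 2) by (rewrite <- RtoC_plus; f_equal; lra). ring.
Qed.

(** Here 1/((k + 1)! (k + 1)) = (1)_k^2 / ((2)_k^2 k!), where k + 1 comes from the integration, and
    the parameter 3/2 comes from the duplication formula at s = 0 with index k + 1. *)
Lemma bes2_cross_coef n k : nonint n ->
  icoef 2 (fun k => bes2 n (- n) (S k)) k =
  rGam (1 + n) * rGam (1 - n) / (1 - n ^ 2) *
  (Cprod (map (fun c => pochhammer c k) [RtoC 1; RtoC 1; 3 / 2])
   / Cprod (map (fun c => pochhammer c k) [RtoC 2; RtoC 2; 2 - n; 2 + n])
   * (4 ^ k / RtoC (INR (fact k)))).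
Proof.
  intros H. assert (H' := nonint_opp n H).
  assert (H2 : nonint (2 + n)) by (rewrite Cplus_comm; exact (nonint_plus_IZR n 2 H)).
  assert (H2' : nonint (2 - n)) by (unfold Cminus; rewrite Cplus_comm; exact (nonint_plus_IZR (- n) 2 H')).
  assert (G0 : rGam 1 <> 0) by (rewrite rGam_1; apply C1_nz).
  assert (G1 : rGam 2 <> 0) by (rewrite rGam_2; apply C1_nz).
  assert (G2 := rGam_neq_0 _ nonint_3_2). assert (G3 := rGam_neq_0 _ H2). assert (G4 := rGam_neq_0 _ H2').
  cbn [map Cprod fold_right]. rewrite !pochhammer_rising by auto.
  assert (R3 := rising_neq_0 _ k G3). assert (R4 := rising_neq_0 _ k G4).
  rewrite rising_1, rising_2.
  unfold icoef, bes2.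
  assert (E1 : rGam (1 + n) = (1 + n) * (rising (2 + n) k * rGam (n + RtoC (INR (S k)) + 1))).
  { rewrite rGam_rec. replace (1 + n + 1) with (2 + n) by ring. rewrite (rGam_rising (2 + n) k).
    do 3 f_equal. rewrite RtoC_INR_S. ring. }
  assert (E2 : rGam (1 - n) = (1 - n) * (rising (2 - n) k * rGam (- n + RtoC (INR (S k)) + 1))).
  { rewrite rGam_rec. replace (1 - n + 1) with (2 - n) by ring. rewrite (rGam_rising (2 - n) k).
    do 3 f_equal. rewrite RtoC_INR_S. ring. }
  assert (E3 : rising (n + - n + RtoC (INR (S k)) + 1) (S k) = 2 * (4 ^ k * rising (3 / 2) k)).
  { assert (D := rising_duplication 0 (S k)).
    rewrite !Cmult_0_r, !Cplus_0_r, rising_add, (rising_1 (S k)), (rising_S_l (1 / 2)) in D.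
    replace (1 / 2 + 1) with (3 / 2) in D by (field; nz).
    assert (N := INR_fact_neq_0_C (S k)).
    replace (n + - n + RtoC (INR (S k)) + 1) with (1 + RtoC (INR (S k))) by ring.
    replace (rising (1 + RtoC (INR (S k))) (S k)) with
      (RtoC (INR (fact (S k))) * rising (1 + RtoC (INR (S k))) (S k) / RtoC (INR (fact (S k)))) by (field; auto).
    rewrite D, Cpow_S. field; auto. }
  assert (N := INR_fact_neq_0_C k). assert (N1 : RtoC (INR (S k)) <> 0) by (apply RtoC_INR_neq_0; lia).
  assert (P1 : 1 + n <> 0) by (apply nonint_neq_0; now apply nonint_1_plus).
  assert (P2 : 1 - n <> 0) by (apply nonint_neq_0; now apply nonint_1_plus).
  rewrite E1, E2, E3, RtoC_INR_fact_S. replace (2 + 2 * RtoC (INR k)) with (2 * RtoC (INR (S k))) by (rewrite RtoC_INR_S; ring).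
  replace (1 - n ^ 2) with ((1 + n) * (1 - n)) by ring.
  field; nz.
Qed.

Lemma cross_hypergeom n y : nonint n ->
  expser 2 (icoef 2 (fun k => bes2 n (- n) (S k))) y =
  rGam (1 + n) * rGam (1 - n) * (Cexp (2 * y) / (1 - n ^ 2) *
    hypergeom [RtoC 1; RtoC 1; 3 / 2] [RtoC 2; RtoC 2; 2 - n; 2 + n] (4 * Cexp (2 * y))).
Proof.
  intros H. assert (H' := nonint_opp n H).
  assert (He : entire (icoef 2 (fun k => bes2 n (- n) (S k)))).
  { apply entire_icoef; [apply freq2_neq_0 | apply entire_shift, entire_bes2]. }
  rewrite expser_pow by auto.
  assert (P1 : 1 + n <> 0) by (apply nonint_neq_0; now apply nonint_1_plus).
  assert (P2 : 1 - n <> 0) by (apply nonint_neq_0; now apply nonint_1_plus).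
  assert (G1 := rGam_neq_0 _ (nonint_1_plus _ H)). assert (G2 := rGam_neq_0 _ (nonint_1_plus _ H')).
  assert (P3 : 1 - n ^ 2 <> 0) by (replace (1 - n ^ 2) with ((1 + n) * (1 - n)) by ring; now apply Cmult_neq_0).
  set (c := rGam (1 + n) * rGam (1 - n) / (1 - n ^ 2)).
  assert (Hc : c <> 0).
  { unfold c, Cdiv. repeat apply Cmult_neq_0; auto. intros E. apply C1_nz. rewrite <- (Cinv_r _ P3), E. ring. }
  replace (rGam (1 + n) * rGam (1 - n) * (Cexp (2 * y) / (1 - n ^ 2) *
    hypergeom [RtoC 1; RtoC 1; 3 / 2] [RtoC 2; RtoC 2; 2 - n; 2 + n] (4 * Cexp (2 * y)))) with
    (Cexp (2 * y) * (c * hypergeom [RtoC 1; RtoC 1; 3 / 2] [RtoC 2; RtoC 2; 2 - n; 2 + n] (4 * Cexp (2 * y))))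
    by (unfold c, Cdiv; ring).
  f_equal. unfold hypergeom. rewrite <- CSeries_scal.
  - apply CSeries_ext. intros k. rewrite bes2_cross_coef by auto. fold c. rewrite Cpow_mult_Cexp2.
    unfold Cdiv. ring.
  - assert (S0 := Csummable_scal (/ c) _ (entire_pow_summable _ (Cexp (2 * y)) He)).
    revert S0. apply ex_series_ext. intros k. f_equal. rewrite bes2_cross_coef by auto. fold c.
    rewrite Cpow_mult_Cexp2. assert (N := INR_fact_neq_0_C k).
    match goal with |- context [Cprod ?a / Cprod ?b] => generalize (Cprod a / Cprod b) end.
    intros u. field; auto.
Qed.

(** * The digamma function and the closed form of the primitive *)

Lemma Cdiff_ext_loc f g z l : @locally C_UniformSpace z (fun w => f w = g w) -> Cdiff f z l -> Cdiff g z l.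
Proof.
  intros E H eps He. apply locally_Cmod in E. destruct E as [d1 [D1 E]].
  destruct (H eps He) as [d [Hd Hh]]. exists (Rmin d d1). split; [now apply Rmin_pos|].
  intros h Hm. assert (L1 := Rlt_le_trans _ _ _ Hm (Rmin_l _ _)). assert (L2 := Rlt_le_trans _ _ _ Hm (Rmin_r _ _)).
  rewrite <- !E; [now apply Hh | |].
  - replace (z - z) with (RtoC 0) by ring. now rewrite Cmod_0.
  - now replace (z + h - z) with h by ring.
Qed.

Lemma digamma_rGam s : rGam s <> 0 -> digamma s = - rGam' s / rGam s.
Proof.
  intros H. unfold digamma.
  assert (D : Cdiff Gamma s (- rGam' s / (rGam s * rGam s))).
  { apply Cdiff_ext_loc with (fun w => / rGam w); [|apply Cdiff_inv; auto; apply rGam_diff].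
    assert (K := Cdiff_cont _ _ _ (rGam_diff s)). generalize (Clim_nonzero _ _ K H).
    apply filter_imp. intros w Hw. symmetry. apply Gamma_rGam. apply Cmod_gt_0.
    apply Cmod_gt_0 in H. lra. }
  rewrite (C_derive_eq _ _ _ D), Gamma_rGam by auto. field; auto.
Qed.

Lemma rGam'_rec s : rGam' s = rGam (1 + s) + s * rGam' (1 + s).
Proof.
  apply (Cdiff_unique rGam s); [apply rGam_diff|].
  apply Cdiff_ext with (fun w => (1 * w + 0) * rGam (1 * w + 1)).
  { intros w. rewrite (rGam_rec w). replace (1 * w + 1) with (w + 1) by ring. ring. }
  eapply Cdiff_eq.
  - apply (Cdiff_mult (fun w => 1 * w + 0) (fun w => rGam (1 * w + 1))); [apply Cdiff_affine|].
    apply (Cdiff_comp rGam (fun w => 1 * w + 1)); [apply Cdiff_affine | apply rGam_diff].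
  - replace (1 * s + 1) with (1 + s) by ring. ring.
Qed.

(** Two derivatives of sin(pi s) are compared. Together with [rGam'_rec] this expresses the
    derivatives of 1/Gamma at 1 + n and 1 - n by the one at n, which is how 1/(2n) and the cotangent
    enter. *)
Lemma rGam'_reflection s :
  rGam' s * rGam (1 - s) - rGam s * rGam' (1 - s) = Ccos (RtoC PI * s).
Proof.
  assert (E : RtoC PI * (rGam' s * rGam (1 - s) - rGam s * rGam' (1 - s)) = Ccos (RtoC PI * s) * RtoC PI).
  { apply (Cdiff_unique (fun w => Csin (RtoC PI * w)) s); [|apply Cdiff_scaled, Cdiff_Csin].
    apply Cdiff_ext with (fun w => RtoC PI * (rGam w * rGam (- (1) * w + 1))).
    { intros w. rewrite <- rGam_reflection. do 3 f_equal. ring. }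
    eapply Cdiff_eq.
    - apply Cdiff_scal, (Cdiff_mult rGam (fun w => rGam (- (1) * w + 1))); [apply rGam_diff|].
      apply (Cdiff_comp rGam (fun w => - (1) * w + 1)); [apply Cdiff_affine | apply rGam_diff].
    - replace (- (1) * s + 1) with (1 - s) by ring. ring. }
  replace (rGam' s * rGam (1 - s) - rGam s * rGam' (1 - s)) with
    (RtoC PI * (rGam' s * rGam (1 - s) - rGam s * rGam' (1 - s)) / RtoC PI) by (field; nz).
  rewrite E. field; nz.
Qed.

(** The factor is the square of (pi/2)/sin(pi n), which relates K_n to [LK]; the sign is that of an
    integral from the point to infinity. *)
Definition FK (n y : C) : C := - (RtoC PI ^ 2 / (4 * Csin (RtoC PI * n) ^ 2)) * LKprim n y.

Lemma C4_neq_0 : RtoC 4 <> 0.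
Proof. apply RtoC_neq_0; lra. Qed.

Lemma FK_hypergeom n y : nonint (2 * n) ->
  1 / (8 * n) *
    (Cexp (- (2 * n) * y) * Gamma n ^ 2
       * hypergeom [- n; 1 / 2 - n] [1 - n; 1 - n; 1 - 2 * n] (4 * Cexp (2 * y))
     - Cexp (2 * n * y) * Gamma (- n) ^ 2
       * hypergeom [n; 1 / 2 + n] [1 + n; 1 + n; 1 + 2 * n] (4 * Cexp (2 * y))
     + 4 * RtoC PI * Ccsc (RtoC PI * n) *
       (y + 4 * Cexp (2 * y) / (4 * (1 - n ^ 2))
          * hypergeom [RtoC 1; RtoC 1; 3 / 2] [RtoC 2; RtoC 2; 2 - n; 2 + n] (4 * Cexp (2 * y))
        - 1 / (2 * n) - digamma n - RtoC PI / 2 * Ccot (RtoC PI * n)))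
  = FK n y.
Proof.
  intros H. assert (Hn := nonint_double n H). assert (Hn' := nonint_opp n Hn).
  assert (H' : nonint (2 * - n)) by (replace (2 * - n) with (- (2 * n)) by ring; now apply nonint_opp).
  assert (G1 := rGam_neq_0 _ Hn). assert (G2 := rGam_neq_0 _ Hn').
  assert (G3 := rGam_neq_0 _ (nonint_1_plus _ Hn)). assert (G4 := rGam_neq_0 _ (nonint_1_plus _ Hn')).
  change (1 + - n) with (1 - n) in G4.
  assert (B1 := BIprim_hypergeom n y H). assert (B2 := BIprim_hypergeom (- n) y H').
  change (1 / 2 + - n) with (1 / 2 - n) in B2. change (1 + - n) with (1 - n) in B2.
  replace (1 + 2 * - n) with (1 - 2 * n) in B2 by ring. replace (2 * - n * y) with (- (2 * n) * y) in B2 by ring.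
  assert (B3 := cross_hypergeom n y Hn).
  rewrite (digamma_rGam n G1), !Gamma_rGam by auto.
  unfold FK, LKprim, BIcross, Ccsc, Ccot. rewrite B1, B2, B3.
  assert (Hsin := Csin_PI_neq_0 n Hn).
  assert (R1 := rGam_reflection n). assert (R2 := rGam_reflection (- n)).
  replace (1 - - n) with (1 + n) in R2 by ring.
  assert (Esin : Csin (RtoC PI * - n) = - Csin (RtoC PI * n)).
  { unfold Csin. replace (Ci * (RtoC PI * - n)) with (- (Ci * (RtoC PI * n))) by ring.
    replace (- - (Ci * (RtoC PI * n))) with (Ci * (RtoC PI * n)) by ring. field; nz. }
  rewrite Esin in R2.
  assert (D1 := rGam'_rec n). assert (D2 := rGam'_reflection n).
  assert (Rn := rGam_rec n). rewrite (Cplus_comm n 1) in Rn.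
  assert (Nn := nonint_neq_0 n Hn).
  assert (P1 : 1 + n <> 0) by (apply nonint_neq_0; now apply nonint_1_plus).
  assert (P2 : 1 - n <> 0) by (apply nonint_neq_0; now apply nonint_1_plus).
  assert (P3 : 1 - n ^ 2 <> 0) by (replace (1 - n ^ 2) with ((1 + n) * (1 - n)) by ring; now apply Cmult_neq_0).
  set (h1 := hypergeom [- n; _] _ _). set (h2 := hypergeom [n; _] _ _). set (h3 := hypergeom [RtoC 1; _; _] _ _).
  set (e1 := Cexp (- (2 * n) * y)). set (e2 := Cexp (2 * n * y)). set (e3 := Cexp (2 * y)).
  set (sn := Csin (RtoC PI * n)) in *. set (cs := Ccos (RtoC PI * n)) in *.
  set (g := rGam n) in *. set (gm := rGam (- n)) in *. set (a := rGam (1 + n)) in *. set (b := rGam (1 - n)) in *.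
  set (g' := rGam' n) in *. set (a' := rGam' (1 + n)) in *. set (b' := rGam' (1 - n)) in *.
  assert (NP := PI_neq0_C).
  (* The values of 1/Gamma, its derivatives and the sine are reduced to those at n, 1 + n and 1 - n.
     What remains is an identity of rational functions. *)
  assert (Ea' : a' = (g' - a) / n) by (rewrite D1; field; auto).
  assert (Eb' : b' = (g' * b - cs) / g) by (rewrite <- D2; field; auto).
  assert (Esn : sn = RtoC PI * (g * b)) by (symmetry; exact R1).
  assert (Egm : gm = - (b * g) / a).
  { transitivity (RtoC PI * (gm * a) / (RtoC PI * a)); [field; auto|]. rewrite R2, Esn. field; auto. }
  rewrite Ea', Eb', Egm, Esn, Rn. assert (Nba : - (b * g) <> 0).
  { intros E. apply G2. rewrite Egm, E. field; auto. }
  clearbody h1 h2 h3 e1 e2 e3 sn cs g gm a b g' a' b'.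
  field; nz.
Qed.

(** * The integral along a path *)

Lemma cval_Cexp p : (0 < cmod p)%R -> cval p = Cexp (clog p).
Proof. intros H. unfold cval, Cexp, clog. simpl. now rewrite exp_ln. Qed.

Lemma cval_chalf p : (0 < cmod p)%R -> cval (chalf p) = Cexp (clog (chalf p)).
Proof. intros H. apply cval_Cexp. simpl. lra. Qed.

Lemma cval_double p : cval p = 2 * cval (chalf p).
Proof. unfold cval. simpl. rewrite RtoC_div by lra. field; nz. Qed.

Lemma cval_sq p : (0 < cmod p)%R -> cval p ^ 2 = 4 * Cexp (2 * clog (chalf p)).
Proof.
  intros H. rewrite cval_double, cval_chalf by auto.
  replace (2 * clog (chalf p)) with (clog (chalf p) + clog (chalf p)) by ring.
  rewrite Cexp_plus. ring.
Qed.

Lemma besselI_BI nu p : nonint nu -> (0 < cmod p)%R -> besselI nu p = BI nu (clog (chalf p)).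
Proof.
  intros Hn Hp. unfold besselI, BI. rewrite expser_pow by apply entire_bes. unfold cpower.
  f_equal. apply CSeries_ext. intros k.
  rewrite cval_chalf, Gamma_rGam by
    (auto; apply rGam_neq_0; rewrite INR_IZR_INZ; apply (nonint_plus_IZR _ 1); now apply nonint_plus_IZR).
  unfold bes. rewrite Cpow_mult_r.
  replace (Cexp (clog (chalf p)) ^ 2) with (Cexp (2 * clog (chalf p))).
  - assert (N := INR_fact_neq_0_C k).
    assert (G : rGam (nu + RtoC (INR k) + 1) <> 0).
    { apply rGam_neq_0. rewrite INR_IZR_INZ. apply (nonint_plus_IZR _ 1). now apply nonint_plus_IZR. }
    field. auto.
  - replace (2 * clog (chalf p)) with (clog (chalf p) + clog (chalf p)) by ring.
    rewrite Cexp_plus. ring.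
Qed.

Definition Kf (nu y : C) : C := RtoC PI / 2 * (LK nu y / Csin (RtoC PI * nu)).

Lemma besselK_Kf nu p : nonint nu -> (0 < cmod p)%R -> besselK nu p = Kf nu (clog (chalf p)).
Proof.
  intros Hn Hp. unfold besselK, Kf, LK. rewrite !besselI_BI by (auto; now apply nonint_opp). reflexivity.
Qed.

Lemma FK_diff nu y : nonint nu -> Cdiff (FK nu) y (- Kf nu y ^ 2).
Proof.
  intros Hn. assert (Hs := Csin_PI_neq_0 nu Hn). eapply Cdiff_eq.
  - apply Cdiff_scal, LKprim_diff. now apply nonint_nonperiodic.
  - unfold Kf. field; nz.
Qed.

Lemma Kf_diff nu y : exists l, Cdiff (Kf nu) y l.
Proof.
  eexists. apply Cdiff_scal.
  apply Cdiff_ext with (fun w => / Csin (RtoC PI * nu) * LK nu w).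
  { intros w. unfold Cdiv. ring. }
  apply Cdiff_scal, LK_diff.
Qed.

Lemma Rdiff_comp f c (s : R) l c' : Rdiff c s c' -> Cdiff f (c s) l -> Rdiff (fun t => f (c t)) s (l * c').
Proof.
  intros Hc Hf eps He.
  assert (Pm := Cmod_ge_0 c'). assert (Pl := Cmod_ge_0 l).
  assert (e1 : (0 < eps / 2 / (Cmod c' + 1))%R) by (apply Rdiv_lt_0_compat; lra).
  (* The bound 1 keeps the increment of the inner function below (|c'| + 1) |h|; the other one makes
     its linearization error small. *)
  assert (e2 : (0 < Rmin 1 (eps / 2 / (Cmod l + 1)))%R).
  { apply Rmin_pos; [lra|]. apply Rdiv_lt_0_compat; lra. }
  destruct (Hf _ e1) as [d1 [D1 B1]]. destruct (Hc _ e2) as [d2 [D2 B2]].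
  assert (d3 : (0 < d1 / (Cmod c' + 1))%R) by (apply Rdiv_lt_0_compat; lra).
  exists (Rmin d2 (d1 / (Cmod c' + 1))). split. { now apply Rmin_pos. }
  intros h Hh.
  assert (h2 := Rlt_le_trans _ _ _ Hh (Rmin_l _ _)).
  assert (h1 := Rlt_le_trans _ _ _ Hh (Rmin_r _ _)).
  specialize (B2 h h2). assert (Ph := Rabs_pos h).
  assert (m1 := Rmin_l 1 (eps / 2 / (Cmod l + 1))). assert (m2 := Rmin_r 1 (eps / 2 / (Cmod l + 1))).
  assert (B0 : (Cmod (c (s + h)%R - c s) <= (Cmod c' + 1) * Rabs h)%R).
  { replace (c (s + h)%R - c s) with ((c (s + h)%R - c s - c' * RtoC h) + c' * RtoC h) by ring.
    eapply Rle_trans. { apply Cmod_triangle. } rewrite Cmod_mult, Cmod_R. nra. }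
  assert (K : (Cmod (c (s + h)%R - c s) < d1)%R).
  { eapply Rle_lt_trans. { exact B0. }
    apply Rmult_lt_compat_l with (r := (Cmod c' + 1)%R) in h1; [|lra].
    replace ((Cmod c' + 1) * (d1 / (Cmod c' + 1)))%R with d1 in h1 by (field; lra). exact h1. }
  specialize (B1 _ K). replace (c s + (c (s + h)%R - c s)) with (c (s + h)%R) in B1 by ring.
  replace (f (c (s + h)%R) - f (c s) - l * c' * RtoC h) with
    ((f (c (s + h)%R) - f (c s) - l * (c (s + h)%R - c s)) + l * (c (s + h)%R - c s - c' * RtoC h)) by ring.
  eapply Rle_trans. { apply Cmod_triangle. } rewrite Cmod_mult.
  apply Rle_trans with (eps / 2 * Rabs h + eps / 2 * Rabs h)%R; [|lra].
  apply Rplus_le_compat.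
  - eapply Rle_trans. { exact B1. }
    apply Rle_trans with (eps / 2 / (Cmod c' + 1) * ((Cmod c' + 1) * Rabs h))%R.
    + apply Rmult_le_compat_l; lra.
    + apply Req_le. field. lra.
  - apply Rle_trans with ((Cmod l + 1) * (eps / 2 / (Cmod l + 1) * Rabs h))%R.
    + apply Rmult_le_compat; try lra; [apply Cmod_ge_0|].
      eapply Rle_trans; [exact B2|]. apply Rmult_le_compat_r; lra.
    + apply Req_le. field. lra.
Qed.

Lemma is_RInt_components (f : R -> C) (a b : R) (l : C) :
  is_RInt (fun t => Re (f t)) a b (Re l) -> is_RInt (fun t => Im (f t)) a b (Im l) ->
  is_RInt (V := C_R_NormedModule) f a b l.
Proof.
  intros H1 H2. exact (is_RInt_fct_extend_pair (U := R_NormedModule) (V := R_NormedModule) f a b (Re l) (Im l) H1 H2).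
Qed.

Lemma is_RInt_Rdiff (F f : R -> C) (a b : R) : (a <= b)%R ->
  (forall x, (a <= x <= b)%R -> Rdiff F x (f x)) ->
  (forall x, (a <= x <= b)%R -> continuous (fun t => Re (f t)) x /\ continuous (fun t => Im (f t)) x) ->
  is_RInt (V := C_R_NormedModule) f a b (F b - F a).
Proof.
  intros Hab HF Hc. apply is_RInt_components.
  - replace (Re (F b - F a)) with (minus (Re (F b)) (Re (F a))).
    2: { unfold Cminus. rewrite re_plus, re_opp. reflexivity. }
    apply (is_RInt_derive (V := R_CompleteNormedModule) (fun t => Re (F t))); rewrite Rmin_left, Rmax_right by auto;
      intros x Hx; [now apply Rdiff_is_derive_re, HF | now apply Hc].
  - replace (Im (F b - F a)) with (minus (Im (F b)) (Im (F a))).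
    2: { unfold Cminus. rewrite im_plus, im_opp. reflexivity. }
    apply (is_RInt_derive (V := R_CompleteNormedModule) (fun t => Im (F t))); rewrite Rmin_left, Rmax_right by auto;
      intros x Hx; [now apply Rdiff_is_derive_im, HF | now apply Hc].
Qed.

Lemma Rdiff_continuous f s l : Rdiff f s l ->
  continuous (fun t => Re (f t)) s /\ continuous (fun t => Im (f t)) s.
Proof.
  intros H. split.
  - apply (ex_derive_continuous (fun t => Re (f t))). eexists. now apply Rdiff_is_derive_re with (1 := H).
  - apply (ex_derive_continuous (fun t => Im (f t))). eexists. now apply Rdiff_is_derive_im with (1 := H).
Qed.

Definition path_integrand (nu : C) (gamma : R -> cpoint) (s : R) : C :=
  besselK nu (gamma s) ^ 2 / cval (gamma s) * path_velocity gamma s.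

(** In y = log(gamma/2) the form dt/t is dy, so the integrand is the derivative of -FK along the
    piece; its continuity allows the fundamental theorem of calculus. *)
Lemma path_piece nu gamma (rho theta : R -> R) (a b : R) : nonint nu -> (a <= b)%R ->
  Defs.C1 rho -> Defs.C1 theta ->
  (forall x, (a <= x <= b)%R -> cmod (gamma x) = rho x /\ carg (gamma x) = theta x) ->
  (forall x, (a <= x <= b)%R -> (0 < cmod (gamma x))%R) ->
  is_RInt (V := C_R_NormedModule) (path_integrand nu gamma) a b
    (FK nu (clog (chalf (gamma a))) - FK nu (clog (chalf (gamma b)))).
Proof.
  intros Hn Hab Hr Ht Hg Hp.
  set (y := fun x => (ln (rho x / 2), theta x) : C).
  set (y' := fun x => (Derive rho x / rho x, Derive theta x)%R : C).
  assert (Hrho : forall x, (a <= x <= b)%R -> (0 < rho x)%R).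
  { intros x Hx. destruct (Hg x Hx) as [<- _]. now apply Hp. }
  assert (Ey : forall x, (a <= x <= b)%R -> clog (chalf (gamma x)) = y x).
  { intros x Hx. destruct (Hg x Hx) as [E1 E2]. unfold clog, chalf, y. simpl. now rewrite E1, E2. }
  assert (Dy : forall x, (a <= x <= b)%R -> Rdiff y x (y' x)).
  { intros x Hx. assert (P := Hrho x Hx). destruct (Hr x) as [R1 _]. destruct (Ht x) as [T1 _].
    apply Rdiff_components; simpl.
    - auto_derive; [split; auto; lra|]. change (Derive (fun u => rho u) x) with (Derive rho x). field. lra.
    - now apply Derive_correct. }
  set (F := fun x => - (1) * FK nu (y x)).
  set (f := fun x => Kf nu (y x) ^ 2 * y' x).
  assert (DF : forall x, (a <= x <= b)%R -> Rdiff F x (f x)).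
  { intros x Hx. unfold F, f. replace (Kf nu (y x) ^ 2 * y' x) with (- (1) * ((- Kf nu (y x) ^ 2) * y' x)) by ring.
    apply Rdiff_scal. apply Rdiff_comp; [now apply Dy | now apply FK_diff]. }
  assert (I : is_RInt (V := C_R_NormedModule) f a b (F b - F a)).
  { apply is_RInt_Rdiff; auto. intros x Hx. assert (P := Hrho x Hx).
    destruct (Kf_diff nu (y x)) as [l Hl].
    assert (K1 := Rdiff_comp (Kf nu) y x l (y' x) (Dy x Hx) Hl).
    destruct (Rdiff_continuous _ _ _ (Rdiff_comp (fun w => w ^ 2) (fun t => Kf nu (y t)) x _ _ K1
      (Cdiff_ext _ _ _ _ (fun w => ltac:(simpl; ring) : w * w = w ^ 2) (Cdiff_square (fun w => w) _ 1
         (Cdiff_ext _ _ _ _ (fun w => ltac:(ring) : 1 * w + 0 = w) (Cdiff_affine 1 0 _))))))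
      as [C1' C2'].
    assert (R1 : continuous (fun t => Derive rho t / rho t)%R x).
    { apply (continuous_mult (Derive rho) (fun t => / rho t)%R); [apply Hr|].
      apply continuous_Rinv_comp; [|lra]. apply (ex_derive_continuous rho), Hr. }
    assert (T1 : continuous (Derive theta) x) by apply Ht.
    split.
    - apply continuous_ext with (fun t => (Re (Kf nu (y t) ^ 2) * (Derive rho t / rho t) - Im (Kf nu (y t) ^ 2) * Derive theta t)%R).
      { intros t. unfold f. rewrite re_mult. reflexivity. }
      apply (continuous_minus (fun t => (Re (Kf nu (y t) ^ 2) * (Derive rho t / rho t))%R) (fun t => (Im (Kf nu (y t) ^ 2) * Derive theta t)%R)).
      + now apply (continuous_mult (fun t => Re (Kf nu (y t) ^ 2)) (fun t => Derive rho t / rho t)%R).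
      + now apply (continuous_mult (fun t => Im (Kf nu (y t) ^ 2)) (Derive theta)).
    - apply continuous_ext with (fun t => (Re (Kf nu (y t) ^ 2) * Derive theta t + Im (Kf nu (y t) ^ 2) * (Derive rho t / rho t))%R).
      { intros t. unfold f. rewrite im_mult. reflexivity. }
      apply (continuous_plus (fun t => (Re (Kf nu (y t) ^ 2) * Derive theta t)%R) (fun t => (Im (Kf nu (y t) ^ 2) * (Derive rho t / rho t))%R)).
      + now apply (continuous_mult (fun t => Re (Kf nu (y t) ^ 2)) (Derive theta)).
      + now apply (continuous_mult (fun t => Im (Kf nu (y t) ^ 2)) (fun t => Derive rho t / rho t)%R). }
  rewrite (Ey a), (Ey b) by lra.
  replace (FK nu (y a) - FK nu (y b)) with (F b - F a) by (unfold F; ring).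
  (* Equality is needed only inside the interval, where gamma coincides with rho and theta near x.
     At a breakpoint the path may have a corner and [path_velocity] no meaning. *)
  revert I. apply is_RInt_ext. rewrite Rmin_left, Rmax_right by auto. intros x Hx.
  assert (Hx' : (a <= x <= b)%R) by lra. assert (P := Hrho x Hx').
  destruct (Hg x Hx') as [E1 E2].
  unfold f, path_integrand. rewrite besselK_Kf by auto. rewrite Ey by auto.
  assert (Loc : locally x (fun t => (a <= t <= b)%R)).
  { assert (Hd : (0 < Rmin (x - a) (b - x))%R) by (apply Rmin_pos; lra).
    exists (mkposreal _ Hd). intros t Bt. unfold ball in Bt; simpl in Bt.
    unfold AbsRing_ball, abs, minus, plus, opp in Bt; simpl in Bt.
    assert (m1 := Rmin_l (x - a) (b - x)). assert (m2 := Rmin_r (x - a) (b - x)).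
    apply Rabs_def2 in Bt. lra. }
  assert (V : path_velocity gamma x = cval (gamma x) * y' x).
  { destruct (Hr x) as [R1 _]. destruct (Ht x) as [T1 _].
    unfold path_velocity. apply C_eq.
    - simpl Re at 1. rewrite (Derive_ext_loc _ (fun t => rho t * cos (theta t))%R).
      + apply is_derive_unique. rewrite re_mult. unfold cval. rewrite E1, E2. simpl.
        auto_derive; [auto|]. change (Derive (fun u => rho u) x) with (Derive rho x).
        change (Derive (fun u => theta u) x) with (Derive theta x). field. lra.
      + revert Loc. apply filter_imp. intros t Bt. destruct (Hg t Bt) as [F1 F2].
        unfold cval. rewrite F1, F2. simpl. ring.
    - simpl Im at 1. rewrite (Derive_ext_loc _ (fun t => rho t * sin (theta t))%R).
      + apply is_derive_unique. rewrite im_mult. unfold cval. rewrite E1, E2. simpl.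
        auto_derive; [auto|]. change (Derive (fun u => rho u) x) with (Derive rho x).
        change (Derive (fun u => theta u) x) with (Derive theta x). field. lra.
      + revert Loc. apply filter_imp. intros t Bt. destruct (Hg t Bt) as [F1 F2].
        unfold cval. rewrite F1, F2. simpl. ring. }
  rewrite V. assert (N : cval (gamma x) <> 0).
  { rewrite cval_Cexp by auto. apply Cexp_neq_0. }
  match goal with |- ?u = ?v => change (@eq C u v) end. field. auto.
Qed.

Lemma path_finite nu gamma : nonint nu -> piecewise_C1 gamma ->
  (forall s, (0 <= s)%R -> (0 < cmod (gamma s))%R) -> forall T, (0 <= T)%R ->
  is_RInt (V := C_R_NormedModule) (path_integrand nu gamma) 0 T
    (FK nu (clog (chalf (gamma 0%R))) - FK nu (clog (chalf (gamma T)))).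
Proof.
  intros Hn [b [b0 [Hinc [Hlim Hp]]]] Hpos T HT.
  assert (Hb : forall n, (0 <= b n)%R).
  { induction n as [|n IH]; [rewrite b0; lra|]. assert (X := Hinc n). lra. }
  assert (Piece : forall n t, (b n <= t <= b (S n))%R ->
    is_RInt (V := C_R_NormedModule) (path_integrand nu gamma) (b n) t
    (FK nu (clog (chalf (gamma (b n)))) - FK nu (clog (chalf (gamma t))))).
  { intros n t Ht. destruct (Hp n) as [rho [theta [H1 [H2 H3]]]].
    apply path_piece with rho theta; auto; [lra | |].
    - intros x Hx. apply H3. lra.
    - intros x Hx. apply Hpos. specialize (Hb n). lra. }
  assert (Glue : forall u v w, is_RInt (V := C_R_NormedModule) (path_integrand nu gamma) 0 u
      (FK nu (clog (chalf (gamma 0%R))) - v) ->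
    forall t, is_RInt (V := C_R_NormedModule) (path_integrand nu gamma) u t (v - w) ->
    is_RInt (V := C_R_NormedModule) (path_integrand nu gamma) 0 t (FK nu (clog (chalf (gamma 0%R))) - w)).
  { intros u v w A t B. assert (K := is_RInt_Chasles _ _ _ _ _ _ A B).
    replace (FK nu (clog (chalf (gamma 0%R))) - w) with
      (plus (G := C_R_NormedModule) (FK nu (clog (chalf (gamma 0%R))) - v) (v - w)); [exact K|].
    change (FK nu (clog (chalf (gamma 0%R))) - v + (v - w) = FK nu (clog (chalf (gamma 0%R))) - w). ring. }
  assert (Full : forall n, is_RInt (V := C_R_NormedModule) (path_integrand nu gamma) 0 (b n)
    (FK nu (clog (chalf (gamma 0%R))) - FK nu (clog (chalf (gamma (b n)))))).
  { induction n as [|n IH].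
    - rewrite b0. replace (FK nu (clog (chalf (gamma 0%R))) - FK nu (clog (chalf (gamma 0%R)))) with (RtoC 0) by ring.
      apply (is_RInt_point (V := C_R_NormedModule)).
    - apply (Glue (b n) _ _ IH). apply Piece. assert (X := Hinc n). lra. }
  assert (Ex : exists n, (b n <= T <= b (S n))%R).
  { apply is_lim_seq_spec in Hlim. destruct (Hlim T) as [N HN].
    assert (X : forall n, (T < b n)%R -> exists k, (b k <= T <= b (S k))%R).
    { induction n as [|n IH]; intros Hlt; [rewrite b0 in Hlt; lra|].
      destruct (Rle_dec (b n) T) as [L|L]; [exists n; lra | apply IH; lra]. }
    apply (X N). apply HN. lia. }
  destruct Ex as [n Hn']. apply (Glue (b n) _ _ (Full n)). apply Piece. lra.
Qed.

Lemma FK_path_lim nu gamma : nonint nu ->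
  (forall s, (0 <= s)%R -> (0 < cmod (gamma s))%R) ->
  is_lim (fun s => cmod (gamma s)) p_infty p_infty -> is_lim (fun s => carg (gamma s)) p_infty 0%R ->
  Clim (Rbar_locally p_infty) (fun s => FK nu (clog (chalf (gamma s)))) 0.
Proof.
  intros Hn Hpos Hm Ha. assert (Hn' := nonint_opp nu Hn).
  replace (RtoC 0) with (- (RtoC PI ^ 2 / (4 * Csin (RtoC PI * nu) ^ 2)) * 0) by ring.
  apply Clim_mult; [apply Clim_const|]. intros eps He.
  destruct (LKprim_decay nu (rGam_neq_0 _ Hn) (rGam_neq_0 _ Hn') (nonint_nonperiodic _ Hn) eps He) as [y0 Hy].
  apply is_lim_spec in Hm. apply is_lim_spec in Ha.
  assert (q4 : (0 < 1 / 4)%R) by lra.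
  assert (A1 := Hm (2 * exp y0)%R). assert (A2 := Ha (mkposreal _ q4)).
  assert (A3 : Rbar_locally p_infty (fun s => (0 <= s)%R)) by (exists 0%R; intros; lra).
  generalize (filter_and _ _ A1 (filter_and _ _ A2 A3)). apply filter_imp.
  intros s [B1 [B2 B3]]. simpl in B2. rewrite Rminus_0_r in B2.
  replace (LKprim nu (clog (chalf (gamma s))) - 0) with (LKprim nu (clog (chalf (gamma s)))) by ring.
  assert (P := exp_pos y0).
  replace (clog (chalf (gamma s))) with (RtoC (ln (cmod (gamma s) / 2)) + Ci * RtoC (carg (gamma s))).
  - apply Hy; [|lra]. rewrite <- (ln_exp y0). apply ln_le; lra.
  - apply C_eq; simpl; ring.
Qed.

Lemma path_integral_FK nu gamma : nonint nu -> piecewise_C1 gamma ->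
  (forall s, (0 <= s)%R -> (0 < cmod (gamma s))%R) ->
  is_lim (fun s => cmod (gamma s)) p_infty p_infty -> is_lim (fun s => carg (gamma s)) p_infty 0%R ->
  is_path_integral (fun t => besselK nu t ^ 2 / cval t) gamma (FK nu (clog (chalf (gamma 0%R)))).
Proof.
  intros Hn Hp Hpos Hm Ha.
  assert (L := FK_path_lim nu gamma Hn Hpos Hm Ha).
  set (l := FK nu (clog (chalf (gamma 0%R)))) in *.
  assert (L' : Clim (Rbar_locally p_infty) (fun s => l - FK nu (clog (chalf (gamma s)))) l).
  { apply Clim_eq with (l - 0); [|ring]. apply Clim_minus; [apply Clim_const | exact L]. }
  apply (proj1 (Clim_filterlim _ _ _)) in L'.
  intros P HP.
  exists (fun u => u = 0%R) (fun s => (0 <= s)%R /\ P (l - FK nu (clog (chalf (gamma s))))).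
  - reflexivity.
  - apply filter_and; [exists 0%R; intros; lra | exact (L' P HP)].
  - intros u s -> [Hs HPs]. eexists. split; [|exact HPs]. simpl.
    exact (path_finite nu gamma Hn Hp Hpos s Hs).
Qed.

(** * The limit of the closed form at half-integral orders *)

Lemma nonint_double_near nu : @locally' C_UniformSpace nu (fun n => nonint (2 * n)) .
Proof.
  apply locally'_Cmod.
  destruct (classic (nonint (2 * nu))) as [H|H].
  (* Integers beyond N + 1 in absolute value lie at distance at least 1 from 2 nu; the remaining
     ones are finitely many and have a least distance d. *)
  - destruct (nfloor_ex (Cmod (2 * nu) + 2) ltac:(assert (X := Cmod_ge_0 (2 * nu)); lra)) as [N [_ HN]].
    assert (X : forall k : nat, exists d, (0 < d)%R /\ forall m : Z, (Z.abs m <= Z.of_nat k)%Z -> (d <= Cmod (2 * nu - RtoC (IZR m)))%R).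
    { induction k as [|k [d [D IH]]].
      - exists (Cmod (2 * nu - RtoC (IZR 0))). split; [apply Cmod_gt_0, Cminus_eq_contra, H|].
        intros m Hk. replace m with 0%Z by lia. apply Rle_refl.
      - exists (Rmin d (Rmin (Cmod (2 * nu - RtoC (IZR (Z.of_nat (S k))))) (Cmod (2 * nu - RtoC (IZR (- Z.of_nat (S k))))))).
        split; [repeat apply Rmin_pos; auto; apply Cmod_gt_0, Cminus_eq_contra, H|].
        intros m Hk. destruct (Z.eq_dec m (Z.of_nat (S k))) as [->|N1].
        { eapply Rle_trans; [apply Rmin_r | apply Rmin_l]. }
        destruct (Z.eq_dec m (- Z.of_nat (S k))) as [->|N2].
        { eapply Rle_trans; [apply Rmin_r | apply Rmin_r]. }
        eapply Rle_trans; [apply Rmin_l | apply IH; lia]. }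
    destruct (X (S N)) as [d [D Hd]]. exists (Rmin (d / 2) (1 / 2)). split; [apply Rmin_pos; lra|].
    intros w _ Hw m E.
    assert (w1 := Rlt_le_trans _ _ _ Hw (Rmin_l _ _)). assert (w2 := Rlt_le_trans _ _ _ Hw (Rmin_r _ _)).
    assert (K : (Cmod (2 * nu - RtoC (IZR m)) < d)%R /\ (Cmod (2 * nu - RtoC (IZR m)) < 1)%R).
    { rewrite <- E. replace (2 * nu - 2 * w) with (2 * (nu - w)) by ring.
      rewrite Cmod_mult, Cmod_RtoC_pos, Cmod_sub_comm by lra. lra. }
    destruct (Z_le_dec (Z.abs m) (Z.of_nat (S N))) as [L|L].
    + specialize (Hd m L). lra.
    + assert (T := Cmod_triangle_rev (RtoC (IZR m)) (2 * nu)). rewrite (Cmod_sub_comm (RtoC _)), (Cmod_R (IZR m)) in T.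
      rewrite <- abs_IZR in T. assert (Lz : (IZR (Z.of_nat (S N)) <= IZR (Z.abs m))%R) by (apply IZR_le; lia).
      rewrite <- INR_IZR_INZ, S_INR in Lz. lra.
  - apply not_all_ex_not in H. destruct H as [m0 H]. apply NNPP in H.
    (* Within this radius 2 w stays at distance less than 1 from the integer 2 nu, so it could only
       be that integer, and then w = nu. *)
    exists (1 / 2)%R. split; [lra|]. intros w Nw Hw m E. apply Nw.
    assert (E2 : (Rabs (IZR (m - m0)) < 1)%R).
    { rewrite <- Cmod_R, minus_IZR, RtoC_minus, <- E, <- H.
      replace (2 * w - 2 * nu) with (2 * (w - nu)) by ring. rewrite Cmod_mult, Cmod_RtoC_pos; lra. }
    rewrite <- abs_IZR in E2. apply (lt_IZR _ 1) in E2. assert (Em : m = m0) by lia.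
    rewrite Em, <- H in E.
    replace w with (2 * w / 2) by (field; nz). rewrite E. field; nz.
Qed.

Lemma FK_cont nu y : nonint nu -> Clim (@locally' C_UniformSpace nu) (fun n => FK n y) (FK nu y).
Proof.
  intros Hn. assert (Hs := Csin_PI_neq_0 nu Hn).
  assert (K : Clim (@locally' C_UniformSpace nu) (fun n => Csin (RtoC PI * n)) (Csin (RtoC PI * nu))).
  { apply (Clim_locally _ Csin (fun n => RtoC PI * n) (RtoC PI * nu) _ _ (Cdiff_Csin _)).
    apply Clim_mult; [apply Clim_const | apply Clim_id_locally']. }
  unfold FK. apply Clim_mult; [|apply LKprim_cont; now apply nonint_nonperiodic].
  apply Clim_opp. apply Clim_div; [apply Clim_const | |].
  - apply Clim_mult; [apply Clim_const|]. now apply Clim_pow.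
  - apply Cmult_neq_0; [apply C4_neq_0 | now apply Cpow_nz].
Qed.

Theorem theorem6 :
  forall (z : cpoint) (nu : C) (gamma : R -> cpoint),
  in_cut_plane z ->
  (forall m : Z, nu <> RtoC (IZR m)) ->
  nu <> 1 / 2 -> nu <> - (1 / 2) -> nu <> 3 / 2 -> nu <> - (3 / 2) ->
  path_to_infinity z gamma ->
  let rhs (n : C) : C :=
    1 / (8 * n) *
    (cpower (chalf z) (- (2 * n)) * Gamma n ^ 2
       * hypergeom [- n; 1 / 2 - n] [1 - n; 1 - n; 1 - 2 * n] (cval z ^ 2)
     - cpower (chalf z) (2 * n) * Gamma (- n) ^ 2
       * hypergeom [n; 1 / 2 + n] [1 + n; 1 + n; 1 + 2 * n] (cval z ^ 2)
     + 4 * RtoC PI * Ccsc (RtoC PI * n) *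
       (clog (chalf z)
        + cval z ^ 2 / (4 * (1 - n ^ 2))
          * hypergeom [RtoC 1; RtoC 1; 3 / 2] [RtoC 2; RtoC 2; 2 - n; 2 + n] (cval z ^ 2)
        - 1 / (2 * n) - digamma n - RtoC PI / 2 * Ccot (RtoC PI * n))) in
  let is_lhs (l : C) : Prop :=
    is_path_integral (fun t => besselK nu t ^ 2 / cval t) gamma l in
  (* the hypergeometric series are defined at nu *)
  ((forall m : Z, 2 * nu <> RtoC (IZR m)) -> is_lhs (rhs nu)) /\
  (* a denominator parameter 1 - 2 nu or 1 + 2 nu is a nonpositive integer:
     the right-hand side is taken as its limit at nu *)
  ((exists m : Z, 2 * nu = RtoC (IZR m)) ->
     exists l : C, is_C_lim rhs nu l /\ is_lhs l).
Proof.
  intros z nu gamma [Hz _] Hn _ _ _ _ [H0 [Hcut [Hp [Hm Ha]]]] rhs is_lhs.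
  assert (Hpos : forall s, (0 <= s)%R -> (0 < cmod (gamma s))%R) by (intros s Hs; apply (Hcut s Hs)).
  assert (Hrhs : forall n, nonint (2 * n) -> rhs n = FK n (clog (chalf z))).
  { intros n H. unfold rhs, cpower. rewrite cval_sq by auto. now apply FK_hypergeom. }
  (* The integral is [FK] for every nonintegral nu, half-integers included; only its hypergeometric
     expression requires 2 nu to be nonintegral. *)
  assert (Hint : is_lhs (FK nu (clog (chalf z)))).
  { unfold is_lhs. rewrite <- H0. now apply path_integral_FK. }
  split.
  - intros H. now rewrite Hrhs.
  - intros _. exists (FK nu (clog (chalf z))). split; auto.
    apply (proj1 (Clim_filterlim (@locally' C_UniformSpace nu) rhs (FK nu (clog (chalf z))))).
    (* [rhs] and [FK] agree on a punctured neighbourhood of nu, and a limit over [locally'] ignores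
       the value at nu itself. *)
    apply Clim_ext_loc with (2 := FK_cont nu (clog (chalf z)) Hn).
    generalize (nonint_double_near nu). apply filter_imp. intros n H. symmetry. now apply Hrhs.
Qed.
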